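(* Let $f:\mathbb{R}^2\to\mathbb{R}$, $f(y_1,y_2)=\frac{1}{3}y_1^3-y_1y_2^2$ (the elliptic umbilic in dimension 2), which is the generating function of the Lagrangian map $(y_1,y_2)\mapsto (x_1,x_2)=(y_1^2-y_2^2,\,-2y_1y_2)$. For a generic and sufficiently small perturbation $f'\in C^\infty(\mathbb{R}^2)$, the function $\tilde f=f+f'$ has caustic diffeomorphic to a tricuspoid.
   Context: Consider the Lagrangian fibration $\mathbb{R}^4\to\mathbb{R}^2$ with coordinates $(x_1,x_2)$ on the base and $(y_1,y_2)$ on the fibres. A function $g\in C^\infty(\mathbb{R}^2)$ in the fibre variables is the generating function of the Lagrangian submanifold $L_g=\{(y,x): x=\nabla g(y)\}$; the associated Lagrangian map is the projection of $L_g$ to the base, i.e. $y\mapsto x=\nabla g(y)$, and the caustic of $g$ is the set of critical values of this map, i.e. $\{\nabla g(y): \det \mathrm{Hess}\, g(y)=0\}\subset\mathbb{R}^2$. $C^\infty(\mathbb{R}^2)$ carries the Whitney $C^\infty$ topology; ''small'' means belonging to a suitable neighbourhood of $0$ in this topology. A property $P$ of smooth functions is generic if the set of functions satisfying $P$ contains a residual subset and is closed under Lagrangian equivalence (two Lagrangian maps are Lagrangian equivalent if there is a fibre-preserving symplectic diffeomorphism of the Lagrangian bundles taking one Lagrangian submanifold to the other). The tricuspoid (deltoid) is the closed plane curve with exactly three cusps joined by three smooth arcs, e.g. $\{2e^{i\theta}+e^{-2i\theta}:\theta\in\mathbb{R}\}\subset\mathbb{C}\cong\mathbb{R}^2$.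 Two subsets of the plane are diffeomorphic here if a diffeomorphism of the plane carries one to the other. *)

(* Defs.v *)
From HB Require Import structures.
From mathcomp Require Import all_boot all_order all_algebra.
From mathcomp Require Import all_classical all_reals all_analysis.

Set Implicit Arguments.
Unset Strict Implicit.
Unset Printing Implicit Defensive.

Import Order.TTheory GRing.Theory Num.Theory.
Import numFieldNormedType.Exports.

Local Open Scope classical_set_scope.
Local Open Scope ring_scope.

Section SmoothFunctions.
Context {R : realType}.

Definition partial n (i : 'I_n) (f : 'rV[R]_n -> R) : 'rV[R]_n -> R :=
  fun x => 'D_(delta_mx 0 i) f x.

(* iter_partial [:: i; j; ...] f = d_i (d_j (... f)) *)
Definition iter_partial n (s : seq 'I_n) (f : 'rV[R]_n -> R) : 'rV[R]_n -> R :=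
  foldr (@partial n) f s.

(* C^oo in the classical sense: all iterated partial derivatives exist and are
   continuous; the existence clause is needed because 'D is a total operator. *)
Definition smooth n (f : 'rV[R]_n -> R) : Prop :=
  forall s : seq 'I_n,
    continuous (iter_partial s f) /\
    forall (i : 'I_n) x, derivable (iter_partial s f) x (delta_mx 0 i).

Definition smooth_map n m (F : 'rV[R]_n -> 'rV[R]_m) : Prop :=
  forall j : 'I_m, smooth (fun x => F x 0 j).

Definition diffeomorphism n (F : 'rV[R]_n -> 'rV[R]_n) : Prop :=
  smooth_map F /\
  exists G : 'rV[R]_n -> 'rV[R]_n, [/\ smooth_map G, cancel F G & cancel G F].

Definition diffeomorphic_sets n (A B : set 'rV[R]_n) : Prop :=
  exists2 F, diffeomorphism F & F @` A = B.

Lemma smooth_coind n (S : set ('rV[R]_n -> R)) :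
  (forall f, S f -> [/\ continuous f,
     forall i x, derivable f x (delta_mx 0 i) &
     forall i, S (partial i f)]) ->
  forall f, S f -> smooth f.
Proof.
move=> HS f Sf s; elim/last_ind: s f Sf => [|s i IH] f Sf.
  by have [cf df _] := HS f Sf.
have [_ _ pf] := HS f Sf.
by rewrite /iter_partial foldr_rcons; apply: IH.
Qed.

Lemma smooth_partial n (f : 'rV[R]_n -> R) i : smooth f -> smooth (partial i f).
Proof.
move=> sf s; have := sf (rcons s i).
by rewrite /iter_partial foldr_rcons.
Qed.

Inductive smooth_closure n : ('rV[R]_n -> R) -> Prop :=
| Sbase f : smooth f -> smooth_closure f
| Sadd f g : smooth_closure f -> smooth_closure g -> smooth_closure (f \+ g)
| Smul f g : smooth_closure f -> smooth_closure g -> smooth_closure (f \* g).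

Lemma smooth_closureP n (f : 'rV[R]_n -> R) : smooth_closure f -> smooth f.
Proof.
apply: smooth_coind => {}f; elim=> {f}.
- move=> f sf; have [cf df] := sf [::]; split=> // i.
  exact/Sbase/smooth_partial.
- move=> f g Sf [cf df pf] Sg [cg dg pg]; split=> [x|i x|i].
  + by apply: continuousD; [exact: cf | exact: cg].
  + exact: derivableD.
  + rewrite (_ : partial i _ = partial i f \+ partial i g); first exact: Sadd.
    by apply/funext => x; rewrite /partial /= deriveD.
- move=> f g Sf [cf df pf] Sg [cg dg pg]; split=> [x|i x|i].
  + by apply: continuousM; [exact: cf | exact: cg].
  + exact: derivableM.
  + rewrite (_ : partial i _ =
      (f \* partial i g) \+ (g \* partial i f)).
      by apply: Sadd; apply: Smul.
    by apply/funext => x; rewrite /partial /= deriveM.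
Qed.

Lemma smoothD n (f g : 'rV[R]_n -> R) : smooth f -> smooth g -> smooth (f \+ g).
Proof. by move=> sf sg; apply/smooth_closureP/Sadd; exact: Sbase. Qed.

Lemma smoothM n (f g : 'rV[R]_n -> R) : smooth f -> smooth g -> smooth (f \* g).
Proof. by move=> sf sg; apply/smooth_closureP/Smul; exact: Sbase. Qed.

Lemma smooth_cst n (c : R) : smooth (fun _ : 'rV[R]_n => c).
Proof.
apply: (@smooth_coind n [set f | exists c, f = fun=> c]); last by exists c.
move=> _ [d ->]; split=> [x|i x|i]; [exact: cst_continuous|exact: derivable_cst|].
by exists 0; apply/funext => x; rewrite /partial derive_cst.
Qed.

Lemma smooth_coord n (j : 'I_n) : smooth (fun x : 'rV[R]_n => x 0 j).
Proof.
have dc x : differentiable (fun x : 'rV[R]_n => x 0 j) x.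
  exact: differentiable_coord.
apply: (@smooth_coind n ([set f | exists c, f = fun=> c] `|`
   [set (fun x : 'rV[R]_n => x 0 j)])); last by right.
move=> f [[d ->]|->]; split=> [x|i x|i].
- exact: cst_continuous.
- exact: derivable_cst.
- by left; exists 0; apply/funext => x; rewrite /partial derive_cst.
- exact: coord_continuous.
- exact/diff_derivable.
- left; exists ((delta_mx 0 i : 'rV[R]_n) 0 j); apply/funext => x.
  rewrite /partial; apply: cvg_lim => //.
  have : (fun=> (delta_mx 0 i : 'rV[R]_n) 0 j) @ (0:R)^' -->
    (delta_mx 0 i : 'rV[R]_n) 0 j by exact: cvg_cst.
  apply: cvg_trans; apply: near_eq_cvg.
  near=> h; rewrite /= !mxE addrK scalerA mulVf ?scale1r //.
  by near: h; exact: nbhs_dnbhs_neq.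
Unshelve. all: by end_near. Qed.

Lemma smoothN n (f : 'rV[R]_n -> R) : smooth f -> smooth (\- f).
Proof.
move=> sf; have -> : \- f = (fun=> -1) \* f.
  by apply/funext => x /=; rewrite mulN1r.
by apply: (@smoothM n (fun=> -1) f) => //; exact: smooth_cst.
Qed.

End SmoothFunctions.

Definition smooth_pred (R : realType) n : {pred 'rV[R]_n -> R} :=
  [pred f | `[< smooth f >]].

Lemma smooth_zmod_closed (R : realType) n : zmod_closed (@smooth_pred R n).
Proof.
split=> [|f g]; first by apply/asboolP; exact: (@smooth_cst R n 0).
by move=> /asboolP sf /asboolP sg; apply/asboolP/smoothD/smoothN.
Qed.

HB.instance Definition _ (R : realType) n :=
  GRing.isZmodClosed.Build ('rV[R]_n -> R) (@smooth_pred R n)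
    (@smooth_zmod_closed R n).

Record Cinfty (R : realType) (n : nat) := MkCinfty {
  cinfty_fun :> 'rV[R]_n -> R ;
  cinfty_smooth : cinfty_fun \in @smooth_pred R n
}.

HB.instance Definition _ (R : realType) n :=
  [isSub for @cinfty_fun R n].
HB.instance Definition _ (R : realType) n := [Choice of Cinfty R n by <:].
HB.instance Definition _ (R : realType) n :=
  [SubChoice_isSubZmodule of Cinfty R n by <:].

Section WhitneyTopology.
Context {R : realType} {n : nat}.
Implicit Types (g h : Cinfty R n) (A : set (Cinfty R n)).

(* h is delta-close to g in the strong C^k sense; the error function delta may
   tend to 0 arbitrarily fast at infinity. *)
Definition whitney_ball (k : nat) (delta : 'rV[R]_n -> R) g : set (Cinfty R n) :=
  [set h | forall s : seq 'I_n, (size s <= k)%N ->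
     forall y, `|iter_partial s h y - iter_partial s g y| < delta y].

(* Open sets of the Whitney C^oo topology: the union over k of the Whitney C^k
   topologies generates it, and a C^k neighbourhood base at g is given by the
   balls above, delta ranging over the positive continuous functions. *)
Definition whitney_open A : Prop :=
  forall g, A g -> exists (k : nat) (delta : 'rV[R]_n -> R),
    [/\ continuous delta, forall y, 0 < delta y & whitney_ball k delta g `<=` A].

Lemma whitney_openT : whitney_open setT.
Proof.
move=> g _; exists 0%N, (fun=> 1); split=> // y; exact: cst_continuous.
Qed.

Lemma whitney_openI : setI_closed whitney_open.
Proof.
move=> A B oA oB g [/oA [k [d [cd d0 dA]]] /oB [l [e [ce e0 eB]]]].
exists (maxn k l), (fun y => Order.min (d y) (e y)); split.
- by move=> y; apply: continuous_min; [exact: cd | exact: ce].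
- by move=> y; rewrite lt_min d0 e0.
- move=> h H; split; [apply: dA | apply: eB] => s sk y.
    have := H s (leq_trans sk (leq_maxl _ _)) y.
    by rewrite lt_min => /andP[].
  have := H s (leq_trans sk (leq_maxr _ _)) y.
  by rewrite lt_min => /andP[].
Qed.

Lemma whitney_open_bigcup (I : Type) (F : I -> set (Cinfty R n)) :
  (forall i, whitney_open (F i)) -> whitney_open (\bigcup_i F i).
Proof.
move=> oF g [i _ Fig]; have [k [d [cd d0 dF]]] := oF i g Fig.
by exists k, d; split=> // h /dF Fih; exists i.
Qed.

HB.instance Definition _ := isOpenTopological.Build (Cinfty R n)
  whitney_openT whitney_openI whitney_open_bigcup.

End WhitneyTopology.

Definition contains_residual (T : topologicalType) (P : set T) : Prop :=
  exists2 G : nat -> set T,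
    forall i, open (G i) /\ dense (G i) & \bigcap_i G i `<=` P.

Section LagrangianMaps.
Context {R : realType}.

Definition gradient n (g : 'rV[R]_n -> R) (y : 'rV[R]_n) : 'rV[R]_n :=
  \row_i partial i g y.

Definition hessian n (g : 'rV[R]_n -> R) (y : 'rV[R]_n) : 'M[R]_n :=
  \matrix_(i, j) partial i (partial j g) y.

Definition caustic n (g : 'rV[R]_n -> R) : set 'rV[R]_n :=
  gradient g @` [set y | \det (hessian g y) = 0].

(* A point of the total space is row_mx y x: fibre coordinates y first, base
   coordinates x last, so that the Lagrangian projection is rsubmx. *)
Definition lagrangian_graph n (g : 'rV[R]_n -> R) : set 'rV[R]_(n + n) :=
  [set row_mx y (gradient g y) | y in setT].

(* sum_i dx_i /\ dy_i *)
Definition symplectic_form n (u v : 'rV[R]_(n + n)) : R :=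
  \sum_(i < n) (rsubmx u 0 i * lsubmx v 0 i - lsubmx u 0 i * rsubmx v 0 i).

Definition symplectic n (Phi : 'rV[R]_(n + n) -> 'rV[R]_(n + n)) : Prop :=
  forall p u v,
    symplectic_form ('D_u Phi p) ('D_v Phi p) = symplectic_form u v.

Definition fibre_preserving n (Phi : 'rV[R]_(n + n) -> 'rV[R]_(n + n)) : Prop :=
  exists2 phi : 'rV[R]_n -> 'rV[R]_n, diffeomorphism phi &
    forall p, rsubmx (Phi p) = phi (rsubmx p).

Definition lagrangian_equivalent n (g h : 'rV[R]_n -> R) : Prop :=
  exists Phi : 'rV[R]_(n + n) -> 'rV[R]_(n + n),
    [/\ diffeomorphism Phi, symplectic Phi, fibre_preserving Phi &
        Phi @` lagrangian_graph g = lagrangian_graph h].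

Definition generic n (P : set (Cinfty R n)) : Prop :=
  contains_residual P /\
  forall g h : Cinfty R n, lagrangian_equivalent g h -> P g -> P h.

Definition vec2 (a b : R) : 'rV[R]_2 := \row_(i < 2) (if i == 0 then a else b).

(* {2 e^(i t) + e^(-2 i t)} in real coordinates *)
Definition tricuspoid : set 'rV[R]_2 :=
  [set vec2 (2 * cos t + cos (2 * t)) (2 * sin t - sin (2 * t)) | t in setT].

Definition elliptic_umbilic_fun (y : 'rV[R]_2) : R :=
  3^-1 * y 0 0 ^+ 3 - y 0 0 * y 0 1 ^+ 2.

Lemma elliptic_umbilic_smooth : elliptic_umbilic_fun \in @smooth_pred R 2.
Proof.
apply/asboolP.
have s0 := @smooth_coord R 2 0; have s1 := @smooth_coord R 2 1.
have -> : elliptic_umbilic_fun =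
    ((fun=> 3^-1) \* ((fun y : 'rV[R]_2 => y 0 0) \*
       ((fun y => y 0 0) \* (fun y => y 0 0)))) \+
    (\- ((fun y => y 0 0) \* ((fun y => y 0 1) \* (fun y => y 0 1)))).
  by apply/funext => y; rewrite /elliptic_umbilic_fun !exprS expr0 !mulr1.
by apply: smoothD; [exact: smoothM (smooth_cst _) (smoothM s0 (smoothM s0 s0))|
  exact: smoothN (smoothM s0 (smoothM s1 s1))].
Qed.

Definition elliptic_umbilic : Cinfty R 2 := MkCinfty elliptic_umbilic_smooth.

End LagrangianMaps.

(* Main.v *)
(* The Hessian of a perturbation g = f + h is [[T + 2 e0, - 2 e1], [- 2 e1, T - 2 e0]], where T is small and
   e is close to the identity map.  Let y0 be the zero of e.  If T(y0) = 0, then y0 is the only critical point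
   and the Hessian vanishes there; functions with this property form a set that is invariant under Lagrangian
   equivalence (the Hessian changes by invertible factors) and whose complement contains a dense open set: a
   bump function at y0 makes the Hessian determinant take both signs, which is an open condition and is
   impossible in the exceptional set, because the plane minus a point is connected.
   If eps = T(y0) <> 0, rescale by eps around y0.  The critical set becomes a smooth closed curve close to the
   circle |z| = 1/2, with parametrization G(q / 2) for q in the unit circle, and the rescaled map tends with
   all its derivatives to the quadratic map with deltoid caustic q |-> 2 q + conj(q)^2.  The rank one Jacobian
   forces zeros of the velocity of the perturbed caustic near the three cusps, and a small reparametrization of
   the circle moves them to the cusp parameters.  The difference between the perturbed caustic and the deltoid
   is then a small function on the circle whose derivative vanishes at the cusps, and such a function extends
   through the deltoid to a small smooth displacement of the plane; the identity plus this displacement is a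
   diffeomorphism.  Smallness is handled by sequences: a sequence of perturbations tending to 0 is a family
   indexed by option nat, continuous at None with all derivatives. *)

Require Import Defs.
From HB Require Import structures.
From mathcomp Require Import all_boot all_order all_algebra.
From mathcomp Require Import all_classical all_reals all_analysis.
From mathcomp Require Import ring lra zify.

Set Implicit Arguments.
Unset Strict Implicit.
Unset Printing Implicit Defensive.

Import Order.TTheory GRing.Theory Num.Theory.
Import numFieldNormedType.Exports.

Local Open Scope classical_set_scope.
Local Open Scope ring_scope.

(** * Calculus in several variables and families of smooth functions *)

Section Calculus.
Context {R : realType}.

(** No lower bound on |eps| is available, so smallness cannot come from comparing the perturbation
    with eps. What saves the rescaling is that the rescaled second derivatives are difference
    quotients of step eps: the third derivatives of the perturbation bound them whatever eps is, and
    further differentiation only produces factors eps. On the side of the deltoid the obstacle is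
    the cusps: near a cusp with parameter u the plane sees u only through u^2 and u^3, so a function
    on the circle extends smoothly when it has the form A(u^2) + u^3 B(u^2), which amounts to a zero
    derivative at u = 0; Borel's lemma and flat functions supply A and B. The extension must also be
    small in C^1, which is why Borel's lemma is proved with bounds. Sequences are enough because
    failure in every neighbourhood given by bounds on finitely many derivatives yields a sequence of
    counterexamples, and it suffices to refute one of its terms. *)

Lemma coord_le_norm n (x : 'rV[R]_n) i : `|x 0 i| <= `|x|.
Proof.
rewrite [leRHS]/Num.Def.normr/= mx_normrE.
exact: (le_bigmax _ (fun ij : 'I_1 * 'I_n => `|x ij.1 ij.2|) (0, i)).
Qed.

Lemma rV_norm_le n (x : 'rV[R]_n) c : 0 <= c -> (forall i, `|x 0 i| <= c) -> `|x| <= c.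
Proof.
move=> c0 xc; rewrite [leLHS]/Num.Def.normr/= mx_normrE.
by apply: bigmax_le => // -[i j] _ /=; rewrite (ord1 i).
Qed.

Lemma cvg_rV T (F : set_system T) (FF : Filter F) n (G : T -> 'rV[R]_n) (y : 'rV[R]_n) :
  (forall i, (fun p => G p 0 i) @ F --> y 0 i) -> G @ F --> y.
Proof.
move=> Gy; apply/cvgrPdist_le => e e0.
have : \forall p \near F, forall i, `|y 0 i - G p 0 i| <= e.
  by apply: filter_forall => i; exact: ((cvgrPdist_le _ _).1 (Gy i)).
apply: filterS => p yG; apply: rV_norm_le => [|i]; first exact: ltW.
by rewrite !mxE.
Qed.

Lemma continuous_rV (T : topologicalType) n (G : T -> 'rV[R]_n) (x : T) :
  (forall i, {for x, continuous (fun p => G p 0 i)}) -> {for x, continuous G}.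
Proof. by move=> Gx; apply: cvg_rV => i; exact: Gx. Qed.

(** Restriction to a line: through it, directional derivatives inherit the mean value theorem and
    the one-variable chain rule. *)
Lemma is_derive_lineP (V : normedModType R) (f : V -> R) (p v : V) (s : R) df :
  is_derive (p + s *: v) v f df <-> is_derive s 1 (fun t => f (p + t *: v)) df.
Proof.
have E : (fun h : R => h^-1 *: (((fun t => f (p + t *: v)) \o shift s) (h *: 1) -
    f (p + s *: v))) =
  (fun h : R => h^-1 *: ((f \o shift (p + s *: v)) (h *: v) - f (p + s *: v))).
  apply/funext => h; rewrite /= [_%:A]mulr1 scalerDl.
  by congr (_ *: (f _ - _)); rewrite addrC addrA addrAC.
split=> -[dfe dfv]; split.
- by rewrite /derivable E.
- by rewrite /derive E.
- by rewrite /derivable -E.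
- by rewrite /derive -E.
Qed.

Lemma MVT_between (f df : R -> R) (a b : R) :
  (forall x, Num.min a b <= x <= Num.max a b -> is_derive x 1 f (df x)) ->
  exists2 c, Num.min a b <= c <= Num.max a b & f b - f a = df c * (b - a).
Proof.
wlog ab : a b / a <= b => [W fd|].
  have /orP[ab|ba] := le_total a b; first exact: W.
  have [|c cab E] := W b a ba; first by rewrite minC maxC.
  by exists c; [rewrite minC maxC|rewrite -opprB E -mulrN opprB].
rewrite (min_idPl ab) (max_idPr ab) => fd.
have [| |c cab E] := @MVT_segment R f df a b ab.
- by move=> c; rewrite in_itv/= => /andP[/ltW ca /ltW cb]; apply: fd; rewrite ca.
- apply: derivable_within_continuous => x; rewrite in_itv/= => xab.
  by have [] := fd x xab.
by exists c => //; move: cab; rewrite in_itv.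
Qed.

Definition lin_form n (c : 'I_n -> R) (v : 'rV[R]_n) : R := \sum_i v 0 i * c i.

Lemma lin_form_bound n (c : 'I_n -> R) v : `|lin_form c v| <= `|v| * \sum_i `|c i|.
Proof.
rewrite /lin_form (le_trans (ler_norm_sum _ _ _))// mulr_sumr ler_sum// => i _.
by rewrite normrM ler_wpM2r// coord_le_norm.
Qed.

Lemma cvg_sumr T (F : set_system T) (FF : Filter F) p (f : 'I_p -> T -> R) (a : 'I_p -> R) :
  (forall k, f k @ F --> a k) -> (fun t => \sum_k f k t) @ F --> \sum_k a k.
Proof.
move=> fa; elim: (index_enum _) => [|k s IH].
  rewrite big_nil; under eq_fun do rewrite big_nil; exact: cvg_cst.
rewrite big_cons; under eq_fun do rewrite big_cons.
exact: (cvgD (fa k) IH).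
Qed.

Definition partials_exist n (f : 'rV[R]_n -> R) :=
  forall (i : 'I_n) x, derivable f x (delta_mx 0 i).

(** The points [pt k] take the first k coordinates from z and the others from x, so consecutive ones
    differ along one axis; the mean value theorem on each edge and continuity of the partial
    derivatives give the expansion. Dividing e by n + 1 rather than n covers n = 0. *)
Lemma partial_expand n (f : 'rV[R]_n -> R) (x : 'rV[R]_n) (e : R) :
    partials_exist f -> (forall i, {for x, continuous (partial i f)}) -> 0 < e ->
  \forall z \near x, `|f z - f x - lin_form (fun i => partial i f x) (z - x)| <= e * `|z - x|.
Proof.
move=> df cf e0.
pose e' := e / n.+1%:R.
have e'0 : 0 < e' by rewrite divr_gt0.
have : \forall y \near x, forall i, `|partial i f x - partial i f y| <= e'.
  apply: (@filter_forall _ _ (fun i y => `|partial i f x - partial i f y| <= e') (nbhs x)) => i.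
  by move/cvgrPdist_le : (cf i); apply.
case/nbhs_ballP => d /= d0 Hd.
near=> z.
pose pt k : 'rV[R]_n := \row_(i < n) (if (i < k)%N then z 0 i else x 0 i).
have ptS (k : 'I_n) : pt k.+1 = pt k + (z 0 k - x 0 k) *: delta_mx 0 k.
  apply/rowP => i; rewrite !mxE eqxx /= ltnS.
  have [->|nik] := eqVneq i k; first by rewrite leqnn ltnn mulr1 addrC subrK.
  by rewrite leq_eqVlt (inj_eq val_inj) (negbTE nik) mulr0 addr0.
have -> : f z - f x = \sum_(k < n) (f (pt k.+1) - f (pt k)).
  rewrite -(big_mkord xpredT (fun k => f (pt k.+1) - f (pt k))) telescope_sumr//.
  by congr (f _ - f _); apply/rowP => i; rewrite !mxE ?ltn_ord ?ltn0.
rewrite /lin_form -sumrB (le_trans (ler_norm_sum _ _ _))//.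
have -> : e * `|z - x| = \sum_(i < n.+1) e' * `|z - x|.
  by rewrite sumr_const card_ord -mulr_natr mulrAC /e' divfK ?pnatr_eq0.
rewrite big_ord_recl; apply: ler_wpDl; first by rewrite mulr_ge0// ltW.
apply: ler_sum => k _.
have [|s sP E] := @MVT_between (fun t => f (pt k + t *: delta_mx 0 k))
   (fun t => partial k f (pt k + t *: delta_mx 0 k)) 0 (z 0 k - x 0 k).
  by move=> t _; apply: (is_derive_lineP f _ _ _ _).1; exact/derivableP/df.
rewrite ptS; move: E; rewrite scale0r addr0 subr0 => ->.
rewrite !mxE mulrC -mulrBr normrM mulrC distrC.
apply: ler_pM => //; last by have := coord_le_norm (z - x) k; rewrite !mxE.
apply: (Hd _ _ k); rewrite mx_norm_ball /ball_ /=.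
apply: (@le_lt_trans _ _ `|z - x|); last first.
  by near: z; apply/nbhs_ballP; exists d => //= w; rewrite mx_norm_ball /ball_/= distrC.
apply: rV_norm_le => // i; rewrite !mxE eqxx /=.
have [->|nik] := eqVneq i k.
  rewrite ltnn mulr1 opprD addrA subrr add0r normrN.
  apply: le_trans (coord_le_norm (z - x) k); rewrite !mxE.
  move: sP; case: (lerP 0 (z 0 k - x 0 k)) => zx /andP[s1 s2].
    by rewrite !ger0_norm.
  by rewrite !ler0_norm ?lerN2// ltW.
rewrite mulr0 addr0; case: ifP => _; last by rewrite subrr normr0.
by rewrite distrC; have := coord_le_norm (z - x) i; rewrite !mxE.
Unshelve. all: by end_near. Qed.

(** Only derivatives of the coordinates of [G] at x in the direction v are assumed, because the
    chain rule is applied to inverse maps before these are known to be smooth. *)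
Lemma derive_comp_rV n p (H : 'rV[R]_p -> R) (G : 'rV[R]_n -> 'rV[R]_p) (x v : 'rV[R]_n)
    (D : 'I_p -> R) :
    partials_exist H -> (forall k, continuous (partial k H)) ->
    (forall k, is_derive x v (fun y => G y 0 k) (D k)) ->
  is_derive x v (H \o G) (\sum_k D k * partial k H (G x)).
Proof.
move=> dH cH dG.
pose q k (h : R) := h^-1 * (G (h *: v + x) 0 k - G x 0 k).
have qD k : q k h @[h --> 0^'] --> D k.
  by have [/cvg_ex[l ql] <-] := dG k; rewrite /derive (cvg_lim _ ql).
(* Continuity along the line comes from the difference quotients: G(x + h v) = G x + h q. *)
have G0 : G (h *: v + x) @[h --> 0^'] --> G x.
  apply: cvg_rV => k; rewrite -[G x 0 k]addr0 -[X in _ + X](mul0r (D k)).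
  apply: (@cvg_trans _ ((G x 0 k + h * q k h) @[h --> 0^'])); last first.
    by apply: cvgD; [exact: cvg_cst|apply: cvgM => //; exact: nbhs_dnbhs].
  apply: near_eq_cvg; near=> h; rewrite /q mulrA mulfV ?mul1r.
    by rewrite addrC subrK.
  by near: h; exact: nbhs_dnbhs_neq.
have Q : (h^-1 *: ((H \o G \o shift x) (h *: v) - (H \o G) x)) @[h --> 0^'] -->
    \sum_k D k * partial k H (G x).
  apply/cvgrPdist_le => e e0.
  pose M := \sum_k `|D k| + 1.
  have M0 : 0 < M by rewrite ltr_wpDl// sumr_ge0.
  pose e' := e / 2 / M.
  have e'0 : 0 < e' by rewrite !divr_gt0.
  have sumq : (\sum_k q k h * partial k H (G x)) @[h --> 0^'] --> \sum_k D k * partial k H (G x).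
    by apply: cvg_sumr => k; apply: cvgMl.
  have sumnq : (\sum_k `|q k h|) @[h --> 0^'] --> \sum_k `|D k|.
    by apply: cvg_sumr => k; apply: cvg_norm.
  have nearA := G0 _ (partial_expand dH (fun k => cH k (G x)) e'0).
  near=> h.
  have h0 : h != 0 by near: h; exact: nbhs_dnbhs_neq.
  pose z := G (h *: v + x).
  have A : `|H z - H (G x) - lin_form (fun i => partial i H (G x)) (z - G x)| <= e' * `|z - G x|.
    by rewrite /z; near: h; exact: nearA.
  have B : \sum_k `|q k h| <= M.
    have : `|\sum_k `|D k| - \sum_k `|q k h| | <= 1.
      by near: h; move/cvgrPdist_le : sumnq; apply.
    rewrite ler_norml => /andP[+ _]; rewrite /M; lra.
  have C : `|\sum_k D k * partial k H (G x) - \sum_k q k h * partial k H (G x)| <= e / 2.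
    by near: h; move/cvgrPdist_le : sumq; apply; rewrite divr_gt0.
  have zB : `|z - G x| <= `|h| * M.
    apply: rV_norm_le => [|k]; first by rewrite mulr_ge0// ltW.
    rewrite !mxE (_ : z 0 k - G x 0 k = h * q k h); last by rewrite /q mulVKf.
    rewrite normrM ler_wpM2l// (le_trans _ B)// (bigD1 k)//= lerDl.
    by rewrite sumr_ge0.
  rewrite /=; have -> : \sum_k D k * partial k H (G x) - h^-1 *: (H z - H (G x)) =
    (\sum_k D k * partial k H (G x) - \sum_k q k h * partial k H (G x)) -
    h^-1 * (H z - H (G x) - lin_form (fun i => partial i H (G x)) (z - G x)).
    have -> : \sum_k q k h * partial k H (G x) = h^-1 * lin_form (fun i => partial i H (G x)) (z - G x).
      rewrite mulr_sumr; apply: eq_bigr => k _.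
      by rewrite /q !mxE mulrA.
    by rewrite [in RHS]mulrBr opprB addrA subrK.
  rewrite (le_trans (ler_normB _ _))// [leRHS]splitr lerD// normrM normfV.
  rewrite ler_pdivrMl ?normr_gt0// (le_trans A)//.
  rewrite (le_trans (ler_wpM2l (ltW e'0) zB))// /e' mulrCA.
  by rewrite divfK ?gt_eqF.
by split; [apply/cvg_ex; eexists; exact: Q|exact: (cvg_lim _ Q)].
Unshelve. all: by end_near. Qed.


Definition jac n p (G : 'rV[R]_n -> 'rV[R]_p) (x : 'rV[R]_n) : 'M[R]_(n, p) :=
  \matrix_(i, j) partial i (fun y => G y 0 j) x.

Lemma smooth_continuous n (f : 'rV[R]_n -> R) : smooth f -> continuous f.
Proof. by move=> sf; have [] := sf [::]. Qed.

Lemma smooth_derivable n (f : 'rV[R]_n -> R) : smooth f -> partials_exist f.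
Proof. by move=> sf; have [] := sf [::]. Qed.

Lemma is_derive_partial n (f : 'rV[R]_n -> R) i x : smooth f ->
  is_derive x (delta_mx 0 i) f (partial i f x).
Proof. by move=> sf; apply: derivableP; exact: smooth_derivable. Qed.

Lemma smooth_map_continuous n p (G : 'rV[R]_n -> 'rV[R]_p) : smooth_map G -> continuous G.
Proof. by move=> sG x; apply: continuous_rV => i; exact: smooth_continuous. Qed.

Lemma partial_comp n p (H : 'rV[R]_p -> R) (G : 'rV[R]_n -> 'rV[R]_p) i x :
    smooth H -> smooth_map G ->
  is_derive x (delta_mx 0 i) (H \o G) (\sum_k jac G x i k * partial k H (G x)).
Proof.
move=> sH sG; have := @derive_comp_rV n p H G x (delta_mx 0 i) (fun k => jac G x i k).
apply.
- exact: smooth_derivable.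
- by move=> k; apply/smooth_continuous/smooth_partial.
- by move=> k; rewrite mxE; apply: is_derive_partial; exact: sG.
Qed.

Lemma is_derive_val (V W : normedModType R) (f : V -> W) x v df : is_derive x v f df -> 'D_v f x = df.
Proof. by case. Qed.

Lemma partial_compE n p (H : 'rV[R]_p -> R) (G : 'rV[R]_n -> 'rV[R]_p) i x :
    smooth H -> smooth_map G ->
  partial i (H \o G) x = \sum_k jac G x i k * partial k H (G x).
Proof. by move=> sH sG; apply/is_derive_val/partial_comp. Qed.

(* Families of functions indexed by [option nat]: the members [Some m] are meant to
   converge to the member [None], locally uniformly with all their derivatives.  Constant
   families make every closure property below a statement about single smooth functions. *)
Definition cont_cvg n (F : option nat -> 'rV[R]_n -> R) :=
  forall y, (fun p : nat * 'rV[R]_n => F (Some p.1) p.2) @ filter_prod \oo (nbhs y) --> F None y.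

Definition smooth_family n (F : option nat -> 'rV[R]_n -> R) :=
  (forall j, smooth (F j)) /\ forall s, cont_cvg (fun j => iter_partial s (F j)).

(** Coinduction: a class closed under partial derivatives contains all iterated ones, so only the
    lowest order has to be checked. As [iter_partial] folds from the right, the last index of [s]
    acts first, hence the induction on [rcons]. *)
Lemma smooth_family_coind n (S : set (option nat -> 'rV[R]_n -> R)) :
  (forall F, S F -> [/\ forall j, continuous (F j), forall j, partials_exist (F j),
     cont_cvg F & forall i, S (fun j => partial i (F j))]) ->
  forall F, S F -> smooth_family F.
Proof.
move=> HS F SF; split=> [j|s].
  apply: (@smooth_coind R n [set f | exists2 F, S F & exists j, f = F j]).
    move=> _ [{}F {}SF [{}j ->]]; have [cF dF _ pF] := HS F SF.
    split=> //; first by move=> i x; exact: dF.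
    by move=> i; eexists; [exact: (pF i)|exists j].
  by exists F => //; exists j.
elim/last_ind: s F SF => [|s i IH] F SF; first by have [_ _ cF _] := HS F SF.
have [_ _ _ pF] := HS F SF.
have -> : (fun j => iter_partial (rcons s i) (F j)) =
    (fun j => iter_partial s (partial i (F j))).
  by apply/funext => j; rewrite /iter_partial foldr_rcons.
exact: IH (pF i).
Qed.

Lemma smooth_family_partial n (F : option nat -> 'rV[R]_n -> R) i :
  smooth_family F -> smooth_family (fun j => partial i (F j)).
Proof.
move=> [sF cF]; split=> [j|s]; first exact: smooth_partial.
have := cF (rcons s i).
by congr (cont_cvg _); apply/funext => j; rewrite /iter_partial foldr_rcons.
Qed.

Lemma cont_cvgD n (F G : option nat -> 'rV[R]_n -> R) :
  cont_cvg F -> cont_cvg G -> cont_cvg (fun j => F j \+ G j).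
Proof. by move=> cF cG y; exact: cvgD (cF y) (cG y). Qed.

Lemma cont_cvgM n (F G : option nat -> 'rV[R]_n -> R) :
  cont_cvg F -> cont_cvg G -> cont_cvg (fun j => F j \* G j).
Proof. by move=> cF cG y; exact: cvgM (cF y) (cG y). Qed.

(** The derivative of a composite is a sum of products of smooth families with other composites. A
    class B of composites is thus not closed under [partial], but the ring it generates with the
    smooth families is. *)
Inductive family_closure n (B : set (option nat -> 'rV[R]_n -> R)) :
    (option nat -> 'rV[R]_n -> R) -> Prop :=
| FCbase F : B F -> family_closure B F
| FCsmooth F : smooth_family F -> family_closure B F
| FCadd F G : family_closure B F -> family_closure B G -> family_closure B (fun j => F j \+ G j)
| FCmul F G : family_closure B F -> family_closure B G -> family_closure B (fun j => F j \* G j).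

Lemma family_closureP n (B : set (option nat -> 'rV[R]_n -> R)) :
  (forall F, B F -> [/\ forall j, continuous (F j), forall j, partials_exist (F j),
     cont_cvg F & forall i, family_closure B (fun j => partial i (F j))]) ->
  forall F, family_closure B F -> smooth_family F.
Proof.
move=> HB; apply: smooth_family_coind => F; elim=> {F}.
- exact: HB.
- move=> F sF; have [sFj cF] := sF; split.
  + by move=> j; exact: smooth_continuous.
  + by move=> j; exact: smooth_derivable.
  + exact: (cF [::]).
  + by move=> i; apply: FCsmooth; exact: smooth_family_partial.
- move=> F G SF [cF dF vF pF] SG [cG dG vG pG]; split.
  + by move=> j x; apply: continuousD; [exact: cF|exact: cG].
  + by move=> j i x; apply: derivableD; [exact: dF|exact: dG].
  + exact: cont_cvgD.
  + move=> i; rewrite (_ : (fun j => _) = (fun j => partial i (F j) \+ partial i (G j))).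
      exact: FCadd.
    apply/funext => j; apply/funext => x; rewrite /partial /= deriveD//; [exact: dF|exact: dG].
- move=> F G SF [cF dF vF pF] SG [cG dG vG pG]; split.
  + by move=> j x; apply: continuousM; [exact: cF|exact: cG].
  + by move=> j i x; apply: derivableM; [exact: dF|exact: dG].
  + exact: cont_cvgM.
  + move=> i; rewrite (_ : (fun j => _) =
      (fun j => (F j \* partial i (G j)) \+ (G j \* partial i (F j)))).
      by apply: FCadd; apply: FCmul.
    apply/funext => j; apply/funext => x; rewrite /partial /= deriveM//; [exact: dF|exact: dG].
Qed.

Lemma smooth_familyD n (F G : option nat -> 'rV[R]_n -> R) :
  smooth_family F -> smooth_family G -> smooth_family (fun j => F j \+ G j).
Proof.
by move=> sF sG; apply: (@family_closureP n set0) => //; apply: FCadd; exact: FCsmooth.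
Qed.

Lemma smooth_familyM n (F G : option nat -> 'rV[R]_n -> R) :
  smooth_family F -> smooth_family G -> smooth_family (fun j => F j \* G j).
Proof.
by move=> sF sG; apply: (@family_closureP n set0) => //; apply: FCmul; exact: FCsmooth.
Qed.

Lemma smooth_family_single n (f : 'rV[R]_n -> R) : smooth f -> smooth_family (fun _ => f).
Proof.
move=> sf; split=> [//|s y].
have [cf _] := sf s; apply: cvg_comp; first exact: cvg_snd.
exact: cf.
Qed.

Lemma smooth_family_smooth n (f : 'rV[R]_n -> R) : smooth_family (fun _ => f) -> smooth f.
Proof. by move=> [sf _]; exact: sf None. Qed.

Lemma smooth_family_scalar n (c : option nat -> R) :
  (fun m => c (Some m)) @ \oo --> c None -> smooth_family (fun j => fun _ : 'rV[R]_n => c j).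
Proof.
move=> cc; apply: (@family_closureP n [set F | exists2 d : option nat -> R,
   (fun m => d (Some m)) @ \oo --> d None & F = fun j => fun _ => d j]); last first.
  by apply: FCbase; exists c.
move=> _ [d dd ->]; split.
- by move=> j x; exact: cst_continuous.
- by move=> j i x; exact: derivable_cst.
- by move=> y; apply: cvg_comp dd; exact: cvg_fst.
- move=> i; apply: FCbase; exists (fun _ => 0); first exact: cvg_cst.
  by apply/funext => j; apply/funext => x; rewrite /partial derive_cst.
Qed.

Lemma smooth_family_cst n (c : R) : smooth_family (fun _ => fun _ : 'rV[R]_n => c).
Proof. exact/smooth_family_single/smooth_cst. Qed.

Lemma smooth_family_sum n p (F : 'I_p -> option nat -> 'rV[R]_n -> R) :
  (forall k, smooth_family (F k)) -> smooth_family (fun j x => \sum_k F k j x).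
Proof.
move=> sF; elim: (index_enum _) => [|k s IH].
  by under eq_fun do under eq_fun do rewrite big_nil; exact: smooth_family_cst.
under eq_fun do under eq_fun do rewrite big_cons.
exact: (smooth_familyD (sF k) IH).
Qed.

Lemma family_closure_sum n B p (F : 'I_p -> option nat -> 'rV[R]_n -> R) :
  (forall k, family_closure B (F k)) -> family_closure B (fun j x => \sum_k F k j x).
Proof.
move=> sF; elim: (index_enum _) => [|k s IH].
  by under eq_fun do under eq_fun do rewrite big_nil; exact/FCsmooth/smooth_family_cst.
under eq_fun do under eq_fun do rewrite big_cons.
exact: (FCadd (sF k) IH).
Qed.

Lemma smooth_familyN n (F : option nat -> 'rV[R]_n -> R) :
  smooth_family F -> smooth_family (fun j x => - F j x).
Proof.
move=> sF; have := smooth_familyM (smooth_family_cst n (-1)) sF.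
by congr smooth_family; apply/funext => j; apply/funext => x; rewrite /= mulN1r.
Qed.

Lemma smooth_familyB n (F G : option nat -> 'rV[R]_n -> R) :
  smooth_family F -> smooth_family G -> smooth_family (fun j x => F j x - G j x).
Proof. by move=> sF sG; exact: (smooth_familyD sF (smooth_familyN sG)). Qed.

Definition smooth_map_family n p (G : option nat -> 'rV[R]_n -> 'rV[R]_p) :=
  forall k, smooth_family (fun j x => G j x 0 k).

Lemma smooth_map_family_cvg n p (G : option nat -> 'rV[R]_n -> 'rV[R]_p) y :
  smooth_map_family G ->
  (fun m => G (Some m.1) m.2) @ filter_prod \oo (nbhs y) --> G None y.
Proof. by move=> sG; apply: cvg_rV => k; have [_ cG] := sG k; exact: (cG [::]). Qed.

(** The base class consists of all composites with the fixed [G]: by the chain rule a partial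
    derivative of one is a sum of partial derivatives of [G] times other composites. *)
Lemma smooth_family_comp n p (H : option nat -> 'rV[R]_p -> R)
    (G : option nat -> 'rV[R]_n -> 'rV[R]_p) :
  smooth_family H -> smooth_map_family G -> smooth_family (fun j => H j \o G j).
Proof.
move=> sH sG.
apply: (@family_closureP n [set F | exists2 H, smooth_family H & F = fun j => H j \o G j]);
  last by apply: FCbase; exists H.
move=> _ [{}H {}sH ->].
have sGj j : smooth_map (G j) by move=> k; have [] := sG k.
have sHj j : smooth (H j) by have [] := sH.
split.
- move=> j x; apply: continuous_comp; first exact: smooth_map_continuous.
  exact: smooth_continuous.
- by move=> j i x; have [] := partial_comp i x (sHj j) (sGj j).
- move=> y; have [_ cH] := sH; 
  apply: (@cvg_comp _ _ _ (fun p => (p.1, G (Some p.1) p.2)) (fun p => H (Some p.1) p.2)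
    _ (filter_prod \oo (nbhs (G None y)))); last exact: (cH [::]).
  move=> A [[P Q] /= [nP nQ] PQ].
  have h1 : \forall p \near filter_prod \oo (nbhs y), P p.1 :=
    @cvg_fst _ _ _ _ (nbhs_filter y) _ nP.
  have h2 := smooth_map_family_cvg sG nQ.
  by apply: (@filterS2 _ (filter_prod \oo (nbhs y)) _ _ _ _ _ h1 h2) => q Pp Qp; apply: PQ.
- move=> i.
  have -> : (fun j => partial i (H j \o G j)) = (fun j x =>
      \sum_k partial i (fun y => G j y 0 k) x * partial k (H j) (G j x)).
    apply/funext => j; apply/funext => x; rewrite partial_compE//.
    by apply: eq_bigr => k _; rewrite mxE.
  apply: (@family_closure_sum n _ p (fun k j =>
    partial i (fun y => G j y 0 k) \* (partial k (H j) \o G j))) => k.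
  apply: FCmul.
    by apply: FCsmooth; exact: smooth_family_partial.
  by apply: FCbase; exists (fun j => partial k (H j)) => //; exact: smooth_family_partial.
Qed.

Lemma smooth_comp n p (H : 'rV[R]_p -> R) (G : 'rV[R]_n -> 'rV[R]_p) :
  smooth H -> smooth_map G -> smooth (H \o G).
Proof.
move=> sH sG; apply: smooth_family_smooth; apply: (@smooth_family_comp _ _ (fun _ => H) (fun _ => G)).
  exact: smooth_family_single.
by move=> k; exact: smooth_family_single.
Qed.

Lemma smooth_map_comp n p q (H : 'rV[R]_p -> 'rV[R]_q) (G : 'rV[R]_n -> 'rV[R]_p) :
  smooth_map H -> smooth_map G -> smooth_map (H \o G).
Proof. by move=> sH sG k; exact: (smooth_comp (sH k) sG). Qed.

Lemma jac_comp n p q (H : 'rV[R]_p -> 'rV[R]_q) (G : 'rV[R]_n -> 'rV[R]_p) x :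
  smooth_map H -> smooth_map G -> jac (H \o G) x = jac G x *m jac H (G x).
Proof.
move=> sH sG; apply/matrixP => i j; rewrite !mxE.
have := partial_compE i x (sH j) sG; rewrite /comp => ->.
by apply: eq_bigr => k _; rewrite !mxE.
Qed.

(** All derivatives given at once by explicit formulas on a set D; this serves functions, such as
    the inverse, that are smooth only on part of the line. *)
Definition jet (D : set R) (d : nat -> R -> R) :=
  forall k x, D x -> is_derive x 1 (d k) (d k.+1 x).

Lemma jet_continuous D d k x : jet D d -> D x -> {for x, continuous (d k)}.
Proof.
move=> jd Dx; have [dx _] := jd k x Dx.
exact/differentiable_continuous/derivable1_diffP.
Qed.

Lemma is_derive1_compR (phi f : R -> R) x dphi df :
    is_derive (f x) 1 phi dphi -> is_derive x 1 f df ->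
  is_derive x 1 (phi \o f) (df * dphi).
Proof.
move=> [dphie dphiv] [dfe dfv]; split.
  by apply/derivable1_diffP; apply: differentiable_comp; exact/derivable1_diffP.
by rewrite -derive1E (derive1_comp dfe dphie) !derive1E dphiv dfv mulrC.
Qed.

Lemma is_derive_comp1 (V : normedModType R) (phi : R -> R) (f : V -> R) x v dphi df :
    is_derive (f x) 1 phi dphi -> is_derive x v f df ->
  is_derive x v (phi \o f) (df * dphi).
Proof.
move=> dphif dff.
have x0 : x + 0 *: v = x by rewrite scale0r addr0.
suff : is_derive (x + 0 *: v) v (phi \o f) (df * dphi) by rewrite x0.
apply: (is_derive_lineP (phi \o f) _ _ _ _).2.
apply: (@is_derive1_compR phi (fun t => f (x + t *: v))); first by rewrite x0.
by apply: (is_derive_lineP f _ _ _ _).1; rewrite x0.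
Qed.

Lemma smooth_family_comp1 n (D : set R) (d : nat -> R -> R) (F : option nat -> 'rV[R]_n -> R) :
    jet D d -> smooth_family F -> (forall j x, D (F j x)) ->
  smooth_family (fun j => d 0%N \o F j).
Proof.
move=> jd sF DF.
apply: (@family_closureP n [set F' | exists k, F' = fun j => d k \o F j]);
  last by apply: FCbase; exists 0%N.
move=> _ [k ->]; have [sFj cF] := sF.
split.
- move=> j x; apply: continuous_comp; first exact: smooth_continuous.
  exact: jet_continuous jd _.
- move=> j i x.
  by have [] := is_derive_comp1 (jd k _ (DF j x)) (is_derive_partial i x (sFj j)).
- by move=> y; apply: cvg_comp (cF [::] y) _; exact: (jet_continuous jd (DF None y)).
- move=> i; rewrite (_ : (fun j => _) = fun j => partial i (F j) \* (d k.+1 \o F j)).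
    apply: FCmul; last by apply: FCbase; exists k.+1.
    by apply: FCsmooth; exact: smooth_family_partial.
  apply/funext => j; apply/funext => x; apply: is_derive_val.
  exact: is_derive_comp1 (jd k _ (DF j x)) (is_derive_partial i x (sFj j)).
Qed.

Lemma smooth_comp1 n (D : set R) (d : nat -> R -> R) (f : 'rV[R]_n -> R) :
    jet D d -> smooth f -> (forall x, D (f x)) -> smooth (d 0%N \o f).
Proof.
move=> jd sf Df; apply: smooth_family_smooth.
by apply: (@smooth_family_comp1 n D d (fun _ => f)) => //; exact: smooth_family_single.
Qed.

End Calculus.

(** * Inverse maps of families *)

Section InverseFamily.
Context {R : realType}.

HB.instance Definition _ (m n : nat) := Complete.on 'M[R]_(m, n).

(** The solution is the fixed point of the contraction x |-> y - e x. *)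
Lemma perturbed_identity_onto n (e : 'rV[R]_n -> 'rV[R]_n) (q : R) (y : 'rV[R]_n) :
    0 <= q -> q < 1 -> (forall x z, `|e x - e z| <= q * `|x - z|) ->
  exists x, x + e x = y.
Proof.
move=> q0 q1 eL; pose f x := y - e x.
have [||x _ xE] := @banach_fixed_point R 'rV[R]_n setT (totalfun f) _ closedT.
- exists (NngNum q0); split => //= -[x z] _ /=.
  by rewrite /totalfun_ /f opprB addrC subrKA (le_trans _ (eL _ _))// distrC.
- by exists 0.
by exists x; rewrite {1}xE /totalfun_ /f subrK.
Qed.

Lemma smooth_family_sumT n (I : finType) (F : I -> option nat -> 'rV[R]_n -> R) :
  (forall k, smooth_family (F k)) -> smooth_family (fun j x => \sum_k F k j x).
Proof.
move=> sF; elim: (index_enum _) => [|k s IH].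
  by under eq_fun do under eq_fun do rewrite big_nil; exact: smooth_family_cst.
under eq_fun do under eq_fun do rewrite big_cons.
exact: (smooth_familyD (sF k) IH).
Qed.

Lemma smooth_family_prodT n (I : finType) (F : I -> option nat -> 'rV[R]_n -> R) :
  (forall k, smooth_family (F k)) -> smooth_family (fun j x => \prod_k F k j x).
Proof.
move=> sF; elim: (index_enum _) => [|k s IH].
  by under eq_fun do under eq_fun do rewrite big_nil; exact: smooth_family_cst.
under eq_fun do under eq_fun do rewrite big_cons.
exact: (smooth_familyM (sF k) IH).
Qed.

Lemma smooth_family_det n p (M : option nat -> 'rV[R]_n -> 'M[R]_p) :
  (forall i k, smooth_family (fun j x => M j x i k)) -> smooth_family (fun j x => \det (M j x)).
Proof.
move=> sM; apply: smooth_family_sumT => s.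
apply: (@smooth_familyM _ _ (fun _ _ => _) (fun j x => _)); first exact: smooth_family_cst.
by apply: smooth_family_prodT => i; exact: sM.
Qed.

Lemma jet_inv : jet [set x : R | x != 0] (fun k x => (-1) ^+ k * k`!%:R * (x^-1) ^+ k.+1).
Proof.
move=> k x x0.
have d1 : is_derive x 1 (fun y : R => y^-1) (- x ^- 2).
  by have := is_deriveV x0 (is_derive_id x (1 : R)); rewrite [_ *: _]mulr1.
rewrite (_ : (fun x => _) = ((-1) ^+ k * k`!%:R) \*: ((fun y : R => y^-1) ^+ k.+1)); last first.
  by apply/funext => z; rewrite !fctE.
apply: (is_derive_eq (is_deriveZ _ (is_deriveX k.+1 d1))).
rewrite factS natrM /GRing.scale/= [x^-1 ^+ k.+2]exprS [x^-1 ^+ k.+1]exprS -[x ^- 2]exprVn expr2 exprS.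
by ring.
Qed.

Lemma smooth_familyV n (F : option nat -> 'rV[R]_n -> R) :
  smooth_family F -> (forall j x, F j x != 0) -> smooth_family (fun j x => (F j x)^-1).
Proof.
move=> sF F0; have := smooth_family_comp1 jet_inv sF F0.
by congr smooth_family; apply/funext => j; apply/funext => x; rewrite /= mul1r mul1r expr1.
Qed.

(** Cramer's rule: the entries are cofactors divided by the determinant. *)
Lemma smooth_family_invmx n p (M : option nat -> 'rV[R]_n -> 'M[R]_p) :
    (forall i k, smooth_family (fun j x => M j x i k)) -> (forall j x, M j x \in unitmx) ->
  forall i k, smooth_family (fun j x => invmx (M j x) i k).
Proof.
move=> sM uM i k.
have -> : (fun j x => invmx (M j x) i k) = (fun j x => (\det (M j x))^-1 *
    ((-1) ^+ (k + i) * \det (row' k (col' i (M j x))))).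
  by apply/funext => j; apply/funext => x; rewrite /invmx uM !mxE.
apply: (@smooth_familyM _ _ (fun j x => _) (fun j x => _)).
  apply: smooth_familyV => [|j x]; first exact: smooth_family_det.
  by rewrite -unitfE -unitmxE.
apply: (@smooth_familyM _ _ (fun j x => _) (fun j x => _)); first exact: smooth_family_cst.
apply: smooth_family_det => a b.
rewrite (_ : (fun j x => _) = (fun j x => M j x (lift k a) (lift i b))); first exact: sM.
by apply/funext => j; apply/funext => x; rewrite !mxE.
Qed.

Lemma smooth_map_family_jac n p (G : option nat -> 'rV[R]_n -> 'rV[R]_p) i k :
  smooth_map_family G -> smooth_family (fun j x => jac (G j) x i k).
Proof.
move=> sG.
have -> : (fun j x => jac (G j) x i k) = (fun j => partial i (fun y => G j y 0 k)).
  by apply/funext => j; apply/funext => x; rewrite mxE.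
exact: smooth_family_partial.
Qed.

Lemma lipschitz_rV_continuous n p (G : 'rV[R]_n -> 'rV[R]_p) (c : R) : 0 < c ->
  (forall u v, `|G u - G v| <= c * `|u - v|) -> continuous G.
Proof.
move=> c0 GL y A /nbhs_ballP[d /= d0 dA]; apply/nbhs_ballP; exists (d / c).
  by rewrite /= divr_gt0.
move=> z; rewrite mx_norm_ball /ball_ /= => yz; apply: dA; rewrite mx_norm_ball /ball_ /=.
by rewrite (le_lt_trans (GL _ _))// -ltr_pdivlMl// mulrC.
Qed.

Section OneMap.
Variables (n : nat) (E : 'rV[R]_n -> 'rV[R]_n).
Hypotheses (sE : smooth_map E) (EL : forall x z, `|x - z| <= 2 * `|E x - E z|).

Lemma map_expand (x : 'rV[R]_n) (e : R) : 0 < e ->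
  \forall z \near x, `|E z - E x - (z - x) *m jac E x| <= e * `|z - x|.
Proof.
move=> e0.
have : \forall z \near x, forall k, `|E z 0 k - E x 0 k -
    lin_form (fun i => partial i (fun y => E y 0 k) x) (z - x)| <= e * `|z - x|.
  apply: (@filter_forall _ _ (fun k z => `|E z 0 k - E x 0 k -
    lin_form (fun i => partial i (fun y => E y 0 k) x) (z - x)| <= e * `|z - x|) (nbhs x)) => k.
  apply: partial_expand => //; first exact/smooth_derivable/sE.
  by move=> i; apply/smooth_continuous/smooth_partial/sE.
apply: filterS => z Ez; apply: rV_norm_le => [|k]; first by rewrite mulr_ge0// ltW.
move: (Ez k); congr (`| _ | <= _); rewrite !mxE; congr (_ - _).
by apply: eq_bigr => i _; rewrite !mxE.
Qed.

(** Along a kernel vector v of the Jacobian the first-order expansion moves [E] by at most a quarter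
    of the length of t v, while [EL] forces at least half of it. *)
Lemma jac_unitmx x : jac E x \in unitmx.
Proof.
rewrite unitmxE unitfE; apply/negP => /det0P[v v0 vJ].
have e0 : (0 : R) < 4^-1 by rewrite invr_gt0.
have := map_expand x e0; rewrite (near_shift 0) subr0 => Hx.
have L0 : (fun t : R => t *: v) @ (0:R) --> (0 : 'rV[R]_n).
  rewrite -[X in _ --> X](scale0r v); apply: cvgZr_tmp; exact: cvg_id.
have {}Hx := L0 _ Hx.
have : \forall t \near (0 : R)^', False.
  near=> t.
  have t0 : t != 0 by near: t; exact: nbhs_dnbhs_neq.
  have : `|E (t *: v + x) - E x - (t *: v + x - x) *m jac E x| <= 4^-1 * `|t *: v + x - x|.
    by near: t; apply: nbhs_dnbhs; exact: Hx.
  rewrite addrK -scalemxAl vJ scaler0 subr0 => H.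
  have := EL (t *: v + x) x; rewrite addrK.
  have : 0 < `|t *: v| by rewrite normr_gt0 scaler_eq0 negb_or t0.
  by move: H; set a := `|_|; set b := `|_|; lra.
by move/filter_ex => [].
Unshelve. all: by end_near. Qed.

(** The expansion of [E] at [G y] is solved for the displacement of [G]; its remainder is small
    relative to the step because [EL] makes [G] Lipschitz with constant 2. *)
Lemma is_derive_inverse_map (G : 'rV[R]_n -> 'rV[R]_n) : cancel G E ->
  forall y i k, is_derive y (delta_mx 0 i) (fun y => G y 0 k) (invmx (jac E (G y)) i k).
Proof.
move=> GK y i k; set J := jac E (G y).
have GL u v : `|G u - G v| <= 2 * `|u - v| by rewrite -{2}(GK u) -{2}(GK v).
have Gc : {for y, continuous G}.
  by apply: (@lipschitz_rV_continuous n n G 2 _ GL y).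
pose c := \sum_l `|invmx J l k| + 1.
have c0 : 0 < c by rewrite ltr_wpDl// sumr_ge0.
have Q : (h^-1 *: (((fun y => G y 0 k) \o shift y) (h *: delta_mx 0 i) - G y 0 k)) @[h --> 0^']
    --> invmx J i k.
  apply/cvgrPdist_le => e e0.
  pose e' := e / 2 / c.
  have e'0 : 0 < e' by rewrite !divr_gt0.
  have L0 : (fun t : R => t *: delta_mx 0 i + y) @ (0:R) --> y.
    rewrite -[X in _ --> X]add0r -[X in _ --> X + _](scale0r (delta_mx 0 i)).
    apply: cvgD; last exact: cvg_cst.
    by apply: cvgZr_tmp; exact: cvg_id.
  have H := L0 _ (Gc _ (map_expand (G y) e'0)).
  near=> h.
  have h0 : h != 0 by near: h; exact: nbhs_dnbhs_neq.
  pose z := G (h *: delta_mx 0 i + y).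
  have A : `|E z - E (G y) - (z - G y) *m J| <= e' * `|z - G y|.
    by rewrite /z; near: h; apply: nbhs_dnbhs; exact: H.
  have zB : `|z - G y| <= 2 * `|h|.
    rewrite (le_trans (GL _ _))// addrK ler_wpM2l//; apply: rV_norm_le => // l.
    by rewrite !mxE normrM ler_piMr//; case: (_ && _); rewrite ?normr0 ?normr1.
  move: A; rewrite /z !GK addrK; set r := (_ - _ *m J) => A.
  have E1 : z - G y = (h *: delta_mx 0 i - r) *m invmx J.
    by rewrite /r subKr mulmxK// jac_unitmx.
  have E2 : z 0 k - G y 0 k = h * invmx J i k - (r *m invmx J) 0 k.
    have := congr1 (fun w : 'rV[R]_n => w 0 k) E1.
    by rewrite mulmxBl -scalemxAl -rowE !mxE.
  rewrite /= E2 scalerBr opprB addrC -addrA.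
  rewrite [h^-1 *: (h * _)]mulKf// addNr addr0 normrM normfV ler_pdivrMl ?normr_gt0//.
  have -> : `|(r *m invmx J) 0 k| = `|lin_form (fun l => invmx J l k) r|.
    by rewrite mxE.
  rewrite (le_trans (lin_form_bound _ _))//.
  have c1 : \sum_l `|invmx J l k| <= c by rewrite lerDl.
  rewrite (le_trans (ler_pM _ _ A c1)) ?sumr_ge0//.
  rewrite (le_trans (ler_wpM2r (ltW c0) (ler_wpM2l (ltW e'0) zB)))//.
  by rewrite mulrAC /e' divfK ?gt_eqF// mulrA divfK ?gt_eqF// mulrC.
by split; [apply/cvg_ex; eexists; exact: Q|exact: (cvg_lim _ Q)].
Unshelve. all: by end_near. Qed.

End OneMap.

(** Coinduction on the families [H j \o G j]: the Jacobian of [G] is the inverse of that of [E]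
    taken at [G], so every partial derivative is again a smooth family composed with [G], and
    smoothness of [G] is never presupposed. *)
Lemma inverse_family n (E : option nat -> 'rV[R]_n -> 'rV[R]_n)
    (G : option nat -> 'rV[R]_n -> 'rV[R]_n) :
    smooth_map_family E -> (forall j x z, `|x - z| <= 2 * `|E j x - E j z|) ->
    (forall j, cancel (G j) (E j)) ->
  smooth_map_family G.
Proof.
move=> sE EL GK.
have sEj j : smooth_map (E j) by move=> k; have [] := sE k.
have GL j u v : `|G j u - G j v| <= 2 * `|u - v| by rewrite -{2}(GK j u) -{2}(GK j v).
have Gc j : continuous (G j).
  by apply: (@lipschitz_rV_continuous n n (G j) 2 _ (GL j)).
suff : forall F, (exists2 H, smooth_family H & F = fun j => H j \o G j) -> smooth_family F.
  move=> HG k; apply: HG; exists (fun _ x => x 0 k) => //.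
  exact/smooth_family_single/smooth_coord.
apply: smooth_family_coind => _ [H sH ->].
have sHj j : smooth (H j) by have [] := sH.
have dHG j i x : is_derive x (delta_mx 0 i) (H j \o G j)
    (\sum_k invmx (jac (E j) (G j x)) i k * partial k (H j) (G j x)).
  apply: derive_comp_rV; first exact: smooth_derivable.
    by move=> k; apply/smooth_continuous/smooth_partial.
  by move=> k; apply: is_derive_inverse_map.
split.
- by move=> j x; apply: continuous_comp; [exact: Gc|exact: smooth_continuous].
- by move=> j i x; have [] := dHG j i x.
- move=> y; have [_ cH] := sH.
  apply: (@cvg_comp _ _ _ (fun p => (p.1, G (Some p.1) p.2)) (fun p => H (Some p.1) p.2)
    _ (filter_prod \oo (nbhs (G None y)))); last exact: (cH [::]).
  (* By [EL] the distance from [G None y] to [G (Some m) z] is at most twice that from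
     [E (Some m) (G None y)] to z, and both of these tend to y. *)
  have h2 : (fun p => G (Some p.1) p.2) @ filter_prod \oo (nbhs y) --> G None y.
    apply/cvgrPdist_le => e e0.
    have := @smooth_map_family_cvg _ _ _ E (G None y) sE; rewrite GK => EG.
    have e4 : 0 < e / 4 by rewrite divr_gt0.
    have hE : \forall m \near \oo, `|y - E (Some m) (G None y)| <= e / 4.
      have /cvgrPdist_le/(_ _ e4)[[P Q] /= [nP nQ] PQ] := EG.
      apply: filterS nP => m Pm; apply: (PQ (m, G None y)); split => //=.
      exact: nbhs_singleton nQ.
    have hy : \forall z \near y, `|y - z| <= e / 4.
      by apply: (@cvgr_dist_le _ _ _ (nbhs y) _ id y).
    exists ([set m | `|y - E (Some m) (G None y)| <= e / 4], [set z | `|y - z| <= e / 4]) => //=.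
    move=> [m z] /= [hm hz]; rewrite (le_trans (EL (Some m) _ _))// GK.
    have := ler_distD y (E (Some m) (G None y)) z.
    rewrite [X in _ <= X + _]distrC; move: hm hz.
    by set a := `|_|; set b := `|_|; set c := `|_|; lra.
  move=> A [[P Q] /= [nP nQ] PQ].
  have h1 : \forall p \near filter_prod \oo (nbhs y), P p.1 :=
    @cvg_fst _ _ _ _ (nbhs_filter y) _ nP.
  by apply: (@filterS2 _ (filter_prod \oo (nbhs y)) _ _ _ _ _ h1 (h2 _ nQ)) => q Pp Qp; apply: PQ.
- move=> i; exists (fun j x => \sum_k invmx (jac (E j) x) i k * partial k (H j) x).
    apply: smooth_family_sumT => k; apply: (@smooth_familyM _ _ (fun j x => _) (fun j x => _)).
      apply: smooth_family_invmx => [a b|j x]; first exact: smooth_map_family_jac.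
      by apply: jac_unitmx.
    exact: smooth_family_partial.
  by apply/funext => j; apply/funext => x; apply: is_derive_val; exact: dHG.
Unshelve. all: by end_near. Qed.

Section PerturbedIdentity.
Variables (n : nat) (e : option nat -> 'rV[R]_n -> 'rV[R]_n).
Hypotheses (se : smooth_map_family e) (eL : forall j x z, `|e j x - e j z| <= 2^-1 * `|x - z|).

Lemma perturbed_identity_expanding j x z : `|x - z| <= 2 * `|(x + e j x) - (z + e j z)|.
Proof.
have -> : x - z = ((x + e j x) - (z + e j z)) - (e j x - e j z).
  by rewrite opprD addrACA addrK.
have := ler_normB ((x + e j x) - (z + e j z)) (e j x - e j z).
have := eL j x z.
have -> : x - z = ((x + e j x) - (z + e j z)) - (e j x - e j z).
  by rewrite opprD addrACA addrK.
by set a := `|_|; set b := `|_|; set c := `|_|; lra.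
Qed.

Lemma perturbed_identity_inverse : exists G : option nat -> 'rV[R]_n -> 'rV[R]_n,
  [/\ smooth_map_family G, forall j, cancel (G j) (fun x => x + e j x) &
      forall j, cancel (fun x => x + e j x) (G j)].
Proof.
have ex j y : {x | x + e j x = y}.
  by apply: cid; apply: (@perturbed_identity_onto _ _ 2^-1); [lra|lra|exact: eL].
pose G j y := sval (ex j y).
have GK j : cancel (G j) (fun x => x + e j x) by move=> y; exact: svalP (ex j y).
exists G; split => // [|j x].
  apply: (@inverse_family n (fun j x => x + e j x)) => // [k|j x z].
    have := smooth_familyD (smooth_family_single (@smooth_coord R n k)) (se k).
    by congr smooth_family; apply/funext => j; apply/funext => x; rewrite /= mxE.
  exact: perturbed_identity_expanding.
have := perturbed_identity_expanding j (G j (x + e j x)) x.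
by rewrite GK subrr normr0 mulr0 normr_le0 subr_eq0 => /eqP.
Qed.

End PerturbedIdentity.

Lemma perturbed_identity_diffeomorphism n (e : 'rV[R]_n -> 'rV[R]_n) :
    smooth_map e -> (forall x z, `|e x - e z| <= 2^-1 * `|x - z|) ->
  diffeomorphism (fun x => x + e x).
Proof.
move=> se eL; have [|//|G [sG GK KG]] := @perturbed_identity_inverse n (fun _ => e).
  by move=> k; exact: smooth_family_single.
split.
  move=> k; have := smoothD (@smooth_coord R n k) (se k).
  by congr smooth; apply/funext => x; rewrite /= mxE.
exists (G None); split; [|exact: KG|exact: GK].
by move=> k; have [sGk _] := sG k; exact: sGk.
Qed.

End InverseFamily.

(** * Functions of one variable *)

Section OneVariable.
Context {R : realType}.
Implicit Types (D : set R) (f g : R -> R).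

Definition smooth_on D f := jet D (fun k => derive1n k f).

(** Openness of D allows an identity valid on D to be differentiated there, so explicit formulas
    determine the iterated derivatives. *)
Lemma jet_smooth_on D d f : open D -> jet D d -> (forall x, D x -> d 0%N x = f x) ->
  smooth_on D f /\ forall k x, D x -> derive1n k f x = d k x.
Proof.
move=> oD jd df.
have E k x : D x -> derive1n k f x = d k x.
  elim: k x => [|k IH] x Dx; first by rewrite derive1n0 df.
  rewrite derive1nS derive1E; apply: is_derive_val.
  apply: near_eq_is_derive (jd k x Dx).
  by near=> y; rewrite IH//; near: y; exact: open_nbhs_nbhs.
split; last exact: E.
move=> k x Dx; rewrite (E k.+1 x Dx); apply: near_eq_is_derive (jd k x Dx).
by near=> y; rewrite E//; near: y; exact: open_nbhs_nbhs.
Unshelve. all: by end_near. Qed.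

Lemma smooth_on_eq D f g : open D -> (forall x, D x -> f x = g x) -> smooth_on D f -> smooth_on D g.
Proof. by move=> oD fg sf; have [] := jet_smooth_on oD sf fg. Qed.

Lemma smooth_onU D D' f : smooth_on D f -> smooth_on D' f -> smooth_on (D `|` D') f.
Proof. by move=> sf sf' k x []; [exact: sf|exact: sf']. Qed.

Lemma smooth_on_deriv D f : smooth_on D f -> smooth_on D (derive1n 1 f).
Proof. by move=> sf k x Dx; have := sf k.+1 x Dx; rewrite -!derive1Sn. Qed.

(** Each derivative is prescribed on D only, so the successive ones are picked by choice and
    assembled into a jet. *)
Lemma smooth_on_coind D (S : set (R -> R)) : open D ->
  (forall f, S f -> exists2 g, S g & forall x, D x -> is_derive x 1 f (g x)) ->
  forall f, S f -> smooth_on D f.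
Proof.
move=> oD HS f Sf.
have next (h : {h | S h}) : {h' : {h' | S h'} | forall x, D x -> is_derive x 1 (sval h) (sval h' x)}.
  apply: cid; case: h => h Sh; have [g Sg hg] := HS h Sh.
  by exists (exist _ g Sg).
pose d k := sval (iter k (fun h => sval (next h)) (exist _ f Sf)).
have jd : jet D d by move=> k x Dx; rewrite /d iterS; exact: (svalP (next _)).
by have [] := @jet_smooth_on D d f oD jd.
Qed.

Inductive fun_closure D (B : set (R -> R)) : (R -> R) -> Prop :=
| FunCbase f : B f -> fun_closure D B f
| FunCsmooth f : smooth_on D f -> fun_closure D B f
| FunCadd f g : fun_closure D B f -> fun_closure D B g -> fun_closure D B (f \+ g)
| FunCmul f g : fun_closure D B f -> fun_closure D B g -> fun_closure D B (f \* g).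

Lemma fun_closureP D (B : set (R -> R)) : open D ->
  (forall f, B f -> exists2 g, fun_closure D B g & forall x, D x -> is_derive x 1 f (g x)) ->
  forall f, fun_closure D B f -> smooth_on D f.
Proof.
move=> oD HB; apply: smooth_on_coind => // f; elim=> {f}.
- exact: HB.
- move=> f sf; exists (derive1n 1 f); first exact/FunCsmooth/smooth_on_deriv.
  by move=> x Dx; exact: sf 0%N x Dx.
- move=> f g _ [f' Sf' ff'] _ [g' Sg' gg']; exists (f' \+ g'); first exact: FunCadd.
  by move=> x Dx; apply: is_deriveD; [exact: ff'|exact: gg'].
- move=> f g Sf [f' Sf' ff'] Sg [g' Sg' gg']; exists ((f \* g') \+ (g \* f')).
    by apply: FunCadd; exact: FunCmul.
  move=> x Dx; exact: (is_deriveM (ff' x Dx) (gg' x Dx)).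
Qed.

Lemma smooth_onD D f g : open D -> smooth_on D f -> smooth_on D g -> smooth_on D (f \+ g).
Proof.
move=> oD sf sg; apply: (@fun_closureP D set0) => //.
by apply: FunCadd; exact: FunCsmooth.
Qed.

Lemma smooth_onM D f g : open D -> smooth_on D f -> smooth_on D g -> smooth_on D (f \* g).
Proof.
move=> oD sf sg; apply: (@fun_closureP D set0) => //.
by apply: FunCmul; exact: FunCsmooth.
Qed.

Lemma smooth_on_comp D D' f g : open D -> smooth_on D' g -> smooth_on D f ->
  (forall x, D x -> D' (f x)) -> smooth_on D (g \o f).
Proof.
move=> oD sg sf DD'.
apply: (@fun_closureP D [set h | exists k, h = derive1n k g \o f]) => //; last first.
  by apply: FunCbase; exists 0%N.
move=> _ [k ->]; exists (derive1n 1 f \* (derive1n k.+1 g \o f)).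
  by apply: FunCmul; [exact/FunCsmooth/smooth_on_deriv|apply: FunCbase; exists k.+1].
move=> x Dx; apply: is_derive1_compR; first by apply: sg; exact: DD'.
exact: sf 0%N x Dx.
Qed.

Lemma smooth_on_cst D (c : R) : open D -> smooth_on D (fun=> c).
Proof.
move=> oD; apply: (@smooth_on_coind D [set f | exists c, f = fun=> c]) => //; last by exists c.
by move=> _ [a ->]; exists (fun=> 0); [exists 0|move=> x _; exact: is_derive_cst].
Qed.

Lemma smooth_on_id D : open D -> smooth_on D id.
Proof.
move=> oD; apply: (@fun_closureP D [set id]) => //; last exact: FunCbase.
move=> _ ->; exists (fun=> 1); first exact/FunCsmooth/smooth_on_cst.
by move=> x _; exact: is_derive_id.
Qed.

Lemma smooth_onN D f : open D -> smooth_on D f -> smooth_on D (fun x => - f x).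
Proof.
move=> oD sf; have -> : (fun x => - f x) = (fun=> -1) \* f.
  by apply/funext => x; rewrite /= mulN1r.
exact: (smooth_onM oD (smooth_on_cst _ oD) sf).
Qed.

Lemma smooth_onB D f g : open D -> smooth_on D f -> smooth_on D g -> smooth_on D (fun x => f x - g x).
Proof. by move=> oD sf sg; exact: (smooth_onD oD sf (smooth_onN oD sg)). Qed.

Lemma smooth_onX D f n : open D -> smooth_on D f -> smooth_on D (fun x => f x ^+ n).
Proof.
move=> oD sf; elim: n => [|n IH].
  by under eq_fun do rewrite expr0; exact: smooth_on_cst.
by under eq_fun do rewrite exprS; exact: (smooth_onM oD sf IH).
Qed.

Lemma smooth_onV D f : open D -> smooth_on D f -> (forall x, D x -> f x != 0) ->
  smooth_on D (fun x => (f x)^-1).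
Proof.
move=> oD sf f0.
have o0 : open [set x : R | x != 0].
  have -> : [set x : R | x != 0] = [set x | x < 0] `|` [set x | x > 0].
    by apply/seteqP; split=> x /=; [move/lt_total/orP|move=> /orP; rewrite -neq_lt].
  by apply: openU; [exact: open_lt|exact: open_gt].
have [|sV _] := @jet_smooth_on _ _ (fun x => x^-1) o0 (@jet_inv R).
  by move=> x _; rewrite !mul1r expr1.
exact: (@smooth_on_comp D _ f _ oD sV sf f0).
Qed.

Lemma smooth_on_continuous D f k x : smooth_on D f -> D x -> {for x, continuous (derive1n k f)}.
Proof. exact: jet_continuous. Qed.

Lemma smooth_compR n D f (h : 'rV[R]_n -> R) :
  smooth_on D f -> smooth h -> (forall x, D (h x)) -> smooth (f \o h).
Proof. by move=> sf sh Dh; exact: (smooth_comp1 sf sh Dh). Qed.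

(* Extension by zero: the quadratic bound makes the extension differentiable at 0. *)
Lemma smooth_zero_left (S : set (R -> R)) :
    (forall g, S g -> [/\ forall x : R, x <= 0 -> g x = 0,
       exists C, forall x : R, 0 < x <= 1 -> `|g x| <= C * x ^+ 2 &
       exists2 g', S g' & forall x : R, 0 < x -> is_derive x 1 g (g' x)]) ->
  forall g, S g -> smooth_on setT g.
Proof.
move=> HS; apply: smooth_on_coind; first exact: openT.
move=> g Sg; have [g0 [C gC] [g' Sg' gg']] := HS g Sg.
have [g'0 _ _] := HS g' Sg'.
exists g' => // x _; have [x0|x0|->] := ltgtP x 0; [|exact: gg'|].
  rewrite g'0 ?ltW//; apply: near_eq_is_derive (is_derive_cst 0 x 1).
  near=> y; rewrite g0//; apply/ltW; near: y.
  by apply: (@open_nbhs_nbhs _ x [set y | y < 0]); split => //; exact: open_lt.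
have Q : (h^-1 *: ((g \o shift 0) (h *: 1) - g 0)) @[h --> 0^'] --> (0 : R).
  apply/cvgrPdist_le => e e0; near=> h.
  rewrite /= sub0r normrN (g0 0)// subr0 addr0 [_%:A]mulr1.
  have h0 : h != 0 by near: h; exact: nbhs_dnbhs_neq.
  have [hn|hp|hz] := ltgtP h 0.
  - by rewrite g0 ?(ltW hn)// scaler0 normr0 (ltW e0).
  - have h1 : h <= 1.
      rewrite (le_trans (ler_norm _))//; near: h.
      by apply: dnbhs0_le.
    rewrite normrM normfV ler_pdivrMl ?normr_gt0// (le_trans (gC h _)) ?hp//.
    rewrite gtr0_norm// expr2 mulrCA ler_pM2l//.
    have : `|h| <= e / (`|C| + 1).
      by near: h; apply: dnbhs0_le; rewrite divr_gt0// ltr_wpDl.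
    rewrite ler_pdivlMr ?ltr_wpDl// gtr0_norm// => hC.
    rewrite (le_trans (ler_wpM2r (ltW hp) (ler_norm C)))//; nra.
  - by rewrite hz eqxx in h0.
rewrite (g'0 0)//; split; [apply/cvg_ex; eexists; exact: Q|exact: (cvg_lim _ Q)].
Unshelve. all: by end_near. Qed.

(** * Flat functions and cutoffs on the line *)

Lemma exp_dominates_power N : exists C : R, forall s, 0 <= s -> s ^+ N <= C * expR s.
Proof.
case: N => [|N]; first by exists 1 => s s0; rewrite expr0 mul1r -[leLHS]expR0 ler_expR.
exists (N.+1%:R ^+ N.+1) => s s0.
have -> : expR s = expR (s / N.+1%:R) ^+ N.+1.
  by rewrite -expRM_natl mulrC divfK// pnatr_eq0.
rewrite -exprMn; apply: lerXn2r; rewrite ?nnegrE// ?mulr_ge0 ?expR_ge0//.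
rewrite -ler_pdivrMl ?ltr0n// mulrC (le_trans _ (expR_ge1Dx _))//.
by rewrite lerDr.
Qed.

(** x^-k exp(-1/x) for x > 0; the negative powers are included because differentiating exp(-1/x)
    produces them. *)
Definition exp_flat (k : nat) (x : R) : R := if 0 < x then (x^-1) ^+ k * expR (- x^-1) else 0.

(** Finite linear combinations form a class closed under differentiation. The quadratic bound at 0
    holds because s^(k+2) is dominated by exp s for s = 1/x. *)
Lemma exp_flat_smooth k : smooth_on setT (exp_flat k).
Proof.
pose S := [set g : R -> R | exists p : seq (R * nat), g = fun x => \sum_(c <- p) c.1 * exp_flat c.2 x].
apply: (@smooth_zero_left S); last first.
  by exists [:: (1, k)]; apply/funext => x; rewrite big_cons big_nil addr0 mul1r.
move=> _ [p ->]; split.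
- by move=> x x0; rewrite big1// => c _; rewrite /exp_flat ltNge x0 mulr0.
- elim: p => [|[c m] p [C pC]]; first by exists 0 => x _; rewrite big_nil normr0 mul0r.
  have [C' C'P] := exp_dominates_power m.+2.
  exists (`|c| * C' + C) => x x01; rewrite big_cons (le_trans (ler_normD _ _))// mulrDl lerD ?pC//=.
  have /andP[x0 x1] := x01.
  rewrite normrM -mulrA ler_wpM2l// /exp_flat x0.
  have s0 : 0 <= x^-1 by rewrite invr_ge0 ltW.
  rewrite ger0_norm; last by rewrite mulr_ge0 ?expR_ge0 ?exprn_ge0.
  rewrite expRN ler_pdivrMr ?expR_gt0//.
  have -> : x^-1 ^+ m = x ^+ 2 * x^-1 ^+ m.+2.
    by rewrite !exprS expr0; field; rewrite gt_eqF.
  by rewrite [leRHS]mulrAC [leLHS]mulrC ler_wpM2r ?exprn_ge0 ?(ltW x0)// C'P.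
- elim: p => [|[c m] p [g' [q ->] gq]].
    by exists (fun=> 0); [exists [::]; apply/funext => x; rewrite big_nil|
      move=> x _; under eq_fun do rewrite big_nil; exact: is_derive_cst].
  exists (fun x => \sum_(c <- (- c * m%:R, m.+1) :: (c, m.+2) :: q) c.1 * exp_flat c.2 x).
    by eexists.
  move=> x x0; under eq_fun do rewrite big_cons.
  rewrite !big_cons addrA; apply: is_deriveD; last exact: gq.
  rewrite /= /exp_flat x0.
  have d1 : is_derive x 1 (fun y : R => y^-1) (- x ^- 2).
    have := is_deriveV (lt0r_neq0 x0) (is_derive_id x (1 : R)); by rewrite [_ *: _]mulr1.
  have d2 : is_derive x 1 (fun y : R => - y^-1) (- - x ^- 2) := is_deriveN d1.
  have d3 := @is_derive1_compR R expR (fun y : R => - y^-1) x _ _ (is_derive_expR (- x^-1)) d2.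
  have := is_deriveZ c (is_deriveM (is_deriveX m d1) d3).
  rewrite /GRing.scale/= => H; apply: (@near_eq_is_derive _ _ _ _ _ _ _ _ _ (is_derive_eq H _)).
    near=> y; rewrite !fctE/= ifT//; near: y.
    by apply: (@open_nbhs_nbhs _ x [set y | y > 0]); split => //; exact: open_gt.
  rewrite opprK; set E := expR _.
  rewrite [X in c * (X * _ + _)](_ : _ = x^-1 ^+ m); last by rewrite !fctE.
  rewrite -[x ^- 2]exprVn; move: E (x^-1) => E z.
  by case: m {H} => [|m] /=; rewrite -?[m.+1%:R]natr1 !exprS ?expr0; ring.
Unshelve. all: by end_near. Qed.

Lemma exp_flat_gt0 (x : R) : 0 < x -> 0 < exp_flat 0 x.
Proof. by move=> x0; rewrite /exp_flat x0 expr0 mul1r expR_gt0. Qed.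

Lemma exp_flat_ge0 (x : R) : 0 <= exp_flat 0 x.
Proof. by rewrite /exp_flat; case: ifP => // _; rewrite expr0 mul1r expR_ge0. Qed.

Lemma exp_flat_le0 (x : R) : x <= 0 -> exp_flat 0 x = 0.
Proof. by move=> x0; rewrite /exp_flat ltNge x0. Qed.

Definition smooth_step (x : R) : R := exp_flat 0 x / (exp_flat 0 x + exp_flat 0 (1 - x)).

Lemma smooth_step_den (x : R) : 0 < exp_flat 0 x + exp_flat 0 (1 - x).
Proof.
have [x0|x0] := lerP x 0.
  by rewrite ltr_wpDl ?exp_flat_ge0// exp_flat_gt0//; lra.
by rewrite ltr_wpDr ?exp_flat_ge0// exp_flat_gt0.
Qed.

Lemma smooth_step_smooth : smooth_on setT smooth_step.
Proof.
have s1 : smooth_on setT (fun x : R => 1 - x).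
  exact: (smooth_onB openT (smooth_on_cst _ openT) (smooth_on_id openT)).
have s2 : smooth_on setT (fun x : R => exp_flat 0 (1 - x)).
  exact: (smooth_on_comp openT (exp_flat_smooth 0) s1).
apply: (smooth_onM openT (exp_flat_smooth 0)).
apply: (smooth_onV openT (smooth_onD openT (exp_flat_smooth 0) s2)) => x _ /=.
by rewrite gt_eqF// smooth_step_den.
Qed.

Lemma smooth_step0 (x : R) : x <= 0 -> smooth_step x = 0.
Proof. by move=> x0; rewrite /smooth_step exp_flat_le0// mul0r. Qed.

Lemma smooth_step1 (x : R) : 1 <= x -> smooth_step x = 1.
Proof.
move=> x1; rewrite /smooth_step [exp_flat 0 (1 - x)]exp_flat_le0; last by lra.
by rewrite addr0 divff// gt_eqF// exp_flat_gt0//; lra.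
Qed.

Lemma smooth_step_itv (x : R) : 0 <= smooth_step x <= 1.
Proof.
rewrite /smooth_step divr_ge0 ?exp_flat_ge0 ?(ltW (smooth_step_den _))//=.
by rewrite ler_pdivrMr ?smooth_step_den// mul1r lerDl exp_flat_ge0.
Qed.

Definition plateau (x : R) : R := smooth_step (2 - x) * smooth_step (2 + x).

Lemma plateau_smooth : smooth_on setT plateau.
Proof.
apply: (smooth_onM openT).
  apply: (smooth_on_comp openT smooth_step_smooth _ (fun _ _ => I)).
  exact: (smooth_onB openT (smooth_on_cst _ openT) (smooth_on_id openT)).
apply: (smooth_on_comp openT smooth_step_smooth _ (fun _ _ => I)).
exact: (smooth_onD openT (smooth_on_cst _ openT) (smooth_on_id openT)).
Qed.

Lemma plateau1 (x : R) : `|x| <= 1 -> plateau x = 1.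
Proof.
by rewrite ler_norml => /andP[x1 x2]; rewrite /plateau !smooth_step1 ?mulr1//; lra.
Qed.

Lemma plateau0 (x : R) : 2 <= `|x| -> plateau x = 0.
Proof.
rewrite ler_normr => /orP[x2|x2]; rewrite /plateau.
  by rewrite smooth_step0 ?mul0r//; lra.
by rewrite [X in _ * X]smooth_step0 ?mulr0//; lra.
Qed.

Lemma plateau_itv (x : R) : 0 <= plateau x <= 1.
Proof.
rewrite /plateau; have /andP[a0 a1] := smooth_step_itv (2 - x).
have /andP[b0 b1] := smooth_step_itv (2 + x).
by rewrite mulr_ge0//= mulr_ile1.
Qed.

Lemma is_derive_monomial (c : R) n (x : R) :
  is_derive x 1 (fun z => c * z ^+ n) (c * (n%:R * x ^+ n.-1)).
Proof.
rewrite (_ : (fun z => _) = c \*: (id ^+ n)); last by apply/funext => z; rewrite !fctE.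
apply: (is_derive_eq (is_deriveZ _ (is_deriveX n (is_derive_id x (1 : R))))).
by rewrite /GRing.scale/= mulr1.
Qed.

(** * Taylor estimates and bounds on compact intervals *)

Definition taylor_poly (d : nat -> R -> R) N (x : R) := \sum_(k < N) d k 0 / k`!%:R * x ^+ k.

(** Differentiation turns the Taylor polynomial of a jet into that of the shifted jet, so the mean
    value theorem gains one power of |x| per step. The factor 1/N! is given up. *)
Lemma taylor_bound (d : nat -> R -> R) N (C r : R) : jet setT d ->
    (forall x, `|x| <= r -> `|d N x| <= C) ->
  forall x, `|x| <= r -> `|d 0%N x - taylor_poly d N x| <= C * `|x| ^+ N.
Proof.
elim: N d => [|N IH] d jd dC x xr.
  by rewrite /taylor_poly big_ord0 subr0 expr0 mulr1 dC.
pose dS k := d k.+1.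
have jdS : jet setT dS by move=> k y _; exact: jd.
have dP (y : R) : is_derive y 1 (taylor_poly d N.+1) (taylor_poly dS N y).
  rewrite /taylor_poly; under eq_fun do rewrite big_ord_recl.
  rewrite -[\sum_(k < N) _]add0r; apply: is_deriveD.
    by under eq_fun do rewrite expr0 mulr1; exact: is_derive_cst.
  rewrite (_ : (fun z => _) = \sum_(k < N) (fun z => d (bump 0 k) 0 / (bump 0 k)`!%:R * z ^+ bump 0 k)); last first.
    by apply/funext => z; rewrite fct_sumE.
  apply: is_derive_sum => k.
  apply: (is_derive_eq (is_derive_monomial _ _ _)).
  rewrite /bump/= add1n/= factS natrM /dS.
  have k0 : (k`!%:R : R) != 0 by rewrite pnatr_eq0 -lt0n fact_gt0.
  have k1 : (k.+1%:R : R) != 0 by rewrite pnatr_eq0.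
  rewrite add0n; move: k0 k1; move: (k`!%:R : R) (k.+1%:R : R) => F K F0 K0.
  by field; rewrite F0 K0.
have [|c cx E] := @MVT_between R (fun y => d 0%N y - taylor_poly d N.+1 y)
    (fun y => dS 0%N y - taylor_poly dS N y) 0 x.
  by move=> y _; exact: (is_deriveB (jd 0%N y I) (dP y)).
have c_le : `|c| <= `|x|.
  move: cx; case: (lerP 0 x) => x0 /andP[c1 c2]; first by rewrite !ger0_norm.
  by rewrite !ler0_norm ?lerN2// ltW.
have T0 : d 0%N 0 - taylor_poly d N.+1 0 = 0.
  rewrite /taylor_poly big_ord_recl expr0 mulr1 fact0 divr1 big1 ?addr0 ?subrr// => k _.
  by rewrite expr0n mulr0.
rewrite T0 !subr0 in E; rewrite E normrM exprSr mulrA ler_wpM2r//.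
have cr : `|c| <= r := le_trans c_le xr.
have H := IH dS jdS dC c cr; rewrite (le_trans H)//.
have C0 : 0 <= C by rewrite (le_trans _ (dC x xr)).
by rewrite ler_wpM2l// lerXn2r ?nnegrE.
Qed.

Lemma derive_bound_lipschitz (f df : R -> R) (C : R) :
  (forall x : R, is_derive x 1 f (df x)) -> (forall x, `|df x| <= C) ->
  forall x y, `|f x - f y| <= C * `|x - y|.
Proof.
move=> fd dC x y; have [c _ ->] := @MVT_between R f df y x (fun z _ => fd z).
by rewrite normrM ler_wpM2r.
Qed.

Lemma smooth_on_bounded (f : R -> R) k (r : R) : smooth_on setT f -> 0 <= r ->
  exists2 C, 0 <= C & forall x, `|x| <= r -> `|derive1n k f x| <= C.
Proof.
move=> sf r0; have [||c _ cP] := @EVT_max R (fun x => `|derive1n k f x|) (- r) r.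
- by rewrite ge0_cp.
- apply: continuous_subspaceT => x; apply: continuous_comp; last exact: norm_continuous.
  exact: smooth_on_continuous sf _.
exists `|derive1n k f c| => // x; rewrite ler_norml => xr.
by apply: cP; rewrite in_itv.
Qed.

End OneVariable.

(** * Borel's lemma *)

Section BorelLemma.
Context {R : realType}.

Lemma is_derive_quadratic_bound (g : R -> R) (C : R) :
  (forall h, `|g h| <= C * h ^+ 2) -> is_derive (0 : R) 1 g 0.
Proof.
move=> gC; have g0 : g 0 = 0.
  by apply/eqP; rewrite -normr_le0 (le_trans (gC 0))// expr0n mulr0.
have Q : (h^-1 *: ((g \o shift 0) (h *: 1) - g 0)) @[h --> 0^'] --> (0 : R).
  apply/cvgrPdist_le => e e0; near=> h.
  rewrite /= sub0r normrN g0 subr0 addr0 [_%:A]mulr1.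
  have h0 : h != 0 by near: h; exact: nbhs_dnbhs_neq.
  rewrite normrM normfV ler_pdivrMl ?normr_gt0// (le_trans (gC h))//.
  rewrite -real_normK ?num_real// expr2 mulrCA ler_pM2l ?normr_gt0//.
  have : `|h| <= e / (`|C| + 1).
    by near: h; apply: dnbhs0_le; rewrite divr_gt0// ltr_wpDl.
  rewrite ler_pdivlMr ?ltr_wpDl// => hC.
  have := ler_wpM2r (normr_ge0 h) (ler_norm C); have := normr_ge0 h; nra.
by split; [apply/cvg_ex; eexists; exact: Q|exact: (cvg_lim _ Q)].
Unshelve. all: by end_near. Qed.

Lemma is_derive_sumr N (F : 'I_N -> R -> R) (dF : 'I_N -> R) (x : R) :
  (forall k, is_derive x 1 (F k) (dF k)) ->
  is_derive x 1 (fun y => \sum_(k < N) F k y) (\sum_(k < N) dF k).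
Proof.
move=> dFk; rewrite (_ : (fun y => _) = \sum_(k < N) F k).
  exact: is_derive_sum.
by apply/funext => y; rewrite fct_sumE.
Qed.

Lemma geometric_half_bound N : \sum_(k < N) (2^-1 : R) ^+ k <= 2.
Proof.
suff -> : \sum_(k < N) (2^-1 : R) ^+ k = 2 - 2 * 2^-1 ^+ N.
  by rewrite gerBl mulr_ge0// exprn_ge0// invr_ge0.
elim: N => [|N IH]; first by rewrite big_ord0 expr0 mulr1 subrr.
by rewrite big_ord_recr IH /= exprS; field.
Qed.

Lemma open_norm_gt (c : R) : open [set y : R | c < `|y|].
Proof.
have -> : [set y : R | c < `|y|] = [set y | y < - c] `|` [set y | c < y].
  by apply/seteqP; split=> y /=; rewrite ltr_normr ltrNr; [case/orP; [right|left]|case=> ->; rewrite ?orbT].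
by apply: openU; [exact: open_lt|exact: open_gt].
Qed.

Lemma open_norm_lt (c : R) : open [set y : R | `|y| < c].
Proof.
have -> : [set y : R | `|y| < c] = [set y | y < c] `&` [set y | - c < y].
  by apply/seteqP; split=> y /=; rewrite ltr_norml; [case/andP|case=> -> ->].
by apply: openI; [exact: open_lt|exact: open_gt].
Qed.

Definition monomial_bump k (x : R) := x ^+ k * plateau (4 * x).

Lemma monomial_bump_smooth k : smooth_on setT (monomial_bump k).
Proof.
apply: (smooth_onM openT (smooth_onX k openT (smooth_on_id openT))).
apply: (smooth_on_comp openT (@plateau_smooth R) _ (fun _ _ => I)).
exact: (smooth_onM openT (smooth_on_cst 4 openT) (smooth_on_id openT)).
Qed.

Lemma monomial_bump_out k n (x : R) : 2^-1 < `|x| -> derive1n n (monomial_bump k) x = 0.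
Proof.
move=> x1; pose D := [set y : R | 2^-1 < `|y|].
have oD : open D := @open_norm_gt 2^-1.
have [||_ E] := @jet_smooth_on R D (fun _ _ => 0) (monomial_bump k) oD.
- by move=> j y _; exact: is_derive_cst.
- move=> y Dy; rewrite /monomial_bump plateau0 ?mulr0// normrM gtr0_norm//.
  by move: Dy; rewrite /D/= => Dy; lra.
exact: E.
Qed.

Lemma monomial_bump_at0 k n : derive1n n (monomial_bump k) 0 = (if n == k then k`!%:R else 0) :> R.
Proof.
pose D := [set y : R | `|y| < 4^-1].
have oD : open D := @open_norm_lt 4^-1.
have D0 : D 0 by rewrite /D/= normr0 invr_gt0.
have [||_ E] := @jet_smooth_on R D (fun n x => (k ^_ n)%:R * x ^+ (k - n)) (monomial_bump k) oD.
- move=> j y _; apply: (is_derive_eq (is_derive_monomial _ _ _)).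
  by rewrite ffactnSr natrM mulrA subnS.
- move=> y Dy; rewrite /monomial_bump plateau1 ?mulr1 ?ffactn0 ?mul1r ?subn0//.
  by rewrite normrM gtr0_norm//; move: Dy; rewrite /D/= => Dy; lra.
rewrite E// expr0n subn_eq0; case: ltngtP => [nk|kn|->].
- by rewrite ffact_small// mul0r.
- by rewrite mulr0.
- by rewrite ffactnn mulr1.
Qed.

Lemma monomial_bump_bounded k n : exists2 C, 0 <= C & forall x : R, `|derive1n n (monomial_bump k) x| <= C.
Proof.
have [C C0 Cx] := smooth_on_bounded n (monomial_bump_smooth k) ler01.
exists C => // x; have [x1|x1] := lerP `|x| 1; first exact: Cx.
by rewrite monomial_bump_out ?normr0//; lra.
Qed.

Section Coefficients.
Variables (a : nat -> R) (eta : R).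
Hypothesis eta0 : 0 < eta.

Let Bd k n := s2val (cid2 (monomial_bump_bounded k n)).

Let Bd_ge0 k n : 0 <= Bd k n.
Proof. exact: (s2valP (cid2 (monomial_bump_bounded k n))). Qed.

Let Bd_le k n x : `|derive1n n (monomial_bump k) x| <= Bd k n.
Proof. exact: (s2valP' (cid2 (monomial_bump_bounded k n))). Qed.

Let S k := \sum_(n < k.+1) Bd k n.

Let S_ge0 k : 0 <= S k.
Proof. by apply: sumr_ge0 => n _; exact: Bd_ge0. Qed.

Let delta := Num.min 1 eta.

Let delta_gt0 : 0 < delta.
Proof. by rewrite lt_min ltr01. Qed.

(** Width of the k-th term. From k = 2 on it is so small that each derivative of order below k is at
    most 2^-k eta; the terms 0 and 1 keep width 1, so that their size is linear in [a 0] and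
    [a 1]. *)
Let eps k := if (k < 2)%N then 1 else 2^-1 ^+ k * delta / (1 + `|a k| * S k).

Let den_gt0 k : 0 < 1 + `|a k| * S k.
Proof. by rewrite ltr_pwDl// mulr_ge0. Qed.

Let eps_gt0 k : 0 < eps k.
Proof.
by rewrite /eps; case: ifP => // _; rewrite divr_gt0 ?den_gt0// mulr_gt0// exprn_gt0// invr_gt0.
Qed.

Let half_pow_le1 k : 2^-1 ^+ k <= 1 :> R.
Proof. by rewrite exprn_ile1// ?invr_ge0//; lra. Qed.

Let eps_le k : (2 <= k)%N -> eps k <= 2^-1 ^+ k.
Proof.
move=> k2; rewrite /eps ltnNge k2/= ler_pdivrMr ?den_gt0// ler_pM2l ?exprn_gt0 ?invr_gt0//.
by rewrite (@le_trans _ _ 1)// ?ge_min ?lexx// lerDl mulr_ge0.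
Qed.

Let eps_le1 k : eps k <= 1.
Proof.
have [k2|k2] := leqP 2 k; first exact: le_trans (eps_le k2) (half_pow_le1 k).
by rewrite /eps k2.
Qed.

(** The n-th derivative of the k-th term of the Borel sum, which coincides with a_k v^k near 0. *)
Let T k n v := a k * eps k ^+ k * (eps k)^-1 ^+ n * derive1n n (monomial_bump k) (v / eps k).

Let T_jet k : jet setT (T k).
Proof.
move=> n v _; rewrite /T.
have d : is_derive v 1 (fun w : R => w / eps k) (eps k)^-1.
  have := is_derive_monomial (eps k)^-1 1 v; rewrite mulr1 mulr1.
  by congr is_derive; apply/funext => w; rewrite expr1 mulrC.
have dM := is_derive1_compR (monomial_bump_smooth k n I) d.
apply: (is_derive_eq (is_deriveZ (a k * eps k ^+ k * (eps k)^-1 ^+ n) dM)).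
by rewrite /GRing.scale/= [(eps k)^-1 ^+ n.+1]exprSr !mulrA.
Qed.

Let T_at0 k n : T k n 0 = if n == k then k`!%:R * a k else 0.
Proof.
rewrite /T mul0r monomial_bump_at0; case: eqP => [->|_]; last by rewrite mulr0.
by rewrite exprVn mulfK ?expf_neq0 ?gt_eqF ?eps_gt0// mulrC.
Qed.

Let T_out k n v : eps k <= `|v| -> T k n v = 0.
Proof.
move=> ev; rewrite /T monomial_bump_out ?mulr0// normrM normfV [`|eps k|]gtr0_norm ?eps_gt0//.
rewrite ltr_pdivlMr ?eps_gt0//; have := eps_gt0 k; lra.
Qed.

Let T_small k n v : (2 <= k)%N -> (n < k)%N -> `|T k n v| <= 2^-1 ^+ k * delta.
Proof.
move=> k2 nk; rewrite /T.
have -> : a k * eps k ^+ k * (eps k)^-1 ^+ n = a k * (eps k * eps k ^+ (k - n).-1).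
  rewrite -exprS prednK ?subn_gt0// -mulrA exprVn; congr (_ * _).
  have H (e : R) : e != 0 -> e ^+ k / e ^+ n = e ^+ (k - n).
    by move=> e0; rewrite -[in LHS](subnK (ltnW nk)) exprD mulfK// expf_neq0.
  by apply: H; rewrite gt_eqF ?eps_gt0.
rewrite !normrM [`|eps k|]gtr0_norm ?eps_gt0//.
have H1 : `|eps k ^+ (k - n).-1| <= 1.
  by rewrite ger0_norm ?exprn_ge0 ?(ltW (eps_gt0 k))// exprn_ile1 ?(ltW (eps_gt0 k)).
have H2 : `|derive1n n (monomial_bump k) (v / eps k)| <= S k.
  rewrite (le_trans (Bd_le _ _ _))// /S (bigD1 (Ordinal (leqW nk)))//= lerDl.
  by apply: sumr_ge0 => i _; exact: Bd_ge0.
have E : eps k * (1 + `|a k| * S k) = 2^-1 ^+ k * delta.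
  by rewrite /eps ltnNge k2/= divfK// gt_eqF ?den_gt0.
rewrite -E; have e0 := eps_gt0 k; have a0 := normr_ge0 (a k).
apply: (@le_trans _ _ (`|a k| * (eps k * 1) * S k)).
  by rewrite ler_pM ?mulr_ge0 ?(ltW e0)// ler_wpM2l// ler_wpM2l ?(ltW e0).
have := mulr_ge0 a0 (S_ge0 k); nra.
Qed.

(** Two applications of the mean value theorem to the bound on the derivative of order n + 2: those
    of orders n and n + 1 vanish at 0. *)
Let T_quad k n v : (n.+3 <= k)%N -> `|T k n v| <= 2^-1 ^+ k * v ^+ 2.
Proof.
move=> nk; have k2 : (2 <= k)%N by exact: leq_trans nk.
have d1 : delta <= 1 by rewrite /delta ge_min lexx.
have lin m w : (m.+2 <= k)%N -> (forall z, `|z| <= `|w| -> `|T k m.+1 z| <= 2^-1 ^+ k * `|w| ^+ (n.+1 - m)) ->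
    `|T k m w| <= 2^-1 ^+ k * `|w| ^+ (n.+1 - m) * `|w|.
  move=> mk H; have [c cw E] := @MVT_between R (T k m) (T k m.+1) 0 w (fun z _ => @T_jet k m z I).
  have := T_at0 k m; rewrite ltn_eqF ?(ltnW mk)// => T0.
  move: E; rewrite T0 !subr0 => ->; rewrite normrM ler_wpM2r// H//.
  move: cw; case: (lerP 0 w) => w0 /andP[c1 c2]; first by rewrite !ger0_norm.
  by rewrite !ler0_norm ?lerN2// ltW.
have L1 w : `|T k n.+1 w| <= 2^-1 ^+ k * `|w|.
  have := @lin n.+1 w nk; rewrite subnn expr0 mulr1; apply=> z _.
  rewrite (le_trans (T_small _ k2 _))//.
  by rewrite ler_piMr ?exprn_ge0 ?invr_ge0.
have := @lin n v (ltnW nk); rewrite subSnn expr1 -mulrA -expr2 real_normK ?num_real//; apply => z zv.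
by rewrite (le_trans (L1 z))// ler_wpM2l// exprn_ge0// invr_ge0.
Qed.

Let eps_eventually (r : R) : 0 < r -> exists N, forall k, (N <= k)%N -> eps k <= r.
Proof.
move=> r0; have [m Hm] := ltr_add_invr r0; rewrite add0r in Hm.
exists (maxn 2 m.+1) => k; rewrite geq_max => /andP[k2 mk].
rewrite (le_trans (eps_le k2))// (le_trans _ (ltW Hm))// exprVn lef_pV2 ?posrE ?exprn_gt0 ?ltr0n//.
by rewrite -natrX ler_nat (leq_trans mk)// ltnW// ltn_expl.
Qed.

(** The widths tend to 0 and, at 0 itself, order n meets only the term k = n. So the Borel sum is
    pointwise a finite sum, and no convergence of series enters. *)
Let T_finite n v : exists N, forall k, (N <= k)%N -> T k n v = 0.
Proof.
have [->|v0] := eqVneq v 0.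
  by exists n.+1 => k nk; rewrite T_at0 ltn_eqF.
have [|N HN] := @eps_eventually `|v|; first by rewrite normr_gt0.
by exists N => k Nk; apply: T_out; exact: HN.
Qed.

Let b n v := \sum_(k < sval (cid (T_finite n v))) T k n v.

Let bE N n v : (forall k, (N <= k)%N -> T k n v = 0) -> b n v = \sum_(k < N) T k n v.
Proof.
rewrite /b; case: cid => N' /= HN' HN.
have ext M M' : (forall k, (M <= k)%N -> T k n v = 0) -> (M <= M')%N ->
    \sum_(k < M') T k n v = \sum_(k < M) T k n v.
  move=> HM MM'; rewrite -(subnKC MM') big_split_ord/= [X in _ + X]big1 ?addr0// => i _.
  by rewrite HM// leq_addr.
by rewrite -(ext N' (maxn N N'))// ?leq_maxr// (ext N)// leq_maxl.
Qed.

(** Away from 0 the sum is locally finite. At 0 the first n + 3 terms are differentiated one by one,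
    and the rest is at most 2 h^2 by [T_quad], hence has derivative 0. *)
Let b_jet : jet setT b.
Proof.
move=> n v _; have [->|v0] := eqVneq v 0; last first.
  have [|N HN] := @eps_eventually (`|v| / 2); first by rewrite divr_gt0 ?normr_gt0.
  have E m : \forall w \near v, \sum_(k < N) T k m w = b m w.
    near=> w; rewrite (@bE N)// => k Nk; apply: T_out; rewrite (le_trans (HN k Nk))//.
    have : `|v - w| <= `|v| / 2.
      by near: w; apply: (@cvgr_dist_le _ _ _ (nbhs v) _ id v) => //; rewrite divr_gt0 ?normr_gt0.
    by have := ler_distD w v 0; rewrite !subr0; lra.
  apply: near_eq_is_derive (E n) _; rewrite -(nbhs_singleton (E n.+1)).
  by apply: is_derive_sumr => k; exact: T_jet.
have -> : b n = (fun v => \sum_(k < n.+3) T k n v + (b n v - \sum_(k < n.+3) T k n v)).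
  by apply/funext => w; rewrite addrC subrK.
rewrite (@bE n.+3); last first.
  by move=> k nk; rewrite T_at0 ltn_eqF// ltnW.
rewrite -[\sum_(k < _) _]addr0; apply: is_deriveD.
  by apply: is_derive_sumr => k; exact: T_jet.
apply: (@is_derive_quadratic_bound _ 2) => h.
have [N HN] := T_finite n h.
rewrite (@bE (n.+3 + N)); last by move=> k Nk; rewrite HN// (leq_trans _ Nk)// leq_addl.
rewrite big_split_ord/= addrAC subrr add0r (le_trans (ler_norm_sum _ _ _))//.
apply: (@le_trans _ _ (\sum_(i < N) 2^-1 ^+ i * h ^+ 2)).
  apply: ler_sum => i _; rewrite (le_trans (T_quad _ _)) ?leq_addr//.
  rewrite ler_wpM2r ?sqr_ge0// exprD ler_piMl ?exprn_ge0 ?invr_ge0//.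
by rewrite -mulr_suml ler_wpM2r ?sqr_ge0// geometric_half_bound.
Unshelve. all: by end_near. Qed.

Let b_small n v : (n < 2)%N ->
  `|b n v| <= (Bd 0 n + Bd 1 n) * (`|a 0%N| + `|a 1%N|) + 2 * eta.
Proof.
move=> n2; have [N HN] := T_finite n v.
rewrite (@bE (2 + N)); last by move=> k Nk; rewrite HN// (leq_trans _ Nk)// leq_addl.
rewrite big_split_ord/= (le_trans (ler_normD _ _))// lerD//.
  rewrite !big_ord_recl big_ord0 addr0 (le_trans (ler_normD _ _))//.
  rewrite /T /eps/= !expr1n invr1 !expr1n !mulr1 !normrM.
  have := Bd_le 0 n v; have := Bd_le 1 n v; have := Bd_ge0 0 n; have := Bd_ge0 1 n.
  have := normr_ge0 (a 0%N); have := normr_ge0 (a 1%N).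
  move: (`|a 0%N|) (`|a 1%N|) (Bd 0 n) (Bd 1 n) `|derive1n n (monomial_bump 0) v| `|derive1n n (monomial_bump 1) v|.
  by move=> a0 a1 B0 B1 d0 d1 *; nra.
rewrite (le_trans (ler_norm_sum _ _ _))//.
apply: (@le_trans _ _ (\sum_(i < N) 2^-1 ^+ i * eta)).
  apply: ler_sum => i _; rewrite (le_trans (T_small _ _ _)) ?(leq_trans n2) ?leq_addr//.
  apply: ler_pM; rewrite ?(ltW delta_gt0) ?exprn_ge0 ?invr_ge0//.
    by rewrite exprD ler_piMl ?exprn_ge0 ?invr_ge0.
  by rewrite /delta ge_min lexx orbT.
by rewrite -mulr_suml ler_wpM2r ?(ltW eta0)// geometric_half_bound.
Qed.

Lemma borel_aux : exists2 g : R -> R, smooth_on setT g /\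
    (forall n, derive1n n g 0 = n`!%:R * a n) &
    forall n v, (n < 2)%N ->
      `|derive1n n g v| <= (Bd 0 n + Bd 1 n) * (`|a 0%N| + `|a 1%N|) + 2 * eta.
Proof.
have [//|sb bE'] := @jet_smooth_on R setT b (b 0%N) openT b_jet.
exists (b 0%N); last by move=> n v n2; rewrite bE'//; exact: b_small.
split=> // n; rewrite bE'// (@bE n.+1); last by move=> k nk; rewrite T_at0 ltn_eqF.
rewrite big_ord_recr/= T_at0 eqxx big1 ?add0r// => i _.
by rewrite T_at0 gtn_eqF.
Qed.

End Coefficients.

(** Borel's lemma with C^1 bounds: C depends on the bumps only, and the coefficients from the second
    on contribute an arbitrarily small [2 * eta]. These bounds keep the extension across a cusp
    small. *)
Lemma borel : exists2 C : R, 0 <= C & forall (a : nat -> R) (eta : R), 0 < eta ->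
  exists2 g : R -> R, smooth_on setT g /\ (forall n, derive1n n g 0 = n`!%:R * a n) &
    forall v, `|g v| <= C * (`|a 0%N| + `|a 1%N|) + 2 * eta /\
      `|derive1n 1 g v| <= C * (`|a 0%N| + `|a 1%N|) + 2 * eta.
Proof.
pose Bd k n := s2val (cid2 (monomial_bump_bounded k n)).
have Bd0 k n : 0 <= Bd k n := s2valP (cid2 (monomial_bump_bounded k n)).
exists (Bd 0%N 0%N + Bd 1%N 0%N + (Bd 0%N 1%N + Bd 1%N 1%N)); first by rewrite !addr_ge0.
move=> a eta eta0; have [g gP gB] := borel_aux a eta0; exists g => // v.
have A0 : 0 <= `|a 0%N| + `|a 1%N| by rewrite addr_ge0.
split.
  rewrite (le_trans (gB 0%N v isT))// lerD2r ler_wpM2r// lerDl.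
  by rewrite addr_ge0//; exact: Bd0.
rewrite (le_trans (gB 1%N v isT))// lerD2r ler_wpM2r// lerDr.
by rewrite addr_ge0//; exact: Bd0.
Qed.

End BorelLemma.

(** * Functions of the half-angle tangent at a cusp *)

Section CuspSplit.
Context {R : realType}.

(** Both exponents serve to close the class under differentiation: the chain rule raises n and m by
    1, and differentiating the negative power raises m by 2. *)
Definition flat_sqrt (rho : R -> R) n m (v : R) : R :=
  if 0 < v then derive1n n rho (Num.sqrt v) * (Num.sqrt v)^-1 ^+ m else 0.

Lemma is_derive_sqrt_inv (v : R) : 0 < v ->
  is_derive v 1 (fun w => (Num.sqrt w)^-1) (- (2^-1 * (Num.sqrt v)^-1 ^+ 3)).
Proof.
move=> v0; have s0 : Num.sqrt v != 0 by rewrite gt_eqF// sqrtr_gt0.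
apply: (is_derive_eq (is_deriveV s0 (is_derive1_sqrt v0))).
rewrite /GRing.scale/= -exprVn invfM; move: (Num.sqrt v)^-1 => z.
by rewrite !exprS expr0; ring.
Qed.

Lemma flat_sqrt_smooth (rho : R -> R) m : smooth_on setT rho ->
    (forall n N, exists C, forall u, `|u| <= 1 -> `|derive1n n rho u| <= C * `|u| ^+ N) ->
  smooth_on setT (flat_sqrt rho 0 m).
Proof.
move=> sr fr.
pose S := [set g : R -> R | exists p : seq (R * (nat * nat)),
  g = fun x => \sum_(c <- p) c.1 * flat_sqrt rho c.2.1 c.2.2 x].
apply: (@smooth_zero_left R S); last first.
  by exists [:: (1, (0%N, m))]; apply/funext => x; rewrite big_cons big_nil addr0 mul1r.
move=> _ [p ->]; split.
- by move=> x x0; rewrite big1// => c _; rewrite /flat_sqrt ltNge x0 mulr0.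
- elim: p => [|[c [n k]] p [C pC]]; first by exists 0 => x _; rewrite big_nil normr0 mul0r.
  (* Flatness to order k + 4 beats the factor sqrt(x)^-k and leaves sqrt(x)^4 = x^2. *)
  have [C' C'P] := fr n (k + 4)%N.
  exists (`|c| * C' + C) => x x01; rewrite big_cons (le_trans (ler_normD _ _))// mulrDl lerD ?pC//=.
  have /andP[x0 x1] := x01.
  rewrite normrM -mulrA ler_wpM2l// /flat_sqrt x0.
  have s0 : 0 < Num.sqrt x by rewrite sqrtr_gt0.
  have s1 : `|Num.sqrt x| <= 1 by rewrite ger0_norm ?sqrtr_ge0// -sqrtr1 ler_wsqrtr.
  have := C'P _ s1; rewrite [`|Num.sqrt x|]gtr0_norm// => H.
  rewrite normrM [`|_ ^+ k|]ger0_norm; last by rewrite exprn_ge0// invr_ge0 ltW.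
  rewrite exprVn ler_pdivrMr ?exprn_gt0// (le_trans H)//.
  have -> : C' * x ^+ 2 * Num.sqrt x ^+ k = C' * Num.sqrt x ^+ (k + 4).
    by rewrite -{1}(sqr_sqrtr (ltW x0)) -exprM -mulrA -exprD addnC.
  by [].
- elim: p => [|[c [n k]] p [g' [q ->] gq]].
    by exists (fun=> 0); [exists [::]; apply/funext => x; rewrite big_nil|
      move=> x _; under eq_fun do rewrite big_nil; exact: is_derive_cst].
  exists (fun x => \sum_(c <- (c / 2, (n.+1, k.+1)) :: (- (c * k%:R / 2), (n, k.+2)) :: q)
     c.1 * flat_sqrt rho c.2.1 c.2.2 x); first by eexists.
  move=> x x0; under eq_fun do rewrite big_cons.
  rewrite !big_cons addrA; apply: is_deriveD; last exact: gq.
  rewrite /= /flat_sqrt x0.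
  have d1 := is_derive1_sqrt x0.
  have d2 := is_derive_sqrt_inv x0.
  have d3 := is_derive1_compR (sr n (Num.sqrt x) I) d1.
  have d4 := is_deriveX k d2.
  have d5 := is_deriveZ c (is_deriveM d3 d4).
  apply: (@near_eq_is_derive _ _ _ _ _ _ _ _ _ (is_derive_eq d5 _)).
    near=> y; rewrite !fctE/= ifT//; near: y.
    by apply: (@open_nbhs_nbhs _ x [set y | y > 0]); split => //; exact: open_gt.
  rewrite /GRing.scale/= invfM.
  rewrite [X in c * (_ * _ + X * _)](_ : _ = (Num.sqrt x)^-1 ^+ k); last by rewrite !fctE.
  move: (derive1n n rho _) (derive1 (derive1n n rho) _) (Num.sqrt x)^-1 => a b z.
  by case: k {d4 d5} => [|k] /=; rewrite -?[k.+1%:R]natr1 !exprS ?expr0; field.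
Unshelve. all: by end_near. Qed.

Lemma eq0_of_linear_bound (c C : R) : (forall u : R, 0 < u <= 1 -> `|c| <= C * u) -> c = 0.
Proof.
move=> H; apply/eqP; rewrite -normr_le0; apply/ler_addgt0Pl => e e0; rewrite addr0.
pose u := Num.min 1 (e / (`|C| + 1)).
have C1 : 0 < `|C| + 1 by rewrite ltr_wpDl.
have u0 : 0 < u by rewrite lt_min ltr01 divr_gt0.
have u1 : u <= 1 by rewrite ge_min lexx.
have u2 : u * (`|C| + 1) <= e by rewrite -ler_pdivlMr// ge_min lexx orbT.
have := H u; rewrite u0 u1 => /(_ isT); have := ler_norm C; nra.
Qed.

Lemma smooth_taylor (f : R -> R) N : smooth_on setT f ->
  exists C, forall u, `|u| <= 1 -> `|f u - taylor_poly (fun k => derive1n k f) N u| <= C * `|u| ^+ N.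
Proof.
move=> sf; have [C C0 CP] := smooth_on_bounded N sf ler01.
by exists C => u u1; exact: (taylor_bound sf CP).
Qed.

(** Comparison with Taylor polynomials kills the derivatives at 0 one after another; Taylor's bound
    for each derivative, now with zero polynomial, is its flatness. *)
Lemma flat_of_bigO (rho : R -> R) : smooth_on setT rho ->
    (forall N, exists C, forall u, `|u| <= 1 -> `|rho u| <= C * `|u| ^+ N) ->
  forall n N, exists C, forall u, `|u| <= 1 -> `|derive1n n rho u| <= C * `|u| ^+ N.
Proof.
move=> sr rO.
have D0 n : derive1n n rho 0 = 0.
  have [m] := ubnP n; elim: m n => // m IH n; rewrite ltnS => nm.
  have [C CP] := smooth_taylor n.+1 sr; have [C' C'P] := rO n.+1.
  have : derive1n n rho 0 / n`!%:R = 0.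
    apply: (@eq0_of_linear_bound _ (C + C')) => u /andP[u0 u1].
    have un : `|u| = u by rewrite gtr0_norm.
    have := CP u; have := C'P u; rewrite un => /(_ u1) H' /(_ u1) H.
    rewrite -(@ler_pM2r _ (u ^+ n)) ?exprn_gt0// -{1}(ger0_norm (exprn_ge0 n (ltW u0))) -normrM.
    rewrite -[(C + C') * u * _]mulrA -exprS mulrDl.
    have E : derive1n n rho 0 / n`!%:R * u ^+ n = taylor_poly (fun k => derive1n k rho) n.+1 u.
      rewrite /taylor_poly big_ord_recr/= big1 ?add0r// => i _.
      by rewrite IH ?mul0r// (leq_trans (ltn_ord i)).
    rewrite E -[X in `|X|](subrK (rho u)) addrC.
    rewrite (le_trans (ler_normD _ _))// addrC lerD// distrC//.
  move/eqP; rewrite mulf_eq0 invr_eq0 pnatr_eq0 -[(n`! == 0)%N]negbK -lt0n fact_gt0 orbF.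
  by move/eqP.
move=> n N; have sn : smooth_on setT (derive1n n rho).
  by elim: n => [//|n IH]; have := smooth_on_deriv IH; rewrite derive1nS.
have [C CP] := smooth_taylor N sn; exists C => u /CP.
rewrite [X in _ - X](_ : _ = 0) ?subr0// /taylor_poly big1// => k _.
by rewrite /derive1n -iterD -/(derive1n _ _) D0 !mul0r.
Qed.

(** Even and odd powers are separated. The linear term stands apart because it is the obstruction,
    killed later by the condition f'(0) = 0. *)
Lemma taylor_parity (F : nat -> R) N u : \sum_(j < N.*2.+3) F j * u ^+ j =
  F 1%N * u + \sum_(k < N.+2) F k.*2 * (u ^+ 2) ^+ k + u ^+ 3 * \sum_(k < N) F k.*2.+3 * (u ^+ 2) ^+ k.
Proof.
elim: N => [|N IH].
  by rewrite !big_ord_recr !big_ord0 /=; ring.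
rewrite doubleS 2!big_ord_recr IH /= [in RHS]big_ord_recr/= [\sum_(k < N.+1) _]big_ord_recr/=.
rewrite -!exprM !mul2n !doubleS [u ^+ N.*2.+3](_ : _ = u ^+ 3 * u ^+ N.*2); last by rewrite -exprD.
by rewrite [u ^+ N.*2.+4](_ : _ = u ^+ 4 * u ^+ N.*2); [ring|rewrite -exprD].
Qed.

(* By Borel's lemma there are [A] and [B] such that [A (u ^+ 2) + u ^+ 3 * B (u ^+ 2)] has the Taylor
   series of [f] at 0; the difference is flat, and its even and odd parts, divided by any power
   of [u], are smooth functions of [u ^+ 2]. *)
Lemma even_odd_split (f : R -> R) (al be : R -> R) : smooth_on setT f -> smooth_on setT al ->
    smooth_on setT be -> derive1n 1 f 0 = 0 ->
    (forall n, derive1n n al 0 = n`!%:R * (derive1n n.*2 f 0 / n.*2`!%:R)) ->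
    (forall n, derive1n n be 0 = n`!%:R * (derive1n n.*2.+3 f 0 / n.*2.+3`!%:R)) ->
  exists A B : R -> R, [/\ smooth_on setT A, smooth_on setT B,
    forall u, f u = A (u ^+ 2) + u ^+ 3 * B (u ^+ 2),
    forall v, v <= 0 -> A v = al v & forall v, v <= 0 -> B v = be v].
Proof.
move=> sf sal sbe f1 al0 be0.
pose r u := f u - (al (u ^+ 2) + u ^+ 3 * be (u ^+ 2)).
have sX : smooth_on setT (fun u : R => u ^+ 2) := smooth_onX 2 openT (smooth_on_id openT).
have sr : smooth_on setT r.
  apply: (smooth_onB openT sf); apply: (smooth_onD openT (smooth_on_comp openT sal sX (fun _ _ => I))).
  exact: (smooth_onM openT (smooth_onX 3 openT (smooth_on_id openT))
           (smooth_on_comp openT sbe sX (fun _ _ => I))).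
have rO N : exists C, forall u, `|u| <= 1 -> `|r u| <= C * `|u| ^+ N.
  have [C1 C1P] := smooth_taylor N.*2.+3 sf.
  have [C2 C2P] := smooth_taylor N.+2 sal; have [C3 C3P] := smooth_taylor N sbe.
  exists (`|C1| + `|C2| + `|C3|) => u u1.
  have u2 : `|u ^+ 2| <= 1 by rewrite normrX exprn_ile1.
  have := C1P u u1; have := C2P _ u2; have := C3P _ u2.
  set P1 := taylor_poly _ _ _; set P2 := taylor_poly _ _ _; set P3 := taylor_poly _ _ _.
  have E : P3 = P2 + u ^+ 3 * P1.
    pose F j := derive1n j f 0 / j`!%:R.
    have -> : P3 = \sum_(j < N.*2.+3) F j * u ^+ j by [].
    rewrite taylor_parity {1}/F f1 mul0r mul0r add0r; congr (_ + _ * _).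
      apply: eq_bigr => k _; rewrite al0 /F; congr (_ * _).
      by rewrite mulrAC divff ?mul1r// pnatr_eq0 -lt0n fact_gt0.
    apply: eq_bigr => k _; rewrite be0 /F; congr (_ * _).
    by rewrite mulrAC divff ?mul1r// pnatr_eq0 -lt0n fact_gt0.
  move=> H3 H2 H1.
  have -> : r u = (f u - P3) - (al (u ^+ 2) - P2) - u ^+ 3 * (be (u ^+ 2) - P1).
    by rewrite E /r; ring.
  have pw k C : (N <= k)%N -> C * `|u| ^+ k <= `|C| * `|u| ^+ N.
    move=> Nk; apply: (@le_trans _ _ (`|C| * `|u| ^+ k)).
      by rewrite ler_wpM2r ?exprn_ge0// ler_norm.
    by rewrite ler_wpM2l// -(subnK Nk) exprD ler_piMl ?exprn_ge0// exprn_ile1.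
  rewrite (le_trans (ler_normB _ _))// mulrDl lerD//.
    rewrite (le_trans (ler_normB _ _))// mulrDl lerD//.
      by rewrite (le_trans H1)// pw//; lia.
    rewrite (le_trans H2)// normrX -exprM pw//.
    lia.
  rewrite normrM normrX (le_trans (ler_wpM2l _ H3)) ?exprn_ge0//.
  by rewrite normrX -exprM mulrCA -exprD pw//; lia.
pose rn u := r (- u).
have srn : smooth_on setT rn.
  exact: (smooth_on_comp openT sr (smooth_onN openT (smooth_on_id openT)) (fun _ _ => I)).
have rnO N : exists C, forall u, `|u| <= 1 -> `|rn u| <= C * `|u| ^+ N.
  by have [C CP] := rO N; exists C => u u1; rewrite -[`|u|]normrN; apply: CP; rewrite normrN.
have sE m := flat_sqrt_smooth m sr (flat_of_bigO sr rO).
have sO m := flat_sqrt_smooth m srn (flat_of_bigO srn rnO).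
(* The even part of the flat difference is added to [al], the odd part divided by u^3 to [be], both
   as functions of v = u^2. For v <= 0 the corrections are 0. *)
exists (fun v => al v + 2^-1 * (flat_sqrt r 0 0 v + flat_sqrt rn 0 0 v)).
exists (fun v => be v + 2^-1 * (flat_sqrt r 0 3 v - flat_sqrt rn 0 3 v)).
split.
- apply: (smooth_onD openT sal); apply: (smooth_onM openT (smooth_on_cst _ openT)).
  exact: (smooth_onD openT (sE 0%N) (sO 0%N)).
- apply: (smooth_onD openT sbe); apply: (smooth_onM openT (smooth_on_cst _ openT)).
  exact: (smooth_onB openT (sE 3%N) (sO 3%N)).
- move=> u; rewrite /flat_sqrt !derive1n0.
  have fE : f u = al (u ^+ 2) + u ^+ 3 * be (u ^+ 2) + r u by rewrite /r addrC subrK.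
  have [->|u0] := eqVneq u 0.
    rewrite !expr0n/= ltxx mul0r addr0 addr0 mulr0 addr0.
    have [C CP] := rO 1%N; have := CP 0; rewrite normr0 expr1 mulr0 => /(_ ler01).
    by rewrite normr_le0 /r !expr0n/= mul0r addr0 subr_eq0 => /eqP.
  have u20 : 0 < u ^+ 2 by rewrite lt_def sqrf_eq0 u0 sqr_ge0.
  rewrite u20 sqrtr_sqr fE; have [up|un] := ltrP 0 u.
    by rewrite gtr0_norm// /rn; field.
  rewrite ler0_norm// /rn opprK; field.
  by [].
- by move=> v v0; rewrite /flat_sqrt ltNge v0/= addr0 mulr0 addr0.
- by move=> v v0; rewrite /flat_sqrt ltNge v0/= subr0 mulr0 addr0.
Qed.

Lemma bound_at_limit (g : R -> R) (C : R) : continuous g -> (forall v, v != 0 -> `|g v| <= C) -> forall v, `|g v| <= C.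
Proof.
move=> cg gC v; have [->|] := eqVneq v 0; last exact: gC.
apply/ler_addgt0Pl => e e0.
have /cvgrPdist_le/(_ e e0) H := cg 0.
have H' : \forall w \near (0 : R)^', `|g 0 - g w| <= e /\ w != 0.
  by near=> w; split; near: w; [exact: nbhs_dnbhs|exact: nbhs_dnbhs_neq].
have [w [Hw w0]] := @filter_ex _ _ (Proper_dnbhs_numFieldType (0 : R)) _ H'; have := gC w w0.
have := ler_normD (g 0 - g w) (g w); rewrite subrK; lra.
Unshelve. all: by end_near. Qed.

(** These are the numerators, at v = u^2, of B, of the derivative of A and of the derivative of B;
    the denominators have orders u^3, u and u^5. In the last one the cubic terms cancel and the
    linear ones vanish with [d 1%N 0]. *)
Lemma cusp_taylor (d : nat -> R -> R) (eta u : R) : jet setT d -> d 1%N 0 = 0 ->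
    (forall k u, (k <= 5)%N -> `|u| <= 1 -> `|d k u| <= eta) -> 0 < u -> u <= 1 ->
  [/\ `|d 0%N u - d 0%N (- u)| <= 2 * eta * u ^+ 3,
      `|d 1%N u - d 1%N (- u)| <= 2 * eta * u &
      `|u * (d 1%N u + d 1%N (- u)) - 3 * (d 0%N u - d 0%N (- u))| <= 8 * eta * u ^+ 5].
Proof.
move=> jd d1 db u0 u1.
have un : `|u| <= 1 by rewrite gtr0_norm.
have nun : `|- u| <= 1 by rewrite normrN.
have T3 := @taylor_bound R d 3 eta 1 jd (fun x => db 3%N x isT).
have T5 := @taylor_bound R d 5 eta 1 jd (fun x => db 5%N x isT).
have jS : jet setT (fun k => d k.+1) by move=> k x _; exact: jd.
have T4 := @taylor_bound R (fun k => d k.+1) 4 eta 1 jS (fun x => db 5%N x isT).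
have T1 := @taylor_bound R (fun k => d k.+1) 1 eta 1 jS (fun x => db 2%N x isT).
have ex (a b c : R) : `|a - b| <= c -> exists2 e, a = b + e & - c <= e <= c.
  by move=> H; exists (a - b); [rewrite addrC subrK|rewrite -ler_norml].
have ru := gtr0_norm u0; have rnu : `|- u| = u by rewrite normrN.
split.
- have [e /= E He] := ex _ _ _ (T3 u un); have [e' /= E' He'] := ex _ _ _ (T3 (- u) nun).
  rewrite E E' ru rnu in He He' *.
  rewrite /taylor_poly !big_ord_recr !big_ord0 /= d1.
  have -> : 2 * eta * u ^+ 3 = 2 * (eta * u ^+ 3) by rewrite mulrA.
  set t := eta * u ^+ 3 in He He' *; rewrite ler_norml.
  rewrite !exprS !expr0; move: He He' => /andP[? ?] /andP[? ?].
  by apply/andP; split; lra.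
- have [e /= E He] := ex _ _ _ (T1 u un); have [e' /= E' He'] := ex _ _ _ (T1 (- u) nun).
  rewrite E E' ru rnu expr1 in He He' *.
  rewrite /taylor_poly !big_ord_recr !big_ord0 /= d1.
  have -> : 2 * eta * u = 2 * (eta * u) by rewrite mulrA.
  set t := eta * u in He He' *; rewrite ler_norml.
  move: He He' => /andP[? ?] /andP[? ?].
  by apply/andP; split; lra.
- have [e /= E He] := ex _ _ _ (T5 u un); have [e' /= E' He'] := ex _ _ _ (T5 (- u) nun).
  have [g /= G Hg] := ex _ _ _ (T4 u un); have [g' /= G' Hg'] := ex _ _ _ (T4 (- u) nun).
  rewrite E E' G G' ru rnu in He He' Hg Hg' *.
  rewrite /taylor_poly !big_ord_recr !big_ord0 /= d1.
  have -> : 8 * eta * u ^+ 5 = 8 * (eta * u ^+ 5) by rewrite mulrA.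
  set t := eta * u ^+ 5 in He He' *.
  have tE : t = u * (eta * u ^+ 4) by rewrite /t !exprS; ring.
  have ug : - t <= u * g <= t.
    by move: Hg => /andP[? ?]; rewrite tE -mulrN !ler_pM2l//; apply/andP.
  have ug' : - t <= u * g' <= t.
    by move: Hg' => /andP[? ?]; rewrite tE -mulrN !ler_pM2l//; apply/andP.
  rewrite [X in `|X|](_ : _ = u * g + u * g' - 3 * e + 3 * e'); last first.
    rewrite -[2`!]/2%N -[3`!]/6%N -[4`!]/24%N -[1`!]/1%N -[0`!]/1%N.
    by field.
  move: He He' ug ug' => /andP[? ?] /andP[? ?] /andP[? ?] /andP[? ?].
  by rewrite ler_norml; apply/andP; split; lra.
Qed.

(** The bounds come from Borel's lemma for v < 0, from [cusp_taylor] for 0 < v <= 1 and from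
    continuity at 0. Five derivatives enter because the derivative of B divides by u^5. At u^2 = 3/5
    the first coordinate (1 - u^2) / (1 + u^2) of the circle is 1/4, the edge of the support of
    [cusp_weight]. *)
Lemma cusp_split : exists2 C : R, 0 <= C & forall (f : R -> R) (eta : R), 0 < eta ->
    smooth_on setT f -> derive1n 1 f 0 = 0 ->
    (forall k u, (k <= 5)%N -> `|u| <= 1 -> `|derive1n k f u| <= eta) ->
    (forall u, 3 / 5 <= u ^+ 2 -> f u = 0) ->
  exists A B : R -> R, [/\ smooth_on setT A, smooth_on setT B,
    forall u, f u = A (u ^+ 2) + u ^+ 3 * B (u ^+ 2),
    forall v, 3 / 5 <= v -> A v = 0 /\ B v = 0 &
    forall v, [/\ `|A v| <= C * eta, `|B v| <= C * eta,
      `|derive1n 1 A v| <= C * eta & `|derive1n 1 B v| <= C * eta]].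
Proof.
have [K K0 KP] := @borel R.
exists (2 * K + 4); first by rewrite addr_ge0 ?mulr_ge0.
move=> f eta eta0 sf f1 fb f0.
have [al [sal al0] alb] := KP (fun n => derive1n n.*2 f 0 / n.*2`!%:R) eta eta0.
have [be [sbe be0] beb] := KP (fun n => derive1n n.*2.+3 f 0 / n.*2.+3`!%:R) eta eta0.
have [A [B [sA sB fAB Aal Bbe]]] := even_odd_split sf sal sbe f1 al0 be0.
exists A, B.
have n01 : `|0 : R| <= 1 by rewrite normr0.
have coef k j : (k <= 5)%N -> (0 < j)%N -> `|derive1n k f 0 / j%:R| <= eta.
  move=> k5 j0; rewrite normrM normfV ler_pdivrMr ?normr_gt0 ?pnatr_eq0 -?lt0n//.
  by rewrite (le_trans (fb k 0 k5 n01))// ler_peMr ?(ltW eta0)// ger0_norm// ler1n.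
have alC v : `|al v| <= (2 * K + 4) * eta /\ `|derive1n 1 al v| <= (2 * K + 4) * eta.
  have := alb v; have := coef 0%N 1%N isT isT; have := coef 2%N 2%N isT isT; rewrite /=.
  by move: (`|_ / 2`!%:R|) (`|_ / 1|) => a b Ha Hb [H1 H2]; split; nra.
have beC v : `|be v| <= (2 * K + 4) * eta /\ `|derive1n 1 be v| <= (2 * K + 4) * eta.
  have := beb v; have := coef 3%N 3`! isT isT; have := coef 5%N 5`! isT isT; rewrite /=.
  by move: (`|_ / 5`!%:R|) (`|_ / 3`!%:R|) => a b Ha Hb [H1 H2]; split; nra.
have AE u : A (u ^+ 2) = (f u + f (- u)) / 2.
  by rewrite (fAB u) (fAB (- u)) sqrrN; field.
have BE u : u != 0 -> B (u ^+ 2) = (f u - f (- u)) / 2 * u^-1 ^+ 3.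
  by move=> u0; rewrite (fAB u) (fAB (- u)) sqrrN; field.
have zero v : 3 / 5 <= v -> A v = 0 /\ B v = 0.
  move=> v35; have v0 : 0 <= v by lra.
  rewrite -(sqr_sqrtr v0) AE BE; last by rewrite sqrtr_eq0 -ltNge; lra.
  by rewrite !f0 ?sqrrN ?sqr_sqrtr//; split; ring.
have loc (g h : R -> R) v : (\forall w \near v, h w = g w) -> derive1n 1 g v = derive1n 1 h v.
  by move=> gh; rewrite !derive1n1 !derive1E; apply/esym/near_eq_derive.
have zero' v : 3 / 5 < v -> derive1n 1 A v = 0 /\ derive1n 1 B v = 0.
  move=> v35; have nv : \forall w \near v, 3 / 5 < w.
    by apply: (@open_nbhs_nbhs _ v [set y | y > 3 / 5]); split => //; exact: open_gt.
  have c0 : derive1n 1 (cst (0 : R)) v = 0 by rewrite derive1n1 derive1_cst.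
  by split; rewrite -c0; apply: loc; apply: filterS nv => w /ltW/zero[].
have neg v : v < 0 -> derive1n 1 A v = derive1n 1 al v /\ derive1n 1 B v = derive1n 1 be v.
  move=> v0; have nv : \forall w \near v, w < 0.
    by apply: (@open_nbhs_nbhs _ v [set y | y < 0]); split => //; exact: open_lt.
  by split; apply: loc; apply: filterS nv => w /ltW w0; rewrite ?Aal ?Bbe.
have pos v : 0 < v -> v <= 1 -> [/\ `|A v| <= eta, `|B v| <= eta,
    `|derive1n 1 A v| <= eta & `|derive1n 1 B v| <= 2 * eta].
  move=> v0 v1; pose u := Num.sqrt v.
  have u0 : 0 < u by rewrite sqrtr_gt0.
  have u1 : u <= 1 by rewrite /u -sqrtr1 ler_wsqrtr.
  have un : `|u| <= 1 by rewrite gtr0_norm.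
  have nun : `|- u| <= 1 by rewrite normrN.
  have vE : v = u ^+ 2 by rewrite sqr_sqrtr// ltW.
  have nv : \forall w \near v, 0 < w.
    by apply: (@open_nbhs_nbhs _ v [set y | y > 0]); split => //; exact: open_gt.
  have d1 := is_derive1_sqrt v0; have d2 := is_derive_sqrt_inv v0.
  have df : is_derive v 1 (f \o Num.sqrt) _ := is_derive1_compR (sf 0%N u I) d1.
  have d1n : is_derive v 1 (fun w => - Num.sqrt w) (- (2 * Num.sqrt v)^-1) := is_deriveN d1.
  have dfn := @is_derive1_compR R f (fun w => - Num.sqrt w) v _ _ (sf 0%N (- u) I) d1n.
  have [F1 F2 F3] := @cusp_taylor (fun k => derive1n k f) eta u sf f1 fb u0 u1.
  have z0 : 0 < u^-1 by rewrite invr_gt0.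
  have dA : is_derive v 1 A (u^-1 / 4 * (derive1n 1 f u - derive1n 1 f (- u))).
    have dA0 := is_deriveZ 2^-1 (is_deriveD df dfn).
    apply: (@near_eq_is_derive _ _ _ _ _ _ _ _ _ (is_derive_eq dA0 _)).
      by apply: filterS nv => w w0; rewrite -[in RHS](sqr_sqrtr (ltW w0)) AE !fctE /GRing.scale/= mulrC.
    by rewrite /GRing.scale/= -/u invfM; field; rewrite gt_eqF.
  have dB : is_derive v 1 B (u^-1 ^+ 5 / 4 *
      (u * (derive1n 1 f u + derive1n 1 f (- u)) - 3 * (f u - f (- u)))).
    have dB0 := is_deriveM (is_deriveZ 2^-1 (is_deriveB df dfn)) (is_deriveX 3 d2).
    apply: (@near_eq_is_derive _ _ _ _ _ _ _ _ _ (is_derive_eq dB0 _)).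
      apply: filterS nv => w w0; rewrite -[in RHS](sqr_sqrtr (ltW w0)) BE ?gt_eqF ?sqrtr_gt0//.
      rewrite [LHS](_ : _ = 2^-1 * (f (Num.sqrt w) - f (- Num.sqrt w)) * (Num.sqrt w)^-1 ^+ 3); first by ring.
      by rewrite !fctE.
    rewrite [X in X *: _ + _](_ : _ = 2^-1 * (f u - f (- u)))//.
    rewrite [X in _ + X *: _](_ : _ = u^-1 ^+ 3); last by rewrite !fctE.
    rewrite /GRing.scale/= -/u invfM.
    by field; rewrite gt_eqF.
  split.
  - rewrite vE AE; have := fb 0%N u isT un; have := fb 0%N (- u) isT nun; rewrite !derive1n0.
    by rewrite !ler_norml => /andP[? ?] /andP[? ?]; apply/andP; split; lra.
  - rewrite vE BE ?gt_eqF// normrM normrX normfV (gtr0_norm u0) exprVn ler_pdivrMr ?exprn_gt0//.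
    by rewrite normrM [`|2^-1|]gtr0_norm ?invr_gt0// ler_pdivrMr// (le_trans F1)//; nra.
  - rewrite derive1n1 derive1E (is_derive_val dA) normrM [`|u^-1 / 4|]gtr0_norm ?divr_gt0//.
    rewrite mulrAC ler_pdivrMr// ler_pdivrMl// (le_trans F2)//.
    by have := mulr_gt0 eta0 u0; nra.
  - rewrite derive1n1 derive1E (is_derive_val dB) normrM [`|_ / 4|]gtr0_norm ?divr_gt0 ?exprn_gt0//.
    rewrite mulrAC ler_pdivrMr// exprVn ler_pdivrMl ?exprn_gt0// (le_trans F3)//.
    by rewrite le_eqVlt; apply/orP; left; apply/eqP; ring.
have bnd v : v != 0 -> `|derive1n 1 A v| <= (2 * K + 4) * eta /\
    `|derive1n 1 B v| <= (2 * K + 4) * eta.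
  have ge0 : 0 <= (2 * K + 4) * eta by rewrite mulr_ge0 ?(ltW eta0)// addr_ge0 ?mulr_ge0.
  move=> v0; have [vn|vp|vz] := ltgtP v 0; last by rewrite vz eqxx in v0.
    by have [-> ->] := neg v vn; split; [exact: (alC v).2|exact: (beC v).2].
  have [v1|v1] := lerP v 1; last first.
    by have [|-> ->] := zero' v; [lra|rewrite normr0].
  have [_ _ H1 H2] := pos v vp v1; have := mulr_ge0 K0 (ltW eta0); split; nra.
split => // v; split.
- have [vn|vp] := lerP v 0; first by rewrite Aal//; exact: (alC v).1.
  have [v1|v1] := lerP v 1.
    by have [H _ _ _] := pos v vp v1; have := mulr_ge0 K0 (ltW eta0); nra.
  by have [|-> _] := zero v; [lra|rewrite normr0 mulr_ge0 ?(ltW eta0)// addr_ge0 ?mulr_ge0].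
- have [vn|vp] := lerP v 0; first by rewrite Bbe//; exact: (beC v).1.
  have [v1|v1] := lerP v 1.
    by have [_ H _ _] := pos v vp v1; have := mulr_ge0 K0 (ltW eta0); nra.
  by have [|_ ->] := zero v; [lra|rewrite normr0 mulr_ge0 ?(ltW eta0)// addr_ge0 ?mulr_ge0].
- apply: (@bound_at_limit (derive1n 1 A)) => [w|w w0]; last exact: (bnd w w0).1.
  exact: smooth_on_continuous sA I.
- apply: (@bound_at_limit (derive1n 1 B)) => [w|w w0]; last exact: (bnd w w0).2.
  exact: smooth_on_continuous sB I.
Unshelve. all: by end_near. Qed.

End CuspSplit.

(** * Extension from one cusp arc to the plane *)

Section CuspPiece.
Context {R : realType}.

Lemma vec2E0 (a b : R) : vec2 a b 0 0 = a.
Proof. by rewrite mxE. Qed.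

Lemma vec2E1 (a b : R) : vec2 a b 0 1 = b.
Proof. by rewrite mxE. Qed.

Lemma vec2_eta (q : 'rV[R]_2) : vec2 (q 0 0) (q 0 1) = q.
Proof.
by apply/rowP => i; rewrite mxE; case: ifP => [/eqP->//|/negbT i0]; congr (q _ _); apply/val_inj;
  case: i i0 => -[|[|]].
Qed.

Definition deltoid_map (q : 'rV[R]_2) : 'rV[R]_2 :=
  vec2 (2 * q 0 0 + q 0 0 ^+ 2 - q 0 1 ^+ 2) (2 * q 0 1 - 2 * q 0 0 * q 0 1).

(** The sup bound and the Lipschitz constant are carried together since the Lipschitz constant of a
    product involves both. *)
Definition bounded_lipschitz (V : normedModType R) (M : R) (f : V -> R) :=
  (forall x, `|f x| <= M) /\ forall x y, `|f x - f y| <= M * `|x - y|.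

Lemma bounded_lipschitzM (V : normedModType R) M N (f g : V -> R) : 0 <= M -> 0 <= N ->
  bounded_lipschitz M f -> bounded_lipschitz N g -> bounded_lipschitz (2 * M * N) (fun x => f x * g x).
Proof.
move=> M0 N0 [fM fL] [gN gL]; split=> [x|x y].
  rewrite normrM (le_trans (ler_pM _ _ (fM x) (gN x)))//.
  by have := mulr_ge0 M0 N0; lra.
have -> : f x * g x - f y * g y = f x * (g x - g y) + (f x - f y) * g y by ring.
rewrite (le_trans (ler_normD _ _))// !normrM.
have H1 := ler_pM (normr_ge0 _) (normr_ge0 _) (fM x) (gL x y).
have H2 := ler_pM (normr_ge0 _) (normr_ge0 _) (fL x y) (gN y).
have -> : 2 * M * N * `|x - y| = M * (N * `|x - y|) + M * `|x - y| * N by ring.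
exact: lerD.
Qed.

Lemma bounded_lipschitzD (V : normedModType R) M N (f g : V -> R) :
  bounded_lipschitz M f -> bounded_lipschitz N g -> bounded_lipschitz (M + N) (fun x => f x + g x).
Proof.
move=> [fM fL] [gN gL]; split=> [x|x y].
  by rewrite (le_trans (ler_normD _ _))// lerD.
have -> : f x + g x - (f y + g y) = (f x - f y) + (g x - g y) by ring.
by rewrite (le_trans (ler_normD _ _))// mulrDl lerD.
Qed.

Lemma bounded_lipschitz_coord n M (f : R -> R) (i : 'I_n) : 0 <= M ->
  bounded_lipschitz M f -> bounded_lipschitz M (fun x : 'rV[R]_n => f (x 0 i)).
Proof.
move=> M0 [fM fL]; split=> // x y; rewrite (le_trans (fL _ _))// ler_wpM2l//.
by have := coord_le_norm (x - y) i; rewrite !mxE.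
Qed.

Lemma bounded_lipschitz_compact_support (f : R -> R) (r : R) : smooth_on setT f ->
  (forall x, r <= `|x| -> f x = 0) -> exists2 M, 0 <= M & bounded_lipschitz M f.
Proof.
move=> sf f0.
have r0 : 0 <= `|r| + 1 by rewrite addr_ge0.
have [M0 M0ge M0P] := smooth_on_bounded 0 sf r0; have [M1 M1ge M1P] := smooth_on_bounded 1 sf r0.
have f0' x : `|r| + 1 < `|x| -> derive1n 1 f x = 0.
  move=> rx; have nx : \forall y \near x, `|r| + 1 < `|y|.
    by apply: (@open_nbhs_nbhs _ x [set y | `|r| + 1 < `|y|]); split => //; exact: open_norm_gt.
  rewrite derive1n1 -[RHS](@derive1_cst _ _ (0 : R) x) !derive1E; apply: near_eq_derive.
  by apply: filterS nx => y ry; rewrite f0//; have := ler_norm r; lra.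
exists (M0 + M1); first by rewrite addr_ge0.
have b0 x : `|f x| <= M0 + M1.
  have [xr|xr] := lerP `|x| (`|r| + 1); first by rewrite (le_trans (M0P x xr))// lerDl.
  by rewrite f0 ?normr0 ?addr_ge0//; have := ler_norm r; lra.
split => // x y; apply: (@derive_bound_lipschitz R f (derive1n 1 f)) => [z|z].
  exact: sf 0%N z I.
have [xr|xr] := lerP `|z| (`|r| + 1); first by rewrite (le_trans (M1P z xr))// lerDr.
by rewrite f0' ?normr0 ?addr_ge0.
Qed.

Lemma unit_circle_bound (c s : R) : c ^+ 2 + s ^+ 2 = 1 -> `|c| <= 1 /\ `|s| <= 1.
Proof.
move=> cs; have := sqr_ge0 c; have := sqr_ge0 s; move: cs; rewrite !ler_norml !expr2 => cs s2 c2.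
by split; apply/andP; split; nra.
Qed.

(* On the arc [- 2^-1 < c] of the unit circle the first coordinate of the deltoid map is
   [X = 2 * c ^+ 2 + 2 * c - 1], and [cusp_w X = 2 / (1 + c) = 1 + u ^+ 2], where
   [u = s / (1 + c)] is the tangent of the half angle. *)
Definition cusp_w (X : R) : R := 4 / (1 + Num.sqrt (3 + 2 * X)).

Lemma cusp_w_smooth : smooth_on [set X : R | - 6 / 5 < X] cusp_w.
Proof.
have oD : open [set X : R | - 6 / 5 < X] by exact: open_gt.
have oP : open [set X : R | 0 < X] by exact: open_gt.
have s1 : smooth_on [set X : R | - 6 / 5 < X] (fun X => 3 + 2 * X).
  apply: (smooth_onD oD (smooth_on_cst _ oD)).
  exact: (smooth_onM oD (smooth_on_cst _ oD) (smooth_on_id oD)).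
have s2 : smooth_on [set X : R | 0 < X] Num.sqrt.
  apply: (@smooth_on_coind R _ [set f | exists (c : R) k, f = fun x : R => c * (Num.sqrt x * x^-1 ^+ k)] oP).
    move=> _ [c [k ->]].
    exists (fun x => c * (2^-1 - k%:R) * (Num.sqrt x * x^-1 ^+ k.+1)); first by exists (c * (2^-1 - k%:R)), k.+1.
    move=> x x0.
    have d1 : is_derive x 1 (fun y : R => y^-1) (- x ^- 2).
      have := is_deriveV (lt0r_neq0 x0) (is_derive_id x (1 : R)); by rewrite [_ *: _]mulr1.
    have d2 := is_deriveZ c (is_deriveM (is_derive1_sqrt x0) (is_deriveX k d1)).
    apply: (@near_eq_is_derive _ _ _ _ _ _ _ _ _ (is_derive_eq d2 _)).
      by apply: (@nearW _ (nbhs x)) => y; rewrite !fctE.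
    rewrite [X in _ *: (_ + X *: _)](_ : _ = x^-1 ^+ k); last by rewrite !fctE.
    rewrite /GRing.scale/= -[x ^- 2]exprVn invfM.
    have -> : (Num.sqrt x)^-1 = Num.sqrt x * x^-1.
      rewrite -{3}(sqr_sqrtr (ltW x0)) expr2; field.
      by rewrite gt_eqF// sqrtr_gt0.
    by case: k {d2} => [|k] /=; rewrite -?[k.+1%:R]natr1 !exprS ?expr0; ring.
  by exists 1, 0%N; apply/funext => x; rewrite expr0 mulr1 mul1r.
apply: (smooth_onM oD (smooth_on_cst _ oD)); apply: (smooth_onV oD).
  apply: (smooth_onD oD (smooth_on_cst _ oD)).
  by apply: (smooth_on_comp oD s2 s1) => X /= X1; lra.
by move=> X _; rewrite gt_eqF// ltr_pwDl// sqrtr_ge0.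
Qed.

(** The threshold -6/5 lies strictly between -3/2, where the square root degenerates, and -1, below
    which the profiles vanish; 16/7 is 4 / (1 + 3/4). *)
Lemma cusp_w_bounds (X : R) : - 6 / 5 < X -> 3 / 4 <= Num.sqrt (3 + 2 * X) /\ 0 < cusp_w X <= 16 / 7.
Proof.
move=> X1; have r34 : 3 / 4 <= Num.sqrt (3 + 2 * X).
  by rewrite -[leLHS]ger0_norm// -sqrtr_sqr ler_wsqrtr// expr2; lra.
split=> //; rewrite /cusp_w divr_gt0 ?ltr_pwDl ?sqrtr_ge0//=.
by rewrite ler_pdivrMr ?ltr_pwDl ?sqrtr_ge0//; lra.
Qed.

Lemma is_derive_cusp_w (X : R) : - 6 / 5 < X -> exists2 dw, is_derive X 1 cusp_w dw & `|dw| <= 2.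
Proof.
move=> X1; have [r34 /andP[w0 w1]] := cusp_w_bounds X1.
have p0 : 0 < 3 + 2 * X by lra.
have d0 : is_derive X 1 (fun X : R => 3 + 2 * X) 2.
  have := is_deriveD (is_derive_cst (3 : R) X 1) (is_derive_monomial 2 1 X).
  rewrite add0r !mulr1; congr is_derive; apply/funext => y; rewrite !fctE expr1//.
have d1 : is_derive X 1 (fun X => Num.sqrt (3 + 2 * X)) (2 * (2 * Num.sqrt (3 + 2 * X))^-1).
  exact: (@is_derive1_compR R Num.sqrt (fun X => 3 + 2 * X) X _ _ (is_derive1_sqrt p0) d0).
have d2 : is_derive X 1 (fun X => 1 + Num.sqrt (3 + 2 * X)) (0 + 2 * (2 * Num.sqrt (3 + 2 * X))^-1).
  exact: (is_deriveD (is_derive_cst (1 : R) X 1) d1).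
have n0 : 1 + Num.sqrt (3 + 2 * X) != 0 by rewrite gt_eqF// ltr_pwDl// sqrtr_ge0.
have d3 := is_deriveZ 4 (@is_deriveV R (fun X => 1 + Num.sqrt (3 + 2 * X)) X _ 1 n0 d2).
exists (- (4 / (Num.sqrt (3 + 2 * X) * (1 + Num.sqrt (3 + 2 * X)) ^+ 2))).
  apply: (is_derive_eq d3); rewrite /GRing.scale/=; field.
  by rewrite n0 gt_eqF// sqrtr_gt0.
rewrite normrN; move: r34; set r := Num.sqrt _ => r34.
have r2 : 0 < r * (1 + r) ^+ 2 by rewrite mulr_gt0 ?exprn_gt0//; lra.
rewrite ger0_norm ?divr_ge0 ?(ltW r2)// ler_pdivrMr// expr2; nra.
Qed.

Section Profile.
Variables (h : R -> R) (M : R).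
Hypotheses (sh : smooth_on setT h) (hb : forall w, w <= 16 / 7 -> 0 < w -> `|h w| <= M /\ `|derive1n 1 h w| <= M).
Hypotheses (h0 : forall w, 8 / 5 <= w -> h w = 0) (M0 : 0 <= M).

(** For -6/5 < X <= -1 one has [cusp_w X] >= 2 > 8/5, so h vanishes there and the two branches glue
    smoothly. The number 8/5 is 1 + 3/5, the edge u^2 = 3/5 in terms of w = 1 + u^2. *)
Definition cusp_profile (X : R) : R := if - 6 / 5 < X then h (cusp_w X) else 0.

Lemma cusp_profile0 X : X <= -1 -> cusp_profile X = 0.
Proof.
move=> X1; rewrite /cusp_profile; case: ifP => // X2; rewrite h0//.
have [r34 _] := cusp_w_bounds X2.
have : Num.sqrt (3 + 2 * X) <= 1 by rewrite -[leRHS]sqrtr1 ler_wsqrtr//; lra.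
rewrite /cusp_w ler_pdivlMr; last by lra.
lra.
Qed.

Lemma cusp_profile_smooth : smooth_on setT cusp_profile.
Proof.
have oD : open [set X : R | - 6 / 5 < X] by exact: open_gt.
have oD' : open [set X : R | X < -1] by exact: open_lt.
have -> : setT = [set X : R | - 6 / 5 < X] `|` [set X : R | X < -1].
  by apply/seteqP; split=> X //= _; have [X1|X1] := ltrP (- 6 / 5) X; [left|right; lra].
apply: smooth_onU.
  apply: (smooth_on_eq oD) (smooth_on_comp oD sh cusp_w_smooth (fun _ _ => I)) => X /= X1.
  by rewrite /cusp_profile X1.
by apply: (smooth_on_eq oD') (smooth_on_cst 0 oD') => X /= /ltW/cusp_profile0.
Qed.

Lemma cusp_profile_bound : bounded_lipschitz (2 * M) cusp_profile.
Proof.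
split=> [X|].
  rewrite /cusp_profile; case: ifP => [X1|_]; last by rewrite normr0 mulr_ge0.
  have [_ /andP[w0 w1]] := cusp_w_bounds X1.
  by have [H _] := hb w1 w0; rewrite (le_trans H)//; move: M0; lra.
apply: (@derive_bound_lipschitz R _ (derive1n 1 cusp_profile)) => X.
  exact: cusp_profile_smooth 0%N X I.
have [X1|X1] := ltrP (- 6 / 5) X.
  have [dw dwP dwB] := is_derive_cusp_w X1.
  have [_ /andP[w0 w1]] := cusp_w_bounds X1.
  have [_ H] := hb w1 w0.
  have dh := is_derive1_compR (sh 0%N I) dwP.
  rewrite derive1n1 derive1E.
  have nx : \forall y \near X, (h \o cusp_w) y = cusp_profile y.
    have : \forall y \near X, - 6 / 5 < y.
      by apply: (@open_nbhs_nbhs _ X [set y | - 6 / 5 < y]); split => //; exact: open_gt.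
    by apply: filterS => y y1; rewrite /cusp_profile y1.
  rewrite (is_derive_val (near_eq_is_derive nx dh)) normrM.
  by apply: ler_pM.
have nx : \forall y \near X, cusp_profile y = 0.
  have : \forall y \near X, y < -1.
    by apply: (@open_nbhs_nbhs _ X [set y | y < -1]); split => /=; [exact: open_lt|lra].
  by apply: filterS => y /ltW/cusp_profile0.
rewrite derive1n1 derive1E (near_eq_derive _ nx) -derive1E derive1_cst normr0.
exact: mulr_ge0.
Qed.

End Profile.

(* A function of [u] with zero derivative at the cusp [u = 0] is [A (u ^+ 2) + u ^+ 3 * B (u ^+ 2)], and
   both [u ^+ 2] and [u ^+ 3] are restrictions of smooth functions of the point of the plane. *)
Lemma cusp_piece : exists2 C : R, 0 <= C & forall (f : R -> R) (eta : R), 0 < eta ->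
    smooth_on setT f -> derive1n 1 f 0 = 0 ->
    (forall k u, (k <= 5)%N -> `|u| <= 1 -> `|derive1n k f u| <= eta) ->
    (forall u, 3 / 5 <= u ^+ 2 -> f u = 0) ->
  exists W : 'rV[R]_2 -> R, [/\ smooth W,
    forall q : 'rV[R]_2, q 0 0 ^+ 2 + q 0 1 ^+ 2 = 1 ->
      W (deltoid_map q) = if 0 < q 0 0 then f (q 0 1 / (1 + q 0 0)) else 0 &
    bounded_lipschitz (C * eta) W].
Proof.
have [C C0 CP] := @cusp_split R.
(* On the deltoid the second coordinate satisfies |Y| <= 4, where this cutoff is 1. *)
pose th (Y : R) := plateau (4^-1 * Y).
have sth : smooth_on setT th.
  apply: (smooth_on_comp openT (@plateau_smooth R) _ (fun _ _ => I)).
  exact: (smooth_onM openT (smooth_on_cst _ openT) (smooth_on_id openT)).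
have sYth : smooth_on setT (fun Y => Y * th Y) := smooth_onM openT (smooth_on_id openT) sth.
have th0 Y : 8 <= `|Y| -> th Y = 0.
  by move=> Y8; rewrite /th plateau0// normrM ger0_norm ?invr_ge0//; lra.
have th1 Y : `|Y| <= 4 -> th Y = 1.
  by move=> Y4; rewrite /th plateau1// normrM ger0_norm ?invr_ge0//; lra.
have [M1 M1ge M1P] := bounded_lipschitz_compact_support sth th0.
have [|M2 M2ge M2P] := @bounded_lipschitz_compact_support (fun Y => Y * th Y) 8 sYth.
  by move=> Y Y8; rewrite th0 ?mulr0.
exists (2 * M1 * (2 * C) + 2 * M2 * (2 * (2 * C))).
  by rewrite addr_ge0// !mulr_ge0.
move=> f eta eta0 sf f1 fb f0.
have [A [B [sA sB fAB AB0 ABb]]] := CP f eta eta0 sf f1 fb f0.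
have Ce : 0 <= C * eta by rewrite mulr_ge0// ltW.
(* On the arc u^2 = w - 1, and with Y = 2 s (1 - c) the cube is u^3 = Y w^2 / 8: hence the factor
   w^2 / 8 in [hB], while Y is multiplied in separately. *)
pose hA (w : R) := A (w - 1); pose hB (w : R) := 8^-1 * (w ^+ 2 * B (w - 1)).
have s1 : smooth_on setT (fun w : R => w - 1).
  exact: (smooth_onB openT (smooth_on_id openT) (smooth_on_cst _ openT)).
have shA : smooth_on setT hA := smooth_on_comp openT sA s1 (fun _ _ => I).
have sBs : smooth_on setT (fun w => B (w - 1)) := smooth_on_comp openT sB s1 (fun _ _ => I).
have shB : smooth_on setT hB.
  apply: (smooth_onM openT (smooth_on_cst _ openT)).
  exact: (smooth_onM openT (smooth_onX 2 openT (smooth_on_id openT)) sBs).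
have dsub (w : R) : is_derive w 1 (fun w : R => w - 1) (1 - 0).
  exact: (is_deriveB (is_derive_id w (1 : R)) (is_derive_cst (1 : R) w 1)).
have hAb w : w <= 16 / 7 -> 0 < w -> `|hA w| <= C * eta /\ `|derive1n 1 hA w| <= C * eta.
  move=> _ _; have [H1 _ H2 _] := ABb (w - 1); split => //.
  have dA := @is_derive1_compR R A (fun w => w - 1) w _ _ (sA 0%N (w - 1) I) (dsub w).
  by rewrite (derive1n1 hA) derive1E (is_derive_val dA) subr0 mul1r.
have hBb w : w <= 16 / 7 -> 0 < w -> `|hB w| <= 2 * (C * eta) /\ `|derive1n 1 hB w| <= 2 * (C * eta).
  move=> w1 w0; have [_ H1 _ H2] := ABb (w - 1); split.
    rewrite /hB normrM [`|w ^+ 2 * _|]normrM [`|8^-1|]ger0_norm ?invr_ge0// [`|w ^+ 2|]ger0_norm ?sqr_ge0//.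
    have : w ^+ 2 <= 6 by rewrite expr2; nra.
    have := sqr_ge0 w; have := normr_ge0 (B (w - 1)); nra.
  have d1 := @is_derive1_compR R B (fun w => w - 1) w _ _ (sB 0%N (w - 1) I) (dsub w).
  have d2 := is_deriveZ 8^-1 (is_deriveM (is_deriveX 2 (is_derive_id w (1 : R))) d1).
  have nx : \forall y \near w, (8^-1 \*: ((id ^+ 2) * (B \o (fun w => w - 1)))) y = hB y.
    by apply: (@nearW _ (nbhs w)) => y; rewrite !fctE.
  rewrite derive1n1 derive1E (is_derive_val (near_eq_is_derive nx d2)).
  rewrite [X in _ *: (X *: _ + _)](_ : _ = w ^+ 2); last by rewrite !fctE.
  rewrite /GRing.scale/= subr0 mul1r mulr1 expr1 normrM ger0_norm ?invr_ge0//.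
  rewrite ler_pdivrMl//; apply: (le_trans (ler_normD _ _)).
  rewrite [`|w ^+ 2 * _|]normrM [`|B _ * _|]normrM [`|2 * w|]normrM [`|w ^+ 2|]ger0_norm ?sqr_ge0// [`|w|]gtr0_norm// [`|2|]ger0_norm//.
  have : w ^+ 2 <= 6 by rewrite expr2; nra.
  move: H1 H2; rewrite derive1n1; have := sqr_ge0 w.
  have := normr_ge0 (B (w - 1)); have := normr_ge0 (derive1 B (w - 1)).
  move: (w ^+ 2) `|B (w - 1)| `|derive1 B (w - 1)| (C * eta) => w2 b b' c *; nra.
have hA0 w : 8 / 5 <= w -> hA w = 0 by move=> w8; rewrite /hA (AB0 _ _).1//; lra.
have hB0 w : 8 / 5 <= w -> hB w = 0 by move=> w8; rewrite /hB (AB0 _ _).2 ?mulr0//; lra.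
exists (fun x => th (x 0 1) * cusp_profile hA (x 0 0) + (x 0 1 * th (x 0 1)) * cusp_profile hB (x 0 0)).
have Ce2 : 0 <= 2 * (C * eta) by rewrite mulr_ge0.
split.
- have spA := cusp_profile_smooth shA hA0; have spB := cusp_profile_smooth shB hB0.
  have smc (g : R -> R) (i : 'I_2) : smooth_on setT g -> smooth (fun x : 'rV[R]_2 => g (x 0 i)).
    by move=> sg; exact: (smooth_compR sg (@smooth_coord R 2 i) (fun _ => I)).
  apply: (@smoothD R 2 (fun x => _) (fun x => _)); apply: (@smoothM R 2 (fun x => _) (fun x => _)).
  + exact: smc sth.
  + exact: smc spA.
  + exact: (smc _ 1 sYth).
  + exact: smc spB.
- move=> q; rewrite /deltoid_map vec2E0 vec2E1; move: (q 0 0) (q 0 1) => c s cs.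
  have sE : s ^+ 2 = (1 - c) * (1 + c) by rewrite -[s ^+ 2](addKr (c ^+ 2)) cs; ring.
  have [c1 s1'] := unit_circle_bound cs.
  rewrite th1 ?mulr1 ?mul1r; last first.
    move: c1 s1'; rewrite !ler_norml => /andP[? ?] /andP[? ?]; apply/andP; split; nra.
  have -> : 2 * c + c ^+ 2 - s ^+ 2 = 2 * c ^+ 2 + 2 * c - 1 by rewrite sE; ring.
  (* For c <= 0 one has X = 2 c (1 + c) - 1 <= -1, so the piece vanishes on the rest of the
     deltoid. *)
  case: ltrP => c0; last first.
    move: c1; rewrite ler_norml => /andP[c1 c2].
    by rewrite !cusp_profile0 ?mulr0 ?addr0//; rewrite expr2; nra.
  have X1 : - 6 / 5 < 2 * c ^+ 2 + 2 * c - 1 by rewrite expr2; nra.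
  rewrite /cusp_profile X1.
  have rE : Num.sqrt (3 + 2 * (2 * c ^+ 2 + 2 * c - 1)) = 2 * c + 1.
    have -> : 3 + 2 * (2 * c ^+ 2 + 2 * c - 1) = (2 * c + 1) ^+ 2 by ring.
    by rewrite sqrtr_sqr gtr0_norm//; lra.
  have wE : cusp_w (2 * c ^+ 2 + 2 * c - 1) = 2 / (1 + c).
    by rewrite /cusp_w rE; field; apply/andP; split; lra.
  rewrite wE /hA /hB fAB.
  have c1n : 1 + c != 0 by rewrite gt_eqF//; lra.
  have uE : (s / (1 + c)) ^+ 2 = 2 / (1 + c) - 1.
    by rewrite exprMn sE; field.
  rewrite uE; congr (_ + _).
  have -> : (s / (1 + c)) ^+ 3 = (s / (1 + c)) ^+ 2 * (s / (1 + c)) by rewrite exprSr.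
  by rewrite uE; field.
- have -> : (2 * M1 * (2 * C) + 2 * M2 * (2 * (2 * C))) * eta =
    2 * M1 * (2 * (C * eta)) + 2 * M2 * (2 * (2 * (C * eta))) by ring.
  have bA := cusp_profile_bound shA hAb hA0 Ce; have bB := cusp_profile_bound shB hBb hB0 Ce2.
  have Ce4 : 0 <= 2 * (2 * (C * eta)) by rewrite mulr_ge0.
  apply: bounded_lipschitzD; apply: bounded_lipschitzM => //.
  + exact: (bounded_lipschitz_coord _ M1ge M1P).
  + exact: (bounded_lipschitz_coord _ Ce2 bA).
  + exact: (@bounded_lipschitz_coord 2 M2 (fun Y => Y * th Y) 1 M2ge M2P).
  + exact: (bounded_lipschitz_coord _ Ce4 bB).
Qed.

End CuspPiece.

(** * Extension from the deltoid to the plane *)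

Section DeltoidExtension.
Context {R : realType}.

Lemma iter_partial0 n (s : seq 'I_n) : iter_partial s (fun _ : 'rV[R]_n => 0) = (fun=> 0).
Proof.
by elim: s => //= i s ->; apply/funext => x; rewrite /partial derive_cst.
Qed.

(** Compactness of the box makes the locally uniform convergence uniform on it. *)
Lemma cont_cvg_small n (F : option nat -> 'rV[R]_n -> R) (r eta : R) :
    cont_cvg F -> F None = (fun=> 0) -> 0 < eta ->
  \forall m \near \oo, forall y : 'rV[R]_n, (forall i, `|y 0 i| <= r) -> `|F (Some m) y| <= eta.
Proof.
move=> cF F0 eta0.
have cK : compact [set y : 'rV[R]_n | forall i, [set t | `|t| <= r] (y ord0 i)].
  apply: (@rV_compact _ n (fun=> [set t | `|t| <= r])) => _.
  rewrite (_ : [set t | _] = `[- r, r]%classic); first exact: segment_compact.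
  by apply/seteqP; split=> t /=; rewrite in_itv/= ler_norml.
have := (compact_near_coveringP _).1 cK nat \oo (fun m y => `|F (Some m) y| <= eta) _.
apply=> y _; have := cF y; rewrite F0 => /cvgrPdist_le/(_ eta eta0).
move=> [[U V] /= [Um Vy] UV]; exists (V, U) => //= -[z m] /= [Vz Um'].
by have := UV (m, z) (conj Um' Vz); rewrite /= sub0r normrN.
Qed.

Lemma smooth_family_small_jet n (F : option nat -> 'rV[R]_n -> R) (r eta : R) N :
    smooth_family F -> F None = (fun=> 0) -> 0 < eta ->
  \forall m \near \oo, forall s, (size s <= N)%N ->
    forall y : 'rV[R]_n, (forall i, `|y 0 i| <= r) -> `|iter_partial s (F (Some m)) y| <= eta.
Proof.
elim: N F => [|N IH] F sF F0 eta0.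
  have := @cont_cvg_small n _ r eta (sF.2 [::]) F0 eta0.
  by apply: filterS => m H [].
have H0 := @cont_cvg_small n _ r eta (sF.2 [::]) F0 eta0.
have H1 : \forall m \near \oo, forall i : 'I_n, forall s, (size s <= N)%N ->
    forall y : 'rV[R]_n, (forall i, `|y 0 i| <= r) -> `|iter_partial (rcons s i) (F (Some m)) y| <= eta.
  apply: filter_forall => i.
  have Fi0 : partial i (F None) = (fun=> 0) by rewrite F0; exact: (iter_partial0 [:: i]).
  have := IH _ (smooth_family_partial i sF) Fi0 eta0.
  by apply: filterS => m H s sN y yr; have := H s sN y yr; rewrite /iter_partial foldr_rcons.
near=> m => s; case/lastP: s => [|s i] sN y yr.
  by have H := near H0 m; apply: H.
by have H := near H1 m; apply: H => //; move: sN; rewrite size_rcons.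
Unshelve. all: by end_near. Qed.

(** Families live on row vectors and the cusp lemmas on the real line; this is the passage between
    the two. *)
Lemma smooth_line (f : 'rV[R]_1 -> R) : smooth f ->
  smooth_on setT (fun u => f (const_mx u)) /\
  forall k u, derive1n k (fun u => f (const_mx u)) u = iter_partial (nseq k 0) f (const_mx u).
Proof.
move=> sf.
have cE (u : R) : 0 + u *: delta_mx 0 0 = const_mx u :> 'rV[R]_1.
  by apply/rowP => i; rewrite !mxE !(ord1 i) /= add0r mulr1.
have jf : jet setT (fun k u => iter_partial (nseq k (0 : 'I_1)) f (const_mx u)).
  move=> k u _; have H : is_derive (0 + u *: delta_mx 0 0 : 'rV[R]_1) (delta_mx 0 0)
    (iter_partial (nseq k 0) f) (iter_partial (nseq k.+1 0) f (0 + u *: delta_mx 0 0)).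
    by have [_ df] := sf (nseq k 0); exact/derivableP.
  move/is_derive_lineP: H; rewrite cE; congr is_derive.
  by apply/funext => t; rewrite cE.
have [p1 p2] := @jet_smooth_on R setT _ (fun u => f (const_mx u)) openT jf (fun _ _ => erefl).
by split=> // k u; exact: (p2 k u I).
Qed.

Definition rot (c s : R) (q : 'rV[R]_2) : 'rV[R]_2 :=
  vec2 (c * q 0 0 - s * q 0 1) (s * q 0 0 + c * q 0 1).

Lemma smooth_map_vec2 n (f g : option nat -> 'rV[R]_n -> R) : smooth_family f -> smooth_family g ->
  smooth_map_family (fun j x => vec2 (f j x) (g j x)).
Proof.
move=> sf sg k; have [->|k1] : k = 0 \/ k = 1.
  by case: k => -[|[|//]] H; [left|right]; exact/val_inj.
  by under eq_fun do under eq_fun do rewrite vec2E0.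
by rewrite k1; under eq_fun do under eq_fun do rewrite vec2E1.
Qed.

(** Rational parametrization by the tangent of the half angle. It misses (-1, 0), where the weight
    of the cusp at (1, 0) vanishes. *)
Definition circle_param (u : R) : 'rV[R]_2 := vec2 ((1 - u ^+ 2) / (1 + u ^+ 2)) (2 * u / (1 + u ^+ 2)).

Lemma circle_param_circle u : circle_param u 0 0 ^+ 2 + circle_param u 0 1 ^+ 2 = 1.
Proof.
rewrite vec2E0 vec2E1; have u0 : 1 + u ^+ 2 != 0 by rewrite gt_eqF// ltr_pwDl// sqr_ge0.
by field.
Qed.

Lemma circle_paramK (q : 'rV[R]_2) : q 0 0 ^+ 2 + q 0 1 ^+ 2 = 1 -> 0 < q 0 0 ->
  circle_param (q 0 1 / (1 + q 0 0)) = q.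
Proof.
move=> cs c0; rewrite -[RHS]vec2_eta /circle_param.
move: (q 0 0) (q 0 1) cs c0 => c s cs c0.
have c1 : 1 + c != 0 by rewrite gt_eqF//; lra.
have E : 1 + (s / (1 + c)) ^+ 2 = 2 / (1 + c).
  have -> : (s / (1 + c)) ^+ 2 = (1 - c) / (1 + c).
    have -> : (s / (1 + c)) ^+ 2 = s ^+ 2 / (1 + c) ^+ 2 by rewrite expr_div_n.
    by rewrite -[s ^+ 2](addKr (c ^+ 2)) cs; field.
  by field.
rewrite E; congr vec2.
  have -> : 1 - (s / (1 + c)) ^+ 2 = 2 - (1 + (s / (1 + c)) ^+ 2) by ring.
  by rewrite E; field.
by field.
Qed.

Lemma smooth_circle_denominator : smooth_on setT (fun u : R => (1 + u ^+ 2)^-1).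
Proof.
apply: (smooth_onV openT).
  exact: (smooth_onD openT (smooth_on_cst _ openT) (smooth_onX 2 openT (smooth_on_id openT))).
by move=> u _; rewrite gt_eqF// ltr_pwDl// sqr_ge0.
Qed.

Lemma smooth_circle0 : smooth_on setT (fun u => circle_param u 0 0).
Proof.
under eq_fun do rewrite vec2E0.
apply: (smooth_onM openT _ smooth_circle_denominator).
exact: (smooth_onB openT (smooth_on_cst _ openT) (smooth_onX 2 openT (smooth_on_id openT))).
Qed.

Lemma smooth_circle1 : smooth_on setT (fun u => circle_param u 0 1).
Proof.
under eq_fun do rewrite vec2E1.
apply: (smooth_onM openT _ smooth_circle_denominator).
exact: (smooth_onM openT (smooth_on_cst _ openT) (smooth_on_id openT)).
Qed.

Definition half_sqrt3 : R := Num.sqrt 3 / 2.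

Lemma half_sqrt3_sqr : half_sqrt3 ^+ 2 = 3 / 4.
Proof. by rewrite /half_sqrt3 expr_div_n sqr_sqrtr//; field. Qed.

Definition flat_bump (x : R) : R := exp_flat 0 (x - 4^-1).

Definition flat_bump_sum (q : 'rV[R]_2) : R :=
  flat_bump (q 0 0) + flat_bump (- 2^-1 * q 0 0 + half_sqrt3 * q 0 1) + flat_bump (- 2^-1 * q 0 0 - half_sqrt3 * q 0 1).

Lemma flat_bump_smooth : smooth_on setT flat_bump.
Proof.
apply: (smooth_on_comp openT (exp_flat_smooth 0) _ (fun _ _ => I)).
exact: (smooth_onB openT (smooth_on_id openT) (smooth_on_cst _ openT)).
Qed.

(* The first coordinates of the three rotations of a point of the circle have sum 0 and
   sum of squares 3/2, so they cannot all be at most 1/4. *)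
Lemma flat_bump_sum_gt0 (q : 'rV[R]_2) : q 0 0 ^+ 2 + q 0 1 ^+ 2 = 1 -> 0 < flat_bump_sum q.
Proof.
rewrite /flat_bump_sum; move: (q 0 0) (q 0 1) => c s cs; have := half_sqrt3_sqr; move: half_sqrt3 => h hh.
have pg0 x : 0 <= flat_bump x := exp_flat_ge0 _.
have pgt x : 4^-1 < x -> 0 < flat_bump x by move=> x4; apply: exp_flat_gt0; lra.
have [c4|c4] := ltrP 4^-1 c; first by rewrite -addrA ltr_pwDl ?pgt// addr_ge0.
have [c5|c5] := ltrP 4^-1 (- 2^-1 * c + h * s); first by rewrite ltr_pwDl// ltr_wpDl// pgt.
have [c6|c6] := ltrP 4^-1 (- 2^-1 * c - h * s); first by rewrite ltr_wpDl ?addr_ge0// pgt.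
exfalso; move: hh cs; rewrite !expr2 => hh cs.
have E : (h * s) * (h * s) = 3 / 4 * (s * s) by rewrite -hh; ring.
move: (h * s) E c5 c6 => t E c5 c6; nra.
Qed.

(** Its rotations by the cube roots of unity form a partition of unity on the circle, each piece
    living near a single cusp; the function to be extended is split accordingly. *)
Definition cusp_weight (q : 'rV[R]_2) : R := flat_bump (q 0 0) / flat_bump_sum q.

Lemma smooth_cusp_weight : smooth_on setT (cusp_weight \o circle_param).
Proof.
have s0 := smooth_circle0; have s1 := smooth_circle1.
have sp f : smooth_on setT f -> smooth_on setT (flat_bump \o f).
  by move=> sf; exact: (smooth_on_comp openT flat_bump_smooth sf (fun _ _ => I)).
have sm a f : smooth_on setT f -> smooth_on setT (fun u => a * f u : R).
  by move=> sf; exact: (smooth_onM openT (smooth_on_cst _ openT) sf).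
apply: (smooth_onM openT (sp _ s0)); apply: (smooth_onV openT).
  apply: (smooth_onD openT).
    exact: (smooth_onD openT (sp _ s0) (sp _ (smooth_onD openT (sm _ _ s0) (sm _ _ s1)))).
  exact: (sp _ (smooth_onB openT (sm _ _ s0) (sm _ _ s1))).
by move=> u _; rewrite gt_eqF// flat_bump_sum_gt0// circle_param_circle.
Qed.

(** Evenness makes the weight stationary at the cusp, so that multiplication by it keeps a zero
    derivative there. *)
Lemma cusp_weight_even u : cusp_weight (circle_param (- u)) = cusp_weight (circle_param u).
Proof.
have E0 : circle_param (- u) 0 0 = circle_param u 0 0 by rewrite !vec2E0 sqrrN.
have E1 : circle_param (- u) 0 1 = - circle_param u 0 1 by rewrite !vec2E1 sqrrN mulrN mulNr.
by rewrite /cusp_weight /flat_bump_sum E0 E1 mulrN opprK addrAC.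
Qed.

Lemma is_derive_even (f : R -> R) df : (forall u, f (- u) = f u) -> is_derive (0 : R) 1 f df -> df = 0.
Proof.
move=> fe d0.
have dN : is_derive (0 : R) 1 (fun u : R => - u) (-1) by exact: (is_deriveN (is_derive_id (0 : R) (1 : R))).
have d0' : is_derive (- 0 : R) 1 f df by rewrite oppr0.
have := is_derive_val (@is_derive1_compR R f (fun u => - u) 0 _ _ d0' dN).
have -> : f \o (fun u => - u) = f by apply/funext => u; rewrite /= fe.
by rewrite (is_derive_val d0) mulN1r; lra.
Qed.

Lemma cusp_weight0 (q : 'rV[R]_2) : q 0 0 <= 4^-1 -> cusp_weight q = 0.
Proof.
by move=> q4; rewrite /cusp_weight /flat_bump exp_flat_le0 ?mul0r//; lra.
Qed.

(** The factor 2 is the rate of the angle with respect to its half-angle tangent at 0; the rest is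
    the derivative along the circle at (c, s). *)
Lemma is_derive_circle_rot (c s : R) (om : 'rV[R]_2 -> R) : smooth om ->
  is_derive (0 : R) 1 (fun u => om (rot c s (circle_param u)))
    (2 * (- s * partial 0 om (vec2 c s) + c * partial 1 om (vec2 c s))).
Proof.
move=> so.
have dq : is_derive (0 : R) 1 (fun u : R => 1 + u ^+ 2) 0.
  have := is_deriveD (is_derive_cst (1 : R) (0 : R) (1 : R)) (is_derive_monomial 1 2 (0 : R)).
  rewrite expr1 !mulr0 addr0; congr is_derive.
  by apply/funext => u; rewrite !fctE mul1r.
have n0 : 1 + (0 : R) ^+ 2 != 0 by rewrite expr0n addr0 oner_eq0.
have dv : is_derive (0 : R) 1 (fun u : R => (1 + u ^+ 2)^-1) 0.
  by apply: (is_derive_eq (@is_deriveV R (fun u => 1 + u ^+ 2) 0 _ 1 n0 dq)); rewrite scaler0.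
have dn : is_derive (0 : R) 1 (fun u : R => 1 - u ^+ 2) 0.
  have := is_deriveD (is_derive_cst (1 : R) (0 : R) (1 : R)) (is_derive_monomial (-1) 2 (0 : R)).
  rewrite expr1 !mulr0 addr0; congr is_derive.
  by apply/funext => u; rewrite !fctE mulN1r.
have dm : is_derive (0 : R) 1 (fun u : R => 2 * u) 2.
  have := is_derive_monomial 2 1 (0 : R); rewrite expr0 !mulr1; congr is_derive.
have d0 : is_derive (0 : R) 1 (fun u => circle_param u 0 0) 0.
  under eq_fun do rewrite vec2E0.
  by apply: (is_derive_eq (is_deriveM dn dv)); rewrite !scaler0 addr0.
have d1 : is_derive (0 : R) 1 (fun u => circle_param u 0 1) 2.
  under eq_fun do rewrite vec2E1.
  apply: (is_derive_eq (is_deriveM dm dv)).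
  by rewrite scaler0 add0r expr0n addr0 invr1 scale1r.
pose g (v : 'rV[R]_1) := rot c s (circle_param (v 0 0)).
have cE (u : R) : 0 + u *: delta_mx 0 0 = const_mx u :> 'rV[R]_1.
  by apply/rowP => i; rewrite !mxE !(ord1 i) /= add0r mulr1.
have gd k : is_derive (0 + 0 *: delta_mx 0 0 : 'rV[R]_1) (delta_mx 0 0) (fun v => g v 0 k)
    (2 * (if k == 0 then - s else c)).
  apply/is_derive_lineP.
  have -> : (fun t : R => g (0 + t *: delta_mx 0 0) 0 k) =
      (fun t => (if k == 0 then c else s) * circle_param t 0 0 +
        (if k == 0 then - s else c) * circle_param t 0 1).
    by apply/funext => t; rewrite cE /g mxE [const_mx _ _ _]mxE; case: ifP => _ //; rewrite mulNr.
  have := is_deriveD (is_deriveZ (if k == 0 then c else s) d0) (is_deriveZ (if k == 0 then - s else c) d1).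
  by move=> H; apply: (is_derive_eq H); rewrite scaler0 add0r mulrC.
have p0 : 0 + 0 *: delta_mx 0 0 = 0 :> 'rV[R]_1 by rewrite scale0r addr0.
have g0 : g (0 + 0 *: delta_mx 0 0) = vec2 c s.
  rewrite /g p0 mxE /rot vec2E0 vec2E1 expr0n subr0 addr0 divr1 mulr0 mul0r !mulr0 subr0 addr0.
  by rewrite !mulr1.
have := @derive_comp_rV R 1 2 om g _ _ _ (smooth_derivable so)
  (fun k => smooth_continuous (smooth_partial k so)) gd.
rewrite g0 => /is_derive_lineP; rewrite big_ord_recl big_ord1 /=.
have -> : lift ord0 ord0 = 1 :> 'I_2 by exact/val_inj.

move=> H; apply: (@is_derive_eq R R R _ 0 1 _ _ _ _).
  move: H; congr is_derive; apply/funext => t.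
  by rewrite cE /g [const_mx _ _ _]mxE.
rewrite (_ : ord0 = 0)//; ring.
Qed.

Lemma smooth_cusp_piece (c s : R) (om : option nat -> 'rV[R]_2 -> R) : smooth_family om ->
  smooth_family (fun j (v : 'rV[R]_1) =>
    cusp_weight (circle_param (v 0 0)) * om j (rot c s (circle_param (v 0 0)))).
Proof.
move=> so.
have scp : smooth_map_family (fun _ (v : 'rV[R]_1) => circle_param (v 0 0)).
  move=> k; have [->|->] : k = 0 \/ k = 1 by case: k => -[|[|//]] H; [left|right]; exact/val_inj.
    by apply: smooth_family_single; exact: (smooth_compR smooth_circle0 (@smooth_coord R 1 0) (fun _ => I)).
  by apply: smooth_family_single; exact: (smooth_compR smooth_circle1 (@smooth_coord R 1 0) (fun _ => I)).
have sr : smooth_map_family (fun _ (v : 'rV[R]_1) => rot c s (circle_param (v 0 0))).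
  have sM a k : smooth_family (fun _ (v : 'rV[R]_1) => a * circle_param (v 0 0) 0 k : R).
    apply: (@smooth_familyM _ _ (fun _ _ => a) (fun j x => _)); last exact: scp.
    exact: smooth_family_cst.
  apply: (@smooth_map_vec2 1 (fun _ v => _) (fun _ v => _)).
    exact: (smooth_familyB (sM c 0) (sM s 1)).
  exact: (smooth_familyD (sM s 0) (sM c 1)).
apply: (@smooth_familyM _ _ (fun _ v => _) (fun j v => _)).
  apply: smooth_family_single.
  exact: (smooth_compR smooth_cusp_weight (@smooth_coord R 1 0) (fun _ => I)).
exact: (smooth_family_comp so sr).
Qed.

Lemma cusp_piece_eventually (c s eta : R) (om : option nat -> 'rV[R]_2 -> R) : 0 < eta ->
    smooth_family om -> om None = (fun=> 0) ->
  \forall m \near \oo, forall k u, (k <= 5)%N -> `|u| <= 1 ->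
    `|derive1n k (fun u => cusp_weight (circle_param u) * om (Some m) (rot c s (circle_param u))) u| <= eta.
Proof.
move=> eta0 so om0; have sPhi := @smooth_cusp_piece c s om so.
have Phi0 : (fun v : 'rV[R]_1 => cusp_weight (circle_param (v 0 0)) * om None (rot c s (circle_param (v 0 0)))) = (fun=> 0).
  by apply/funext => v; rewrite om0 mulr0.
have := smooth_family_small_jet 1 5 sPhi Phi0 eta0; apply: filterS => m H k u k5 u1.
have [_ E] := smooth_line (sPhi.1 (Some m)).
have := H (nseq k 0) _ (const_mx u) _; rewrite -E size_nseq => /(_ k5).
under [X in derive1n _ X]eq_fun do rewrite mxE.
by apply=> i; rewrite mxE.
Qed.

Lemma smooth_circle_rot (c s : R) (f : 'rV[R]_2 -> R) : smooth f ->
  smooth_on setT (fun u => cusp_weight (circle_param u) * f (rot c s (circle_param u))).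
Proof.
move=> sf; have := smooth_cusp_piece c s (smooth_family_single sf).
by move=> /smooth_family_smooth/smooth_line[]; under eq_fun do rewrite mxE.
Qed.

(** Rotation brings the point (c, s) to (1, 0). The premise is that [om] has zero derivative along
    the circle there; together with the even weight this is the condition of [cusp_piece]. *)
Lemma deltoid_piece : exists2 C : R, 0 <= C & forall (c s eta : R) (om : option nat -> 'rV[R]_2 -> R),
    0 < eta -> smooth_family om -> om None = (fun=> 0) ->
  \forall m \near \oo,
    - s * partial 0 (om (Some m)) (vec2 c s) + c * partial 1 (om (Some m)) (vec2 c s) = 0 ->
    exists W : 'rV[R]_2 -> R, [/\ smooth W,
    forall q : 'rV[R]_2, q 0 0 ^+ 2 + q 0 1 ^+ 2 = 1 ->
      W (deltoid_map q) = cusp_weight q * om (Some m) (rot c s q) &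
    bounded_lipschitz (C * eta) W].
Proof.
have [C C0 CP] := @cusp_piece R; exists C => // c s eta om eta0 so om0.
have := @cusp_piece_eventually c s eta om eta0 so om0; apply: filterS => m fb tan.
have sf := smooth_circle_rot c s (so.1 (Some m)).
have [||W [sW WE WL]] := CP _ eta eta0 sf _ fb.
- rewrite derive1n1 derive1E; apply: is_derive_val.
  have dk : is_derive (0 : R) 1 (cusp_weight \o circle_param) 0.
    have d := smooth_cusp_weight 0%N (x := 0) I.
    by have d0 := is_derive_even cusp_weight_even d; move: d; rewrite d0.
  apply: (is_derive_eq (is_deriveM dk (is_derive_circle_rot c s (so.1 (Some m))))).
  by rewrite tan mulr0 !scaler0 addr0.
- move=> u u35; rewrite cusp_weight0 ?mul0r// vec2E0.
  by rewrite ler_pdivrMr ?ltr_pwDl ?sqr_ge0//; lra.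
exists W; split=> // q qc; rewrite WE//; case: ltrP => q0; first by rewrite circle_paramK.
by rewrite cusp_weight0 ?mul0r// (le_trans q0).
Qed.

(** For z = c + i s the hypotheses read conj(z)^2 = z, which for |z| = 1 means z^3 = 1: the deltoid
    has a symmetry of order 3. *)
Lemma deltoid_map_rot (c s : R) q : c ^+ 2 - s ^+ 2 = c -> - 2 * c * s = s ->
  deltoid_map (rot c s q) = rot c s (deltoid_map q).
Proof.
move=> H1 H2; rewrite /deltoid_map /rot !vec2E0 !vec2E1; move: (q 0 0) (q 0 1) => x y.
congr vec2.
  transitivity (2 * (c * x - s * y) + ((c ^+ 2 - s ^+ 2) * (x ^+ 2 - y ^+ 2) + 2 * (- 2 * c * s) * x * y)).
    by ring.
  by rewrite H1 H2; ring.
transitivity (2 * (s * x + c * y) + (- 2 * c * s) * (x ^+ 2 - y ^+ 2) - 2 * (c ^+ 2 - s ^+ 2) * x * y).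
  by ring.
by rewrite H1 H2; ring.
Qed.

Lemma rotK (c s : R) q : c ^+ 2 + s ^+ 2 = 1 -> rot c s (rot c (- s) q) = q.
Proof.
move=> cs; rewrite -[RHS]vec2_eta /rot !vec2E0 !vec2E1; congr vec2.
  rewrite -[RHS]mul1r -cs; ring.
rewrite -[RHS]mul1r -cs; ring.
Qed.

Lemma rot_circle (c s : R) (q : 'rV[R]_2) : c ^+ 2 + s ^+ 2 = 1 ->
  rot c s q 0 0 ^+ 2 + rot c s q 0 1 ^+ 2 = q 0 0 ^+ 2 + q 0 1 ^+ 2.
Proof.
move=> cs; rewrite /rot vec2E0 vec2E1 -[RHS]mul1r -cs; ring.
Qed.

Lemma bounded_lipschitz_rot (c s M : R) (W : 'rV[R]_2 -> R) : c ^+ 2 + s ^+ 2 = 1 -> 0 <= M ->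
  bounded_lipschitz M W -> bounded_lipschitz (2 * M) (W \o rot c s).
Proof.
move=> cs M0 [WM WL]; split=> [x|x y] /=; first by rewrite (le_trans (WM _))//; lra.
rewrite (le_trans (WL _ _))// [2 * M]mulrC -mulrA ler_wpM2l//.
have [c1 s1] := unit_circle_bound cs.
have d0 := coord_le_norm (x - y) 0; have d1 := coord_le_norm (x - y) 1.
have b a b t : `|a| <= 1 -> `|b| <= 1 -> `|a * (x - y) 0 0 + b * (x - y) 0 1| <= 2 * `|x - y|.
  move=> a1 b1; rewrite (le_trans (ler_normD _ _))// mulr2n mulrDl mul1r !normrM.
  by apply: lerD; rewrite -[leRHS]mul1r; apply: ler_pM.
apply: rV_norm_le => [|i]; first by rewrite mulr_ge0.
rewrite /rot !mxE; case: ifP => _.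
  have -> : c * x 0 0 - s * x 0 1 - (c * y 0 0 - s * y 0 1) = c * (x - y) 0 0 + (- s) * (x - y) 0 1.
    by rewrite !mxE; ring.
  by apply: b => //; rewrite normrN.
have -> : s * x 0 0 + c * x 0 1 - (s * y 0 0 + c * y 0 1) = s * (x - y) 0 0 + c * (x - y) 0 1.
  by rewrite !mxE; ring.
exact: b.
Qed.

Lemma smooth_map_rot (c s : R) : smooth_map (rot c s).
Proof.
move=> k; apply: smooth_family_smooth.
have sM a k' : smooth_family (fun _ (v : 'rV[R]_2) => a * v 0 k' : R).
  apply: (@smooth_familyM _ _ (fun _ _ => a) (fun j x => _)); first exact: smooth_family_cst.
  exact: smooth_family_single (smooth_coord _).
apply: (@smooth_map_vec2 2 (fun _ v => _) (fun _ v => _)).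
  exact: (smooth_familyB (sM c 0) (sM s 1)).
exact: (smooth_familyD (sM s 0) (sM c 1)).
Qed.


(** These rotations permute the three summands. *)
Lemma flat_bump_sum_rot (s : R) q : s = half_sqrt3 \/ s = - half_sqrt3 -> flat_bump_sum (rot (- 2^-1) s q) = flat_bump_sum q.
Proof.
have hh := half_sqrt3_sqr.
rewrite /flat_bump_sum /rot !vec2E0 !vec2E1; move: (q 0 0) (q 0 1) half_sqrt3 hh => x y h hh.
case=> ->.
  have -> : - 2^-1 * (- 2^-1 * x - h * y) + h * (h * x + - 2^-1 * y) = x.
    transitivity ((4^-1 + h ^+ 2) * x); last by rewrite hh; field.
    by field.
  have -> : - 2^-1 * (- 2^-1 * x - h * y) - h * (h * x + - 2^-1 * y) = - 2^-1 * x + h * y.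
    transitivity ((4^-1 - h ^+ 2) * x + h * y); last by rewrite hh; field.
    by field.
  by rewrite [X in X + _]addrC addrAC.
have -> : - 2^-1 * (- 2^-1 * x - - h * y) + h * (- h * x + - 2^-1 * y) = - 2^-1 * x - h * y.
  transitivity ((4^-1 - h ^+ 2) * x - h * y); last by rewrite hh; field.
  by field.
have -> : - 2^-1 * (- 2^-1 * x - - h * y) - h * (- h * x + - 2^-1 * y) = x.
  transitivity ((4^-1 + h ^+ 2) * x); last by rewrite hh; field.
  by field.
have -> : - 2^-1 * x - - h * y = - 2^-1 * x + h * y by ring.
by rewrite [LHS]addrC addrA.
Qed.

(** The cube roots of unity, at which the velocity of the deltoid is zero. *)
Definition cusp_point (q : 'rV[R]_2) :=
  q = vec2 1 0 \/ q = vec2 (- 2^-1) half_sqrt3 \/ q = vec2 (- 2^-1) (- half_sqrt3).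

Lemma deltoid_extension_scalar (om : option nat -> 'rV[R]_2 -> R) :
    smooth_family om -> om None = (fun=> 0) ->
  \forall m \near \oo, (forall q : 'rV[R]_2, cusp_point q ->
      - q 0 1 * partial 0 (om (Some m)) q + q 0 0 * partial 1 (om (Some m)) q = 0) -> exists W : 'rV[R]_2 -> R, [/\ smooth W,
    forall q : 'rV[R]_2, q 0 0 ^+ 2 + q 0 1 ^+ 2 = 1 -> W (deltoid_map q) = om (Some m) q &
    forall x y, `|W x - W y| <= 2^-1 * `|x - y|].
Proof.
move=> so om0; have [C C0 CP] := deltoid_piece; have hh := half_sqrt3_sqr.
(* The three pieces have constants C eta, 2 C eta and 2 C eta, since a rotation may double the
   constant in the sup norm; the sum 5 C eta must not exceed 1/2. *)
pose eta := (12 * C + 12)^-1.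
have eta0 : 0 < eta by rewrite invr_gt0; lra.
have Ce : 0 <= C * eta by rewrite mulr_ge0// ltW.
have t2 s : s = half_sqrt3 \/ s = - half_sqrt3 -> (- 2^-1) ^+ 2 + s ^+ 2 = 1.
  by case=> ->; rewrite ?sqrrN hh; field.
pose piece c s m := - s * partial 0 (om (Some m)) (vec2 c s) + c * partial 1 (om (Some m)) (vec2 c s) = 0 ->
  exists W : 'rV[R]_2 -> R, [/\ smooth W,
    forall q : 'rV[R]_2, q 0 0 ^+ 2 + q 0 1 ^+ 2 = 1 ->
      W (deltoid_map q) = cusp_weight q * om (Some m) (rot c s q) &
    bounded_lipschitz (C * eta) W].
have ex c s : \forall m \near \oo, piece c s m by exact: CP.
have e0 := ex 1 0; have e1 := ex (- 2^-1) half_sqrt3; have e2 := ex (- 2^-1) (- half_sqrt3).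
near=> m.
have p0 : piece 1 0 m by near: m.
have p1 : piece (- 2^-1) half_sqrt3 m by near: m.
have p2 : piece (- 2^-1) (- half_sqrt3) m by near: m.
move=> tan.
have tan' c s : cusp_point (vec2 c s) ->
    - s * partial 0 (om (Some m)) (vec2 c s) + c * partial 1 (om (Some m)) (vec2 c s) = 0.
  by move=> cs; have := tan _ cs; rewrite vec2E0 vec2E1.
have [|W0 [sW0 E0 L0]] := p0; first by apply: tan'; left.
have [|W1 [sW1 E1 L1]] := p1; first by apply: tan'; right; left.
have [|W2 [sW2 E2 L2]] := p2; first by apply: tan'; right; right.
pose r1 := rot (- 2^-1) (- half_sqrt3); pose r2 := rot (- 2^-1) half_sqrt3.
have sr1 : smooth_map r1 := smooth_map_rot _ _; have sr2 : smooth_map r2 := smooth_map_rot _ _.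
exists (fun x => W0 x + W1 (r1 x) + W2 (r2 x)); split.
- apply: (@smoothD R 2 (fun x => _) (fun x => _)); last exact: smooth_comp sW2 sr2.
  by apply: (@smoothD R 2 (fun x => _) (fun x => _)); [exact: sW0|exact: smooth_comp sW1 sr1].
- move=> q qc.
  have D s : s = half_sqrt3 \/ s = - half_sqrt3 -> rot (- 2^-1) s (deltoid_map q) = deltoid_map (rot (- 2^-1) s q).
    by move=> sh; rewrite deltoid_map_rot//; case: sh => ->; rewrite ?sqrrN ?hh; field.
  rewrite /r1 /r2 !D ?E0 ?E1 ?E2 ?rot_circle ?t2//; try by [left|right].
  rewrite (rotK q (t2 _ (or_introl erefl))).
  have := rotK q (t2 _ (or_intror erefl)); rewrite opprK => ->.
  have -> : rot 1 0 q = q by rewrite /rot -[RHS]vec2_eta !mul1r !mul0r subr0 add0r.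
  rewrite /cusp_weight !flat_bump_sum_rot; try by [left|right].
  rewrite -!mulrDl; set w := (X in X * _); rewrite (_ : w = 1) ?mul1r//.
  rewrite /w -[RHS](@divff _ (flat_bump_sum q)); last by rewrite gt_eqF// flat_bump_sum_gt0.
  congr (_ / _); rewrite /flat_bump_sum /rot !vec2E0; congr (_ + flat_bump _ + flat_bump _); ring.
- have L1' := bounded_lipschitz_rot (t2 _ (or_intror erefl)) Ce L1.
  have L2' := bounded_lipschitz_rot (t2 _ (or_introl erefl)) Ce L2.
  have [_ L] := bounded_lipschitzD (bounded_lipschitzD L0 L1') L2'.
  move=> x y; apply: (le_trans (L x y)); rewrite ler_wpM2r//.
  have -> : C * eta + 2 * (C * eta) + 2 * (C * eta) = (5 * C) * eta by ring.
  by rewrite /eta ler_pdivrMr; lra.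
Unshelve. all: by end_near. Qed.

Lemma deltoid_extension (om : option nat -> 'rV[R]_2 -> 'rV[R]_2) :
    smooth_map_family om -> om None = (fun=> 0) ->
  \forall m \near \oo, (forall k (q : 'rV[R]_2), cusp_point q ->
      - q 0 1 * jac (om (Some m)) q 0 k + q 0 0 * jac (om (Some m)) q 1 k = 0) -> exists F : 'rV[R]_2 -> 'rV[R]_2, diffeomorphism F /\
    forall q : 'rV[R]_2, q 0 0 ^+ 2 + q 0 1 ^+ 2 = 1 ->
      F (deltoid_map q) = deltoid_map q + om (Some m) q.
Proof.
move=> so om0.
have ex k := @deltoid_extension_scalar (fun j q => om j q 0 k) (so k).
have : \forall m \near \oo, forall k, (forall q : 'rV[R]_2, cusp_point q ->
      - q 0 1 * partial 0 (fun q => om (Some m) q 0 k) q +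
      q 0 0 * partial 1 (fun q => om (Some m) q 0 k) q = 0) -> exists W : 'rV[R]_2 -> R, [/\ smooth W,
    forall q : 'rV[R]_2, q 0 0 ^+ 2 + q 0 1 ^+ 2 = 1 -> W (deltoid_map q) = om (Some m) q 0 k &
    forall x y, `|W x - W y| <= 2^-1 * `|x - y|].
  apply: filter_forall => k; apply: ex; by apply/funext => q; rewrite om0 mxE.
apply: filterS => m H tan.
have {H}/choice[W HW] k := H k (fun q qc => ltac:(by have := tan k q qc; rewrite !mxE)).
pose e (x : 'rV[R]_2) : 'rV[R]_2 := \row_k W k x.
exists (fun x => x + e x); split.
  apply: perturbed_identity_diffeomorphism => [k|x z].
    by under eq_fun do rewrite mxE; have [] := HW k.
  apply: rV_norm_le => [|k]; first by rewrite mulr_ge0.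
  by rewrite !mxE; have [_ _] := HW k; exact.
move=> q qc; congr (_ + _); apply/rowP => k; rewrite mxE.
by have [_ + _] := HW k; apply.
Qed.

End DeltoidExtension.

(** * Rescaled remainders *)

Section RescaledFamilies.
Context {R : realType}.

(** Serves the rescaled remainders, whose values may grow with |z| while their partial derivatives
    form families already treated. *)
Lemma smooth_family_of_partials n (F : option nat -> 'rV[R]_n -> R) :
    (forall j, continuous (F j)) -> (forall j, partials_exist (F j)) -> cont_cvg F ->
    (forall i, smooth_family (fun j => partial i (F j))) ->
  smooth_family F.
Proof.
move=> cF dF vF pF.
apply: (@smooth_family_coind R n [set G | G = F \/ smooth_family G]); last by left.
move=> G [->|sG]; first by split=> // i; right; exact: pF.
split=> [j|j||i].
- exact: smooth_continuous (sG.1 j).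
- exact: smooth_derivable (sG.1 j).
- exact: sG.2 [::].
- by right; exact: smooth_family_partial.
Qed.

Lemma smooth_family_shift n (F : option nat -> 'rV[R]_n -> R) N : smooth_family F ->
  smooth_family (fun j => F (omap (addn N) j)).
Proof.
move=> [sF cF]; split=> [j|s y]; first exact: sF.
have H : (fun p : nat * 'rV[R]_n => ((N + p.1)%N, p.2)) @ filter_prod \oo (nbhs y) --> filter_prod \oo (nbhs y).
  move=> A [[U V] /= [[M _ MU] Vy] UV]; exists ([set m | (M <= m)%N], V) => /=.
    by split => //; exists M.
  by move=> [m z] /= [Mm Vz]; apply: UV; split => //=; apply: MU; exact: leq_trans Mm (leq_addl _ _).
exact: cvg_comp H (cF s y).
Qed.

Lemma cont_cvg0 n (F : option nat -> 'rV[R]_n -> R) (c : nat -> R) (B : 'rV[R]_n -> R) :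
    F None = (fun=> 0) -> c @ \oo --> 0 -> continuous B ->
    (\forall m \near \oo, forall y, `|F (Some m) y| <= c m * B y) ->
  cont_cvg F.
Proof.
move=> F0 c0 cB FB y; rewrite F0; apply/cvgr0Pnorm_le => e e0.
have : (fun p : nat * 'rV[R]_n => c p.1 * B p.2) @ filter_prod \oo (nbhs y) --> 0 * B y.
  apply: cvgM; first by apply: cvg_comp c0; exact: cvg_fst.
  by apply: cvg_comp; [exact: cvg_snd|exact: cB].
rewrite mul0r => /cvgr0Pnorm_le/(_ e e0) H.
have FB' : \forall p \near filter_prod \oo (nbhs y), `|F (Some p.1) p.2| <= c p.1 * B p.2.
  exists ([set m | forall y, `|F (Some m) y| <= c m * B y], setT) => /=.
    by split => //; exact: filterT.
  by move=> [m z] /= [].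
by apply: filterS2 H FB' => -[m z] /= H FBz; rewrite (le_trans FBz)// (le_trans (ler_norm _)).
Qed.

Lemma continuous_scaled_norm n (a : R) : continuous (fun y : 'rV[R]_n => a * `|y|).
Proof.
move=> y; apply: (@continuousM R _ (fun _ : 'rV[R]_n => a) (fun y => `|y|)).
  exact: cst_continuous.
exact: norm_continuous.
Qed.

Lemma is_derive_affine n (f : 'rV[R]_n -> R) (a z v : 'rV[R]_n) (c : R) df :
  is_derive (a + c *: z) v f df -> is_derive z v (fun z => f (a + c *: z)) (c * df).
Proof.
move=> d.
have z0 : z + (0 : R) *: v = z by rewrite scale0r addr0.
rewrite -{1}z0; apply/is_derive_lineP.
have a0 : a + c *: z + (c * 0) *: v = a + c *: z by rewrite mulr0 scale0r addr0.
rewrite -a0 in d; move/is_derive_lineP : d => d.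
have dm : is_derive (0 : R) 1 (fun t => c * t) c.
  have := is_derive_monomial c 1 (0 : R); rewrite expr0 !mulr1; congr is_derive.
have := is_derive1_compR d dm; congr is_derive; apply/funext => t /=.
by rewrite scalerDr scalerA addrA.
Qed.

Lemma is_derive_coord n (x v : 'rV[R]_n) k : is_derive x v (fun z => z 0 k) (v 0 k).
Proof.
have x0 : x + (0 : R) *: v = x by rewrite scale0r addr0.
rewrite -{1}x0; apply/is_derive_lineP.
have -> : (fun t => (x + t *: v) 0 k) = (fun t => x 0 k + v 0 k * t ^+ 1).
  by apply/funext => u; rewrite !mxE expr1 mulrC.
have := is_deriveD (is_derive_cst (x 0 k) (0 : R) (1 : R)) (is_derive_monomial (v 0 k) 1 (0 : R)).
by rewrite add0r expr0 !mulr1.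
Qed.

Lemma partials_lipschitz n (f : 'rV[R]_n -> R) (C : R) (x y : 'rV[R]_n) : smooth f ->
    (forall i t, 0 <= t <= 1 -> `|partial i f (x + t *: (y - x))| <= C) ->
  `|f y - f x| <= n%:R * C * `|y - x|.
Proof.
move=> sf pC.
pose D t := lin_form (fun i => partial i f (x + t *: (y - x))) (y - x).
have dl (t : R) : is_derive t 1 (fun t => f (x + t *: (y - x))) (D t).
  have lE k := is_derive_coord (x + t *: (y - x)) (y - x) k.
  have := @derive_comp_rV R n n f id (x + t *: (y - x)) (y - x) _ (smooth_derivable sf)
    (fun k => smooth_continuous (smooth_partial k sf)) lE.
  by move/is_derive_lineP.
have [t t01 E] := @MVT_between R _ D 0 1 (fun t _ => dl t).
move: t01 E; rewrite scale0r scale1r addr0 [x + _]addrC subrK subr0 mulr1 min_l// max_r// => t01 ->.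
rewrite (le_trans (lin_form_bound _ _))// mulrC ler_wpM2r//.
by rewrite (le_trans (ler_sum _ (fun i _ => pC i t t01)))// sumr_const card_ord -[C *+ n]mulr_natl.
Qed.

(* The bound by [c] only holds from an index depending on the order of the derivative. *)
Definition uniformly_small n (c : nat -> R) (f : nat -> 'rV[R]_n -> R) :=
  (forall m, smooth (f m)) /\ forall s, \forall m \near \oo, forall y, `|iter_partial s (f m) y| <= c m.

Lemma uniformly_small_partial n c (f : nat -> 'rV[R]_n -> R) i : uniformly_small c f ->
  uniformly_small c (fun m => partial i (f m)).
Proof.
move=> [sf bf]; split=> [m|s]; first exact: smooth_partial.
have := bf (rcons s i); apply: filterS => m H y.
by have := H y; rewrite /iter_partial foldr_rcons.
Qed.

Section Rescale.
Variables (n : nat) (c eps : nat -> R) (y0 : nat -> 'rV[R]_n).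
Hypotheses (c0 : c @ \oo --> 0) (cp : forall m, 0 <= c m).
Hypotheses (eps1 : forall m, `|eps m| <= 1) (eps0 : forall m, eps m != 0).

Lemma smooth_affine (f : 'rV[R]_n -> R) m : smooth f -> smooth (fun z => f (y0 m + eps m *: z)).
Proof.
move=> sf; apply: (@smooth_comp R n n f (fun z => y0 m + eps m *: z) sf) => k.
under eq_fun do rewrite !mxE.
apply: (@smoothD R n (fun=> _) (fun z => _)); first exact: smooth_cst.
apply: (@smoothM R n (fun=> _) (fun z => _)); [exact: smooth_cst|exact: smooth_coord].
Qed.

(** The amplitude a absorbs the factors eps that differentiation produces, so that these families
    are closed under [partial]. *)
Definition rescaled0 (a : nat -> R) (f : nat -> 'rV[R]_n -> R) (j : option nat) (z : 'rV[R]_n) : R :=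
  if j is Some m then a m * f m (y0 m + eps m *: z) else 0.

Lemma rescaled0_smooth f a : (forall m, `|a m| <= 1) -> uniformly_small c f ->
  smooth_family (rescaled0 a f).
Proof.
move=> a1 uf.
apply: (@smooth_family_coind R n [set F | exists f a,
  [/\ forall m, `|a m| <= 1, uniformly_small c f & F = rescaled0 a f]]); last by exists f, a.
move=> _ [{uf}f [{a1}a [a1 uf ->]]].
have sm m : smooth (rescaled0 a f (Some m)).
  apply: (@smoothM R n (fun=> _) (fun z => _)); first exact: smooth_cst.
  exact: smooth_affine (uf.1 m).
have s0 : smooth (rescaled0 a f None) := smooth_cst 0.
split=> [[m|]|[m|]||i].
- exact: smooth_continuous (sm m).
- exact: smooth_continuous s0.
- exact: smooth_derivable (sm m).
- exact: smooth_derivable s0.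
- apply: (@cont_cvg0 n _ c (fun=> 1)) => //; first exact: cst_continuous.
  have := uf.2 [::]; apply: filterS => m H y; rewrite /rescaled0 normrM mulr1 -[leRHS]mul1r.
  by apply: ler_pM => //; exact: H.
- exists (fun m => partial i (f m)), (fun m => a m * eps m); split.
  + by move=> m; rewrite normrM mulr_ile1.
  + exact: uniformly_small_partial.
  + apply/funext => -[m|]; last exact: (iter_partial0 [:: i]).
    apply/funext => z; apply: is_derive_val; rewrite /rescaled0.
    have d := is_derive_affine (is_derive_partial i (y0 m + eps m *: z) (uf.1 m)).
    by rewrite -mulrA; exact: is_deriveZ.
Qed.

(** Differentiation cancels the division by eps, so the partial derivatives are of the form
    [rescaled0]; the value itself is controlled by the mean value theorem, independently of eps. *)
Definition rescaled1 (f : nat -> 'rV[R]_n -> R) (j : option nat) (z : 'rV[R]_n) : R :=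
  if j is Some m then (f m (y0 m + eps m *: z) - f m (y0 m)) / eps m else 0.

Lemma rescaled1_bound f m (C : R) z : smooth (f m) -> (forall i y, `|partial i (f m) y| <= C) ->
  `|rescaled1 f (Some m) z| <= n%:R * C * `|z|.
Proof.
move=> sf fC; rewrite /rescaled1 normrM normfV ler_pdivrMr ?normr_gt0//.
have := @partials_lipschitz n (f m) C (y0 m) (y0 m + eps m *: z) sf (fun i t _ => fC i _).
by move=> H; rewrite (le_trans H)// [_ + _ - _]addrAC subrr add0r normrZ mulrA mulrAC.
Qed.

Lemma rescaled1_partial f m i : smooth (f m) ->
  partial i (rescaled1 f (Some m)) = fun z => partial i (f m) (y0 m + eps m *: z).
Proof.
move=> sf; apply/funext => z; apply: is_derive_val; rewrite /rescaled1.
have d := is_derive_affine (is_derive_partial i (y0 m + eps m *: z) sf).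
have := is_deriveZ (eps m)^-1 (is_deriveB d (is_derive_cst (f m (y0 m)) z (delta_mx 0 i))).
rewrite subr0 /GRing.scale/= mulKf//; congr is_derive.
by apply/funext => w; rewrite !fctE mulrC.
Qed.

Lemma rescaled1_smooth1 f m : smooth (f m) -> smooth (rescaled1 f (Some m)).
Proof.
move=> sf; apply: (@smoothM R n (fun z => _) (fun=> _)); last exact: smooth_cst.
apply: (@smoothD R n (fun z => _) (fun=> _)); last exact: smooth_cst.
exact: smooth_affine.
Qed.

Lemma common_bound f : uniformly_small c f ->
  \forall m \near \oo, forall (i : 'I_n) y, `|partial i (f m) y| <= c m.
Proof.
by move=> [_ bf]; apply: filter_forall => i; exact: bf [:: i].
Qed.

Lemma rescaled1_smooth f : uniformly_small c f -> smooth_family (rescaled1 f).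
Proof.
move=> uf; have s0 : smooth (rescaled1 f None) := smooth_cst 0.
apply: smooth_family_of_partials => [[m|]|[m|]||i].
- exact: smooth_continuous (rescaled1_smooth1 (uf.1 m)).
- exact: smooth_continuous s0.
- exact: smooth_derivable (rescaled1_smooth1 (uf.1 m)).
- exact: smooth_derivable s0.
- apply: (@cont_cvg0 n _ c (fun y => n%:R * `|y|)) => //.
    exact: continuous_scaled_norm.
  have := common_bound uf; apply: filterS => m H y.
  by rewrite mulrA [c m * _]mulrC; exact: rescaled1_bound (uf.1 m) H.
- have := @rescaled0_smooth (fun m => partial i (f m)) (fun=> 1) _ (uniformly_small_partial i uf).
  rewrite normr1 => /(_ (fun _ => lexx _)); congr smooth_family; apply/funext => -[m|].
    by rewrite rescaled1_partial; [apply/funext => z; rewrite /rescaled0 mul1r|exact: (uf.1 m)].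
  exact/esym/(iter_partial0 [:: i]).
Qed.

(** Its partial derivatives are the [rescaled1] of those of f, and it vanishes at 0, so its size
    follows by integration from 0. *)
Definition rescaled2 (f : nat -> 'rV[R]_n -> R) (j : option nat) (z : 'rV[R]_n) : R :=
  if j is Some m then
    (f m (y0 m + eps m *: z) - f m (y0 m) -
       eps m * lin_form (fun i => partial i (f m) (y0 m)) z) / eps m ^+ 2
  else 0.

Lemma is_derive_lin_form (b : 'I_n -> R) i z : is_derive z (delta_mx 0 i) (lin_form b) (b i).
Proof.
have d k : is_derive z (delta_mx 0 i) (fun v : 'rV[R]_n => v 0 k * b k) ((k == i)%:R * b k).
  have := is_deriveZ (b k) (is_derive_coord z (delta_mx 0 i) k).
  rewrite mxE eqxx /GRing.scale/= mulrC; congr is_derive.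
  by apply/funext => w; exact: mulrC.
rewrite (_ : lin_form b = \sum_k (fun v : 'rV[R]_n => v 0 k * b k)); last first.
  by apply/funext => v; rewrite fct_sumE.
apply: (is_derive_eq (is_derive_sum d)).
by rewrite (bigD1 i)//= eqxx mul1r big1 ?addr0// => k /negbTE->; rewrite mul0r.
Qed.

Lemma rescaled2_partial f m i : smooth (f m) ->
  partial i (rescaled2 f (Some m)) = rescaled1 (fun m => partial i (f m)) (Some m).
Proof.
move=> sf; apply/funext => z; apply: is_derive_val; rewrite /rescaled1.
have d := is_derive_affine (is_derive_partial i (y0 m + eps m *: z) sf).
have d2 := is_deriveB (is_deriveB d (is_derive_cst (f m (y0 m)) z (delta_mx 0 i)))
  (is_deriveZ (eps m) (is_derive_lin_form (fun i => partial i (f m) (y0 m)) i z)).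
have := is_deriveZ (eps m ^+ 2)^-1 d2.
have -> : (eps m ^+ 2)^-1 \*: ((fun z => f m (y0 m + eps m *: z)) - cst (f m (y0 m)) -
    eps m \*: lin_form (fun i => partial i (f m) (y0 m))) = rescaled2 f (Some m).
  by apply/funext => w; rewrite !fctE /GRing.scale/= mulrC.
move=> H; apply: (is_derive_eq H).
by rewrite subr0 /GRing.scale/=; field.
Qed.

Lemma smooth_lin_form (b : 'I_n -> R) : smooth (lin_form b).
Proof.
apply: smooth_family_smooth; apply: (@smooth_family_sum R n n (fun k _ z => z 0 k * b k)) => k.
apply: (@smooth_familyM _ _ (fun _ z => _) (fun _ _ => _)); last exact: smooth_family_cst.
exact: smooth_family_single (smooth_coord _).
Qed.

Lemma rescaled2_smooth1 f m : smooth (f m) -> smooth (rescaled2 f (Some m)).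
Proof.
move=> sf; apply: (@smoothM R n (fun z => _) (fun=> _)); last exact: smooth_cst.
apply: (@smoothD R n (fun z => _) (fun z => _)).
  apply: (@smoothD R n (fun z => _) (fun=> _)); last exact: smooth_cst.
  exact: smooth_affine.
apply: (@smoothN R n (fun z => _)).
apply: (@smoothM R n (fun=> _) (fun z => _)); [exact: smooth_cst|exact: smooth_lin_form].
Qed.

Lemma rescaled2_smooth f : uniformly_small c f -> smooth_family (rescaled2 f).
Proof.
move=> uf; have s0 : smooth (rescaled2 f None) := smooth_cst 0.
apply: smooth_family_of_partials => [[m|]|[m|]||i].
- exact: smooth_continuous (rescaled2_smooth1 (uf.1 m)).
- exact: smooth_continuous s0.
- exact: smooth_derivable (rescaled2_smooth1 (uf.1 m)).
- exact: smooth_derivable s0.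
- apply: (@cont_cvg0 n _ c (fun y => n%:R * (n%:R * `|y|) * `|y|)) => //.
    rewrite (_ : (fun y => _) = (fun y : 'rV[R]_n => n%:R * n%:R * `|y|) \* (fun y => `|y|)).
      by move=> y; apply: continuousM; [exact: continuous_scaled_norm|exact: norm_continuous].
    by apply/funext => y /=; rewrite mulrA.
  have H2 : \forall m \near \oo, forall i k y, `|partial k (partial i (f m)) y| <= c m.
    by apply: filter_forall => i; exact: common_bound (uniformly_small_partial i uf).
  apply: filterS H2 => m H2 y.
  have z0 : rescaled2 f (Some m) 0 = 0.
    rewrite /rescaled2 scaler0 addr0 subrr /lin_form big1 ?mulr0 ?subr0 ?mul0r// => i _.
    by rewrite mxE mul0r.
  rewrite -[rescaled2 _ _ _]subr0 -z0.
  have -> : c m * (n%:R * (n%:R * `|y|) * `|y|) = n%:R * (n%:R * c m * `|y|) * `|y - 0|.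
    by rewrite subr0; ring.
  apply: partials_lipschitz; first exact: rescaled2_smooth1 (uf.1 m).
  move=> i t /andP[t0 t1]; rewrite subr0 add0r rescaled2_partial; last exact: (uf.1 m).
  apply: (@le_trans _ _ (n%:R * c m * `|t *: y|)).
    apply: rescaled1_bound; first exact: smooth_partial (uf.1 m).
    exact: H2.
  rewrite ler_wpM2l ?mulr_ge0//.
  by rewrite normrZ ger0_norm// ler_piMl.
- have := rescaled1_smooth (uniformly_small_partial i uf).
  congr smooth_family; apply/funext => -[m|]; last exact/esym/(iter_partial0 [:: i]).
  by rewrite (rescaled2_partial i (uf.1 m)).
Qed.

End Rescale.
End RescaledFamilies.

(** * The rescaled critical set *)

Section PerturbedDeltoid.
Context {R : realType}.

Lemma ord2_case (P : 'I_2 -> Prop) : P 0 -> P 1 -> forall i, P i.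
Proof.
move=> P0 P1 i; have [->|->] // : i = 0 \/ i = 1.
by case: i => -[|[|//]] H; [left|right]; exact/val_inj.
Qed.

Lemma sum_ord2 (F : 'I_2 -> R) : \sum_i F i = F 0 + F 1.
Proof.
rewrite big_ord_recl big_ord1; have -> : lift ord0 ord0 = 1 :> 'I_2 by exact/val_inj.
by [].
Qed.

Definition cutoff (z : 'rV[R]_2) : R := plateau (z 0 0) * plateau (z 0 1).

Lemma cutoff_itv z : 0 <= cutoff z <= 1.
Proof.
have /andP[a0 a1] := plateau_itv (z 0 0); have /andP[b0 b1] := plateau_itv (z 0 1).
by rewrite mulr_ge0//= mulr_ile1.
Qed.

Lemma cutoff0 (z : 'rV[R]_2) i : 2 <= `|z 0 i| -> cutoff z = 0.
Proof.
move: i; apply: ord2_case => /plateau0 p0; rewrite /cutoff p0 ?mul0r ?mulr0//.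
Qed.

Lemma cutoff1 (z : 'rV[R]_2) : (forall i, `|z 0 i| <= 1) -> cutoff z = 1.
Proof. by move=> z1; rewrite /cutoff !plateau1 ?mulr1. Qed.

Lemma smooth_cutoff : smooth cutoff.
Proof.
apply: (@smoothM R 2 (fun z => _) (fun z => _)).
  exact: (smooth_compR (@plateau_smooth R) (@smooth_coord R 2 0) (fun _ => I)).
exact: (smooth_compR (@plateau_smooth R) (@smooth_coord R 2 1) (fun _ => I)).
Qed.

Lemma smooth_family_scale (a : R) (F : option nat -> 'rV[R]_2 -> R) :
  smooth_family F -> smooth_family (fun j x => a * F j x).
Proof. by move=> sF; exact: (smooth_familyM (smooth_family_cst 2 a) sF). Qed.

Lemma smooth_coord_family i : smooth_family (fun _ (z : 'rV[R]_2) => z 0 i).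
Proof. exact: smooth_family_single (smooth_coord i). Qed.

Section Data.
(* [u] and [rho] are the rescaled remainders of the second derivatives and of the gradient of the
   perturbation.  In the rescaled coordinates the Hessian matrix is a multiple of
   [[t + 2 e0, - 2 e1], [- 2 e1, t - 2 e0]] with [t = pert_trace] and [e = pert_dev]. *)
Variables (u : 'I_2 -> 'I_2 -> option nat -> 'rV[R]_2 -> R) (rho : 'I_2 -> option nat -> 'rV[R]_2 -> R).

Definition pert_trace j (z : 'rV[R]_2) : R := 1 + 2^-1 * (u 0 0 j z + u 1 1 j z).

Definition pert_dev j (z : 'rV[R]_2) : 'rV[R]_2 :=
  vec2 (z 0 0 + 4^-1 * (u 0 0 j z - u 1 1 j z)) (z 0 1 - 2^-1 * u 0 1 j z).

(** Four times the rescaled gradient: for zero [rho] the factor 4 makes its value at q / 2 the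
    deltoid map at q. *)
Definition pert_map j (z : 'rV[R]_2) : 'rV[R]_2 :=
  vec2 (4 * (z 0 0 ^+ 2 - z 0 1 ^+ 2 + z 0 0 + rho 0 j z)) (4 * (z 0 1 - 2 * z 0 0 * z 0 1 + rho 1 j z)).

Definition pert_critical j : set 'rV[R]_2 :=
  [set z | 4 * (pert_dev j z 0 0 ^+ 2 + pert_dev j z 0 1 ^+ 2) = pert_trace j z ^+ 2].

Definition pert_trace_cut j z : R := 1 + cutoff z * (pert_trace j z - 1).

(* Where the cutoff is 1, the map [z + pert_dev_cut j z] is [pert_dev j z] divided by
   [pert_trace j z], which maps the critical set onto the circle of radius 1/2. *)
Definition pert_dev_cut j z : 'rV[R]_2 :=
  (cutoff z * (pert_trace_cut j z)^-1) *: (pert_dev j z - pert_trace j z *: z).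

Hypotheses (su : forall i k, smooth_family (u i k)) (sr : forall i, smooth_family (rho i)).
Hypotheses (u0 : forall i k, u i k None = fun=> 0) (r0 : forall i, rho i None = fun=> 0).
Hypotheses (usym : u 1 0 = u 0 1) (dr : forall m i k, partial i (rho k (Some m)) = u i k (Some m)).
Hypothesis ub : forall m i k z, `|u i k (Some m) z| <= 20^-1 * `|z|.

Lemma pert_bound j i k z : `|u i k j z| <= 20^-1 * `|z|.
Proof. by case: j => [m|]; [exact: ub|rewrite u0 normr0 mulr_ge0// invr_ge0]. Qed.

Lemma pert_trace_bound j z : `|pert_trace j z - 1| <= 20^-1 * `|z|.
Proof.
rewrite /pert_trace [1 + _]addrC addrK normrM ger0_norm ?invr_ge0//.
have := ler_normD (u 0 0 j z) (u 1 1 j z).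
have := pert_bound j 0 0 z; have := pert_bound j 1 1 z; lra.
Qed.

Lemma pert_trace_cut_gt0 j z : 0 < pert_trace_cut j z.
Proof.
rewrite /pert_trace_cut; have [z2|] := pselect (forall i, `|z 0 i| <= 2); last first.
  move=> /existsNP[i /negP]; rewrite -ltNge => /ltW/cutoff0->.
  by rewrite mul0r addr0.
have zn : `|z| <= 2 by exact: rV_norm_le.
have := pert_trace_bound j z; have /andP[c0 c1] := cutoff_itv z.
rewrite ler_norml => /andP[t1 t2]; nra.
Qed.

Lemma smooth_pert_trace : smooth_family pert_trace.
Proof.
apply: (smooth_familyD (smooth_family_cst 2 1)); apply: (@smooth_family_scale _ (fun j z => _)).
exact: smooth_familyD.
Qed.

Lemma smooth_pert_dev : smooth_map_family pert_dev.
Proof.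
apply: smooth_map_vec2.
  apply: (smooth_familyD (smooth_coord_family 0)); apply: (@smooth_family_scale _ (fun j z => _)).
  exact: smooth_familyB.
apply: (smooth_familyB (smooth_coord_family 1)); exact: smooth_family_scale.
Qed.

Lemma smooth_pert_trace_cut : smooth_family pert_trace_cut.
Proof.
apply: (smooth_familyD (smooth_family_cst 2 1)).
apply: (smooth_familyM (smooth_family_single smooth_cutoff)).
exact: (smooth_familyB smooth_pert_trace (smooth_family_cst 2 1)).
Qed.

Lemma smooth_pert_dev_cut : smooth_map_family pert_dev_cut.
Proof.
move=> k; under eq_fun do under eq_fun do rewrite mxE.
apply: (@smooth_familyM _ _ (fun j z => _) (fun j z => _)).
  apply: (@smooth_familyM _ _ (fun j z => _) (fun j z => _)).
    exact: smooth_family_single smooth_cutoff.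
  apply: smooth_familyV; first exact: smooth_pert_trace_cut.
  by move=> j x; rewrite gt_eqF// pert_trace_cut_gt0.
have -> : (fun j z => (pert_dev j z - pert_trace j z *: z) 0 k) =
    (fun j z => pert_dev j z 0 k - pert_trace j z * z 0 k).
  by apply/funext => j; apply/funext => z; rewrite [LHS]mxE [X in _ + X]mxE [X in _ - X]mxE.
apply: (smooth_familyB (smooth_pert_dev k)).
exact: (smooth_familyM smooth_pert_trace (smooth_coord_family k)).
Qed.

Lemma smooth_pert_map : smooth_map_family pert_map.
Proof.
have s0 := smooth_coord_family 0; have s1 := smooth_coord_family 1.
have q0 := smooth_familyM s0 s0; have q1 := smooth_familyM s1 s1; have q01 := smooth_familyM s0 s1.
apply: smooth_map_vec2; apply: (@smooth_family_scale _ (fun j z => _)).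
  apply: (fun H => smooth_familyD H (sr 0)); apply: (fun H => smooth_familyD H s0).
  exact: (smooth_familyB q0 q1).
apply: (fun H => smooth_familyD H (sr 1)); apply: (smooth_familyB s1).
under eq_fun do under eq_fun do rewrite -mulrA.
exact: (@smooth_family_scale 2 (fun j z => _) q01).
Qed.

Lemma pert_dev_cut_None : pert_dev_cut None = fun=> 0.
Proof.
apply/funext => z; rewrite /pert_dev_cut /pert_dev /pert_trace !u0.
by rewrite subrr addr0 !mulr0 !addr0 subr0 vec2_eta scale1r subrr scaler0.
Qed.

(** Where a coordinate exceeds 2 in absolute value the cutoff vanishes; on the remaining box both
    partial derivatives are eventually at most 1/4. *)
Lemma pert_dev_cut_lipschitz : \forall m \near \oo, forall x z,
  `|pert_dev_cut (Some m) x - pert_dev_cut (Some m) z| <= 2^-1 * `|x - z|.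
Proof.
have e0 : (0 : R) < 4^-1 by rewrite invr_gt0.
have H : \forall m \near \oo, forall k : 'I_2, forall s, (size s <= 1)%N ->
    forall y : 'rV[R]_2, (forall i, `|y 0 i| <= 2) ->
    `|iter_partial s (fun y => pert_dev_cut (Some m) y 0 k) y| <= 4^-1.
  apply: filter_forall => k.
  apply: (@smooth_family_small_jet R 2 (fun j y => pert_dev_cut j y 0 k) 2 _ 1%N (smooth_pert_dev_cut k)) => //.
  by apply/funext => z; rewrite pert_dev_cut_None mxE.
apply: filterS H => m H x z; apply: rV_norm_le => [|k]; first by rewrite mulr_ge0.
rewrite !mxE -!/(pert_dev_cut (Some m) _ 0 k).
have sk := (smooth_pert_dev_cut k).1 (Some m).
have := @partials_lipschitz R 2 (fun y => pert_dev_cut (Some m) y 0 k) 4^-1 z x sk.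
have -> : 2%:R * 4^-1 = 2^-1 :> R by field.
rewrite !mxE; apply=> i t _; set y := z + _.
have [y2|] := pselect (forall i, `|y 0 i| <= 2); first exact: (H k [:: i]).
move=> /existsNP[l /negP]; rewrite -ltNge => l2.
have nx : \forall y' \near y, pert_dev_cut (Some m) y' 0 k = 0.
  have : \forall y' \near y, 2 < `|(y' : 'rV[R]_2) 0 l|.
    apply: (@open_nbhs_nbhs _ y [set y' | 2 < `|(y' : 'rV[R]_2) 0 l|]); split => //.
    apply: (@open_comp _ _ (fun y' : 'rV[R]_2 => y' 0 l) [set v | 2 < `|v|]) => [v _|].
      exact: coord_continuous.
    exact: (@open_norm_gt R 2).
  by apply: filterS => y' /ltW/cutoff0 E; rewrite /pert_dev_cut E mul0r scale0r mxE.
rewrite /partial (near_eq_derive _ nx) derive_cst normr0 invr_ge0//.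
Qed.


Hypothesis devL : forall j x z, `|pert_dev_cut j x - pert_dev_cut j z| <= 2^-1 * `|x - z|.
Variable G : option nat -> 'rV[R]_2 -> 'rV[R]_2.
Hypotheses (sG : smooth_map_family G) (GK : forall j, cancel (G j) (fun x => x + pert_dev_cut j x)).
Hypothesis KG : forall j, cancel (fun x => x + pert_dev_cut j x) (G j).

Definition on_circle (q : 'rV[R]_2) := q 0 0 ^+ 2 + q 0 1 ^+ 2 = 1.

Definition pert_deltoid j (q : 'rV[R]_2) := pert_map j (G j (2^-1 *: q)).

Lemma pert_trace_gt0 j (z : 'rV[R]_2) : (forall i, `|z 0 i| <= 1) -> 0 < pert_trace j z.
Proof.
by move=> z1; have := pert_trace_cut_gt0 j z; rewrite /pert_trace_cut cutoff1// mul1r addrCA subrr addr0.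
Qed.

Lemma pert_dev_cutE j (z : 'rV[R]_2) : (forall i, `|z 0 i| <= 1) ->
  z + pert_dev_cut j z = (pert_trace j z)^-1 *: pert_dev j z.
Proof.
move=> z1; have t0 := pert_trace_gt0 j z1.
rewrite /pert_dev_cut /pert_trace_cut cutoff1// !mul1r addrCA subrr addr0.
by rewrite scalerBr scalerA mulVf ?gt_eqF// scale1r addrCA subrr addr0.
Qed.

(** On the critical set twice any coordinate of the deviation is bounded by the trace. For the
    largest coordinate of z the former is at least (19/10) |z|, and the trace is at most 1 + |z| /
    20, so |z| < 1 and the cutoff is 1 there. *)
Lemma pert_critical_bound j z : pert_critical j z -> forall i, `|z 0 i| <= 1.
Proof.
rewrite /pert_critical /= => zc.
have Tb : pert_trace j z ^+ 2 <= (1 + 20^-1 * `|z|) ^+ 2.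
  rewrite -[leLHS]real_normK ?num_real// ler_pXn2r ?nnegrE ?addr_ge0 ?mulr_ge0 ?invr_ge0//.
  have := pert_trace_bound j z; have := ler_normD 1 (pert_trace j z - 1).
  by rewrite addrCA subrr addr0 normr1; lra.
have c0 := coord_le_norm z 0; have c1 := coord_le_norm z 1.
have eb i : `|z 0 i| - 20^-1 * `|z| <= `|pert_dev j z 0 i|.
  have h : `|pert_dev j z 0 i - z 0 i| <= 20^-1 * `|z|.
    have b0 := pert_bound j 0 0 z; have b1 := pert_bound j 1 1 z; have b2 := pert_bound j 0 1 z.
    move: i; apply: ord2_case.
      rewrite /pert_dev vec2E0 addrAC subrr add0r normrM ger0_norm ?invr_ge0//.
      have := ler_normB (u 0 0 j z) (u 1 1 j z); have := normr_ge0 z; lra.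
    rewrite /pert_dev vec2E1 addrAC subrr add0r normrN normrM ger0_norm ?invr_ge0//.
    have := normr_ge0 z; lra.
  have := ler_normB (pert_dev j z 0 i) (pert_dev j z 0 i - z 0 i).
  by rewrite opprB addrCA subrr addr0; lra.
have sb i : (`|z 0 i| - 20^-1 * `|z|) * 2 <= 1 + 20^-1 * `|z|.
  have n1 : 0 <= 1 + 20^-1 * `|z| by rewrite addr_ge0// mulr_ge0// invr_ge0.
  have P : `|pert_dev j z 0 i| * 2 <= 1 + 20^-1 * `|z|.
    rewrite -(@ler_pXn2r _ 2)// ?nnegrE ?mulr_ge0// (le_trans _ Tb)// -zc exprMn real_normK ?num_real//.
    by move: i {eb}; apply: ord2_case; have := sqr_ge0 (pert_dev j z 0 0); have := sqr_ge0 (pert_dev j z 0 1); lra.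
  have := eb i; lra.
have zn : `|z| <= 1.
  have [i zi] : exists i, `|z| <= `|z 0 i|.
    have [H|H] := lerP `|z 0 0| `|z 0 1|; [exists 1|exists 0]; apply: rV_norm_le => //.
      by apply: ord2_case.
    by apply: ord2_case => //; exact: ltW.
  have := sb i; lra.
by move=> i; rewrite (le_trans (coord_le_norm z i)).
Qed.

Lemma pert_dev_cut_zero j : pert_dev_cut j 0 = 0.
Proof.
have E i k : u i k j 0 = 0.
  by apply/eqP; rewrite -normr_le0 (le_trans (pert_bound j i k 0))// normr0 mulr0.
have Z i : (0 : 'rV[R]_2) 0 i = 0 by rewrite mxE.
have D : pert_dev j 0 = 0.
  by rewrite -[RHS]vec2_eta /pert_dev !E !Z subrr !mulr0 subr0 addr0.
by rewrite /pert_dev_cut D scaler0 subrr scaler0.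
Qed.

Lemma pert_inner j (q : 'rV[R]_2) : on_circle q -> forall i, `|G j (2^-1 *: q) 0 i| <= 1.
Proof.
move=> qc; set z := G j _.
have zE : z + pert_dev_cut j z = 2^-1 *: q := GK j _.
have L := devL j z 0; rewrite pert_dev_cut_zero !subr0 in L.
have [q0 q1] := unit_circle_bound qc.
have qn : `|q| <= 1 by apply: rV_norm_le => //; apply: ord2_case.
have := ler_normB (z + pert_dev_cut j z) (pert_dev_cut j z).
rewrite addrK zE normrZ ger0_norm ?invr_ge0// => H i.
by rewrite (le_trans (coord_le_norm z i))//; lra.
Qed.

Lemma pert_dev_inner j (q : 'rV[R]_2) i : on_circle q ->
  2 * pert_dev j (G j (2^-1 *: q)) 0 i = pert_trace j (G j (2^-1 *: q)) * q 0 i.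
Proof.
move=> qc; have z1 := pert_inner j qc; have := GK j (2^-1 *: q).
move: (G j _) z1 => z z1; have t0 := pert_trace_gt0 j z1.
rewrite pert_dev_cutE// => /(congr1 (fun v : 'rV[R]_2 => 2 * pert_trace j z * v 0 i)).
rewrite [X in _ * X = _]mxE [X in _ = _ * X]mxE => E.
transitivity (2 * pert_trace j z * ((pert_trace j z)^-1 * pert_dev j z 0 i)).
  by field; rewrite gt_eqF.
by rewrite E; field.
Qed.

(** Both the critical set and the image under [G] of the circle of radius 1/2 lie in the unit box,
    where the cutoff is 1; there the critical equation says that deviation / trace lies on that
    circle. *)
Lemma pert_critical_param j z : pert_critical j z <-> exists2 q, on_circle q & z = G j (2^-1 *: q).
Proof.
split=> [zc|[q qc ->]].
  have z1 := pert_critical_bound zc; have t0 := pert_trace_gt0 j z1.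
  exists (2 *: (z + pert_dev_cut j z)); last by rewrite scalerA mulVf// scale1r KG.
  have c i : (2 *: (z + pert_dev_cut j z)) 0 i = 2 * ((pert_trace j z)^-1 * pert_dev j z 0 i).
    by rewrite pert_dev_cutE// mxE [X in _ * X]mxE.
  rewrite /on_circle !c; move: zc; rewrite /pert_critical/= => zc.
  transitivity ((pert_trace j z)^-2 * (4 * (pert_dev j z 0 0 ^+ 2 + pert_dev j z 0 1 ^+ 2))).
    by field; rewrite gt_eqF.
  by rewrite zc mulVf// sqrf_eq0 gt_eqF.
have d i := pert_dev_inner j i qc; rewrite /pert_critical/=.
transitivity ((2 * pert_dev j (G j (2^-1 *: q)) 0 0) ^+ 2 + (2 * pert_dev j (G j (2^-1 *: q)) 0 1) ^+ 2).
  by ring.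
by rewrite !d !exprMn -mulrDr qc mulr1.
Qed.

Lemma pert_deltoid_image j : pert_map j @` pert_critical j = pert_deltoid j @` [set q | on_circle q].
Proof.
apply/seteqP; split=> x /= [].
  by move=> z /pert_critical_param[q qc ->] <-; exists q.
by move=> q qc <-; exists (G j (2^-1 *: q)) => //; apply/pert_critical_param; exists q.
Qed.

Lemma partial_rho j i k z : partial i (rho k j) z = u i k j z.
Proof. by case: j => [m|]; [rewrite dr|rewrite r0 u0; rewrite [partial _ _](iter_partial0 [:: i])]. Qed.

Lemma jac_pert_map j z :
  [/\ jac (pert_map j) z 0 0 = 4 * (pert_trace j z + 2 * pert_dev j z 0 0),
      jac (pert_map j) z 0 1 = 4 * (- 2 * pert_dev j z 0 1),
      jac (pert_map j) z 1 0 = 4 * (- 2 * pert_dev j z 0 1) &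
      jac (pert_map j) z 1 1 = 4 * (pert_trace j z - 2 * pert_dev j z 0 0)].
Proof.
have dc i k : is_derive z (delta_mx 0 i) (fun z : 'rV[R]_2 => z 0 k) (k == i)%:R.
  by have := is_derive_coord z (delta_mx 0 i) k; rewrite mxE eqxx.
have drho i k : is_derive z (delta_mx 0 i) (rho k j) (u i k j z).
  by rewrite -partial_rho; exact: is_derive_partial ((sr k).1 j).
have d0 i : jac (pert_map j) z i 0 =
    4 * (2 * z 0 0 * (0 == i)%:R - 2 * z 0 1 * (1 == i)%:R + (0 == i)%:R + u i 0 j z).
  rewrite mxE; apply: is_derive_val; under eq_fun do rewrite vec2E0.
  have d := is_deriveZ 4 (is_deriveD (is_deriveD (is_deriveB (is_deriveX 2 (dc i 0)) (is_deriveX 2 (dc i 1))) (dc i 0)) (drho i 0)).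
  by apply: (is_derive_eq d); rewrite /GRing.scale/= !expr1 !mulr_natl.
have d1 i : jac (pert_map j) z i 1 =
    4 * ((1 == i)%:R - 2 * (z 0 0 * (1 == i)%:R + z 0 1 * (0 == i)%:R) + u i 1 j z).
  rewrite mxE; apply: is_derive_val; under eq_fun do rewrite vec2E1.
  have d := is_deriveZ 4 (is_deriveD (is_deriveB (dc i 1) (is_deriveZ 2 (is_deriveM (dc i 0) (dc i 1)))) (drho i 1)).
  have := is_derive_eq d erefl; congr is_derive.
  by apply/funext => w; rewrite -mulrA.
by rewrite !d0 !d1 /pert_trace /pert_dev vec2E0 vec2E1 /= usym; split; field.
Qed.

Lemma smooth_half : smooth_map_family (fun (j : option nat) (q : 'rV[R]_2) => 2^-1 *: q).
Proof.
move=> k; under eq_fun do under eq_fun do rewrite mxE.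
exact: (smooth_family_scale 2^-1 (smooth_coord_family k)).
Qed.

Lemma smooth_pert_inner : smooth_map_family (fun j q => G j (2^-1 *: q)).
Proof. by move=> k; exact: (smooth_family_comp (sG k) smooth_half). Qed.

Lemma smooth_pert_deltoid : smooth_map_family pert_deltoid.
Proof. by move=> k; exact: (smooth_family_comp (smooth_pert_map k) smooth_pert_inner). Qed.

Lemma pert_deltoid_None : pert_deltoid None = deltoid_map.
Proof.
apply/funext => q; rewrite /pert_deltoid.
have -> : G None (2^-1 *: q) = 2^-1 *: q.
  by have := GK None (2^-1 *: q); rewrite pert_dev_cut_None addr0.
by rewrite /pert_map !r0 /deltoid_map !addr0 ![(_ *: q) 0 _]mxE; congr vec2; field.
Qed.

Definition circle_derive (f : 'rV[R]_2 -> 'rV[R]_2) (q : 'rV[R]_2) k :=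
  - q 0 1 * jac f q 0 k + q 0 0 * jac f q 1 k.

(* On the critical circle the Jacobian matrix of [pert_map] is a multiple of the rank one matrix
   [[1 + q0, - q1], [- q1, 1 - q0]], whose image is spanned by [(1 + q0, - q1)]. *)
Lemma circle_derive_pert j q : on_circle q ->
  (1 + q 0 0) * circle_derive (pert_deltoid j) q 1 = - q 0 1 * circle_derive (pert_deltoid j) q 0.
Proof.
move=> qc; rewrite /circle_derive.
have sm : smooth_map (pert_map j) := fun k => (smooth_pert_map k).1 j.
have si : smooth_map (fun q => G j (2^-1 *: q)) := fun k => (smooth_pert_inner k).1 j.
have J := @jac_comp R 2 2 2 (pert_map j) (fun q => G j (2^-1 *: q)) q sm si.
have JE i k : jac (pert_deltoid j) q i k = jac (fun q => G j (2^-1 *: q)) q i 0 * jac (pert_map j) (G j (2^-1 *: q)) 0 k +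
    jac (fun q => G j (2^-1 *: q)) q i 1 * jac (pert_map j) (G j (2^-1 *: q)) 1 k.
  have := congr1 (fun M : 'M[R]_2 => M i k) J; rewrite [RHS]mxE sum_ord2; exact.
have [j00 j01 j10 j11] := jac_pert_map j (G j (2^-1 *: q)).
rewrite (JE 0 0) (JE 0 1) (JE 1 0) (JE 1 1) j00 j01 j10 j11 !mulNr !pert_dev_inner//.
move: (jac _ q 0 0) (jac _ q 0 1) (jac _ q 1 0) (jac _ q 1 1) (pert_trace j _) => a b c d t.
have sE : q 0 1 ^+ 2 = 1 - q 0 0 ^+ 2 by rewrite -qc addrC addKr.
move: (q 0 0) (q 0 1) sE => x y sE.
apply/eqP; rewrite -subr_eq0; apply/eqP.
transitivity (4 * t * (1 - x ^+ 2 - y ^+ 2) * (x * d - y * b)); last by rewrite sE subrr mulr0 mul0r.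
by ring.
Qed.

End Data.
End PerturbedDeltoid.

(** * Displaced cusps *)

Section CuspZeros.
Context {R : realType}.

Lemma sign_change_at_zero (L : R -> R) (a : R) : is_derive (0 : R) 1 L a -> a != 0 -> L 0 = 0 ->
  forall delta, 0 < delta -> exists2 d, 0 < d < delta & L d * L (- d) < 0.
Proof.
move=> dL a0 L0 delta delta0.
have an : 0 < `|a| / 2 by rewrite divr_gt0 ?normr_gt0.
have [ex Ld] := dL.
have : (fun h : R => h^-1 *: (L (h *: 1 + 0) - L 0)) @ (0:R)^' --> a.
  by rewrite -Ld; exact: ex.
move=> /cvgrPdist_lt/(_ _ an) H.
have H2 : \forall h \near (0 : R)^', `|a - h^-1 * L h| < `|a| / 2.
  by apply: filterS H => h; rewrite L0 subr0 addr0 [h *: 1]mulr1.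
move: H2 => /nbhs_ballP[r /= r0 rP].
have Lb h : h != 0 -> `|h| < r -> `|a - h^-1 * L h| < `|a| / 2.
  by move=> h0 hr; apply: rP => //; rewrite /ball/= sub0r normrN.
pose d := Num.min r delta / 2.
have m0 : 0 < Num.min r delta by rewrite lt_min r0.
have d0 : 0 < d by rewrite divr_gt0.
have mr : Num.min r delta <= r by rewrite ge_min lexx.
have md : Num.min r delta <= delta by rewrite ge_min lexx orbT.
have dr : d < r by rewrite /d ltr_pdivrMr//; lra.
have dd : d < delta.
  by rewrite /d ltr_pdivrMr//; lra.
exists d; first by rewrite d0.
have b1 := Lb d (lt0r_neq0 d0); rewrite gtr0_norm// in b1; move/(_ dr) : b1 => b1.
have b2 := Lb (- d); rewrite oppr_eq0 normrN gtr0_norm// in b2; move/(_ (lt0r_neq0 d0) dr) : b2 => b2.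
have E : L d * L (- d) = - (d * d) * ((d^-1 * L d) * ((- d)^-1 * L (- d))).
  by field; rewrite gt_eqF.
rewrite E mulNr oppr_lt0; apply: mulr_gt0; first exact: mulr_gt0.
move: b1 b2; move: (d^-1 * _) ((- d)^-1 * _) => p q.
have [ap|an'] := ltrP 0 a.
  by rewrite !ltr_norml ger0_norm ?(ltW ap)// => /andP[? ?] /andP[? ?]; apply: mulr_gt0; lra.
have a1 : a < 0 by rewrite lt_neqAle a0.
rewrite !ltr_norml ltr0_norm// => /andP[? ?] /andP[? ?]; rewrite nmulr_rgt0; lra.
Qed.

(* [d m] is chosen as an almost smallest zero of [phi m]. *)
Lemma zero_sequence (phi : nat -> R -> R) (L : R -> R) (a : R) :
    (forall m, continuous (phi m)) -> (forall d, (fun m => phi m d) @ \oo --> L d) ->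
    is_derive (0 : R) 1 L a -> a != 0 -> L 0 = 0 ->
  exists2 d : nat -> R, d @ \oo --> 0 & \forall m \near \oo, phi m (d m) = 0.
Proof.
move=> cphi phiL dL a0 L0.
(* A sign change of the limit between -d and d persists for large m, and the intermediate value
   theorem gives a zero of [phi m] between them; pointwise convergence is enough for this. *)
have ex delta : 0 < delta -> \forall m \near \oo, exists2 d, `|d| < delta & phi m d = 0.
  move=> delta0; have [d /andP[d0 dd] Ld] := sign_change_at_zero dL a0 L0 delta0.
  have /cvgrPdist_lt H : (fun m => phi m d * phi m (- d)) @ \oo --> L d * L (- d) by exact: cvgM.
  have := H (- (L d * L (- d))); rewrite oppr_gt0 => /(_ Ld); apply: filterS => m.
  rewrite ltr_norml => /andP[H1 _].
  have pn : phi m d * phi m (- d) < 0 by lra.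
  have [|||c cI c0] := @IVT R (phi m) (- d) d 0.
  - by lra.
  - by apply: continuous_subspaceT => x; exact: cphi.
  - have [p|p] := lerP (phi m (- d)) (phi m d).
      by apply/andP; split; nra.
    by apply/andP; split; nra.
  exists c => //; move: cI; rewrite in_itv/= ltr_norml => /andP[? ?]; apply/andP; split; lra.
pose Z m := [set `|d| | d in [set d | phi m d = 0]].
have near_inf m : exists d, Z m !=set0 -> phi m d = 0 /\ `|d| < inf (Z m) + m.+1%:R^-1.
  have [Z0|Z0] := pselect (Z m !=set0); last by exists 0 => /Z0.
  have hi : has_inf (Z m) by split => //; exists 0 => _ [d _ <-].
  have e0 : (0 : R) < m.+1%:R^-1 by rewrite invr_gt0.
  have [_ [d d0 <-] dlt] := inf_adherent e0 hi.
  by exists d.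
have [d dP] := choice near_inf; exists d.
  apply/cvgr0Pnorm_lt => e e0.
  have e2 : 0 < e / 2 by rewrite divr_gt0.
  have /cvgr0Pnorm_lt/(_ _ e2) Hm := @cvg_harmonic R.
  apply: filterS2 (ex _ e2) Hm => m [d' d'e d'0].
  rewrite /harmonic/= ger0_norm ?invr_ge0// => me.
  have [|_ H] := dP m; first by exists `|d'|; exists d'.
  rewrite (lt_le_trans H)//.
  have infd : inf (Z m) <= `|d'| by apply: ge_inf; [exists 0 => _ [? _ <-]|exists d'].
  move: infd me d'e; move: (inf (Z m)) `|d'| (m.+1%:R^-1 : R) => x y z; lra.
by apply: filterS (ex 1 ltr01) => m [d' _ d'0]; have [|] := dP m; first by exists `|d'|; exists d'.
Qed.

Lemma circle_angle (q : 'rV[R]_2) : q 0 0 ^+ 2 + q 0 1 ^+ 2 = 1 -> exists t, q = vec2 (cos t) (sin t).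
Proof.
move=> qc; have [q0 q1] := unit_circle_bound qc; move: q0; rewrite ler_norml => q0.
have cE := acosK (x := q 0 0) _.
have sE : `|q 0 1| = sin (acos (q 0 0)).
  have := sin_acos q0; rewrite -sqrtr_sqr => ->; congr Num.sqrt; rewrite -qc; ring.
have [p|p] := lerP 0 (q 0 1).
  exists (acos (q 0 0)); rewrite -[LHS]vec2_eta cE// -sE ger0_norm//.
exists (- acos (q 0 0)); rewrite -[LHS]vec2_eta cosN sinN cE// -sE ltr0_norm// opprK//.
Qed.

Lemma tricuspoidE : @tricuspoid R = deltoid_map @` [set q : 'rV[R]_2 | on_circle q].
Proof.
have E t : deltoid_map (vec2 (cos t) (sin t)) = vec2 (2 * cos t + cos (2 * t)) (2 * sin t - sin (2 * t)) :> 'rV[R]_2.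
  rewrite /deltoid_map vec2E0 vec2E1 [2 * t]mulr_natl cos_mulr2n sin_mulr2n.
  have := cos2Dsin2 t; move: (cos t) (sin t) => c s cs.
  congr vec2; last by rewrite mulr2n; ring.
  by rewrite mulr2n -[1]cs; ring.
apply/seteqP; split => x /=.
  move=> [t _ <-]; exists (vec2 (cos t) (sin t)) => //.
  by rewrite /on_circle vec2E0 vec2E1 cos2Dsin2.
by move=> [q /circle_angle[t ->] <-]; exists t.
Qed.

Lemma cos_smooth_on : smooth_on setT (@cos R) /\ smooth_on setT (@sin R).
Proof.
pose S := [set f : R -> R | exists a b, f = fun x => a * cos x + b * sin x].
have H : forall f, S f -> smooth_on setT f.
  apply: smooth_on_coind; first exact: openT.
  move=> _ [a [b ->]]; exists (fun x => b * cos x + (- a) * sin x); first by exists b, (- a).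
  move=> x _; have d := is_deriveD (is_deriveZ a (is_derive_cos x)) (is_deriveZ b (is_derive_sin x)).
  by apply: (is_derive_eq d); rewrite /GRing.scale/=; ring.
split; apply: H; [exists 1, 0|exists 0, 1]; apply/funext => x; rewrite mul1r mul0r ?addr0 ?add0r//.
Qed.


(* Three coefficients, because the angle is to be prescribed at three points of the circle. *)
Section Reparametrization.
Variables (a b c : option nat -> R).

Definition turn_angle j (q : 'rV[R]_2) : R := a j + b j * q 0 0 + c j * q 0 1.

Definition turn j (q : 'rV[R]_2) : 'rV[R]_2 := rot (cos (turn_angle j q)) (sin (turn_angle j q)) q.

(** The lift s |-> s + angle stays within M of the identity, so the intermediate value theorem makes
    it onto. *)
Lemma turn_onto j q : on_circle q -> exists2 p, on_circle p & turn j p = q.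
Proof.
move=> /circle_angle[t ->].
pose f (s : R) := s + turn_angle j (vec2 (cos s) (sin s)).
pose M := `|a j| + `|b j| + `|c j|.
have fb s : `|f s - s| <= M.
  rewrite /f addrAC subrr add0r /turn_angle vec2E0 vec2E1.
  rewrite (le_trans (ler_normD _ _))// lerD//; last by rewrite normrM ler_piMr// ler_norml sin_geN1 sin_le1.
  rewrite (le_trans (ler_normD _ _))// lerD//; by rewrite normrM ler_piMr// ler_norml cos_geN1 cos_le1.
have M0 : 0 <= M by rewrite !addr_ge0.
have cf : continuous f.
  have -> : f = (fun s => s + (a j + b j * cos s + c j * sin s)).
    by apply/funext => s; rewrite /f /turn_angle vec2E0 vec2E1.
  move=> s; apply: cvgD; first exact: cvg_id.
  apply: cvgD; last by apply: cvgM; [exact: cvg_cst|exact: continuous_sin].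
  by apply: cvgD; [exact: cvg_cst|apply: cvgM; [exact: cvg_cst|exact: continuous_cos]].
have [|||s _ fs] := @IVT R f (t - M) (t + M) t.
- by lra.
- by apply: continuous_subspaceT => x; exact: cf.
- have := fb (t - M); have := fb (t + M); rewrite !ler_norml => /andP[? ?] /andP[? ?].
  by rewrite ge_min le_max; apply/andP; split; apply/orP; [left|right]; lra.
exists (vec2 (cos s) (sin s)); first by rewrite /on_circle vec2E0 vec2E1 cos2Dsin2.
by rewrite /turn -[in RHS]fs /f cosD sinD /rot !vec2E0 !vec2E1; congr vec2; ring.
Qed.

Hypotheses (ca : (fun m => a (Some m)) @ \oo --> a None) (cb : (fun m => b (Some m)) @ \oo --> b None).
Hypotheses (cc : (fun m => c (Some m)) @ \oo --> c None).

Lemma smooth_turn_angle : smooth_family turn_angle.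
Proof.
have sM d i : (fun m => d (Some m)) @ \oo --> (d None : R) -> smooth_family (fun j (q : 'rV[R]_2) => d j * q 0 i).
  by move=> cd; exact: (smooth_familyM (smooth_family_scalar 2 cd) (smooth_coord_family i)).
exact: (smooth_familyD (smooth_familyD (smooth_family_scalar 2 ca) (sM b 0 cb)) (sM c 1 cc)).
Qed.

Lemma smooth_turn : smooth_map_family turn.
Proof.
have [sc ss] := cos_smooth_on.
have s1 := smooth_family_comp1 sc smooth_turn_angle (fun _ _ => I).
have s2 := smooth_family_comp1 ss smooth_turn_angle (fun _ _ => I).
have c0 := @smooth_coord_family R 0; have c1 := @smooth_coord_family R 1.
apply: smooth_map_vec2.
  exact: (smooth_familyB (smooth_familyM s1 c0) (smooth_familyM s2 c1)).
exact: (smooth_familyD (smooth_familyM s2 c0) (smooth_familyM s1 c1)).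
Qed.

(** For q on the circle, tau is the rate of the angle of [turn j q], and the velocity is tau times
    the unit tangent at the image point. A zero velocity of a curve at [turn j q] thus gives one for
    its reparametrization at q. *)
Lemma circle_derive_turn j (q : 'rV[R]_2) :
  let tau := 1 + (- q 0 1 * b j + q 0 0 * c j) in
  circle_derive (turn j) q 0 = - tau * turn j q 0 1 /\ circle_derive (turn j) q 1 = tau * turn j q 0 0.
Proof.
have dc i k : is_derive q (delta_mx 0 i) (fun z : 'rV[R]_2 => z 0 k) (k == i)%:R.
  by have := is_derive_coord q (delta_mx 0 i) k; rewrite mxE eqxx.
have da i : is_derive q (delta_mx 0 i) (turn_angle j) (b j * (0 == i)%:R + c j * (1 == i)%:R).
  have d := is_deriveD (is_deriveD (is_derive_cst (a j) q (delta_mx 0 i)) (is_deriveZ (b j) (dc i 0))) (is_deriveZ (c j) (dc i 1)).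
  by rewrite add0r in d.
have dcos i := is_derive_comp1 (is_derive_cos (turn_angle j q)) (da i).
have dsin i := is_derive_comp1 (is_derive_sin (turn_angle j q)) (da i).
have j0 i : jac (turn j) q i 0 = - (b j * (0 == i)%:R + c j * (1 == i)%:R) * turn j q 0 1 +
    cos (turn_angle j q) * (0 == i)%:R - sin (turn_angle j q) * (1 == i)%:R.
  rewrite mxE; apply: is_derive_val; under eq_fun do rewrite vec2E0.
  have d := is_deriveB (is_deriveM (dcos i) (dc i 0)) (is_deriveM (dsin i) (dc i 1)).
  apply: (is_derive_eq d); rewrite /turn /rot vec2E1 /GRing.scale/=; ring.
have j1 i : jac (turn j) q i 1 = (b j * (0 == i)%:R + c j * (1 == i)%:R) * turn j q 0 0 +
    sin (turn_angle j q) * (0 == i)%:R + cos (turn_angle j q) * (1 == i)%:R.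
  rewrite mxE; apply: is_derive_val; under eq_fun do rewrite vec2E1.
  have d := is_deriveD (is_deriveM (dsin i) (dc i 0)) (is_deriveM (dcos i) (dc i 1)).
  apply: (is_derive_eq d); rewrite /turn /rot vec2E0 /GRing.scale/=; ring.
rewrite /circle_derive !j0 !j1 /= /turn /rot vec2E0 vec2E1; split; ring.
Qed.

End Reparametrization.

Lemma circle_derive_comp (F T : 'rV[R]_2 -> 'rV[R]_2) q k : smooth_map F -> smooth_map T ->
  circle_derive (F \o T) q k =
    circle_derive T q 0 * jac F (T q) 0 k + circle_derive T q 1 * jac F (T q) 1 k.
Proof.
move=> sF sT; have J := jac_comp q sF sT.
have JE i : jac (F \o T) q i k = jac T q i 0 * jac F (T q) 0 k + jac T q i 1 * jac F (T q) 1 k.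
  by have := congr1 (fun M : 'M[R]_2 => M i k) J; rewrite [RHS]mxE sum_ord2; exact.
rewrite /circle_derive (JE 0) (JE 1); ring.
Qed.

End CuspZeros.

(** * The deltoid and its perturbations *)

Section PerturbedCaustic.
Context {R : realType}.
Variables (u : 'I_2 -> 'I_2 -> option nat -> 'rV[R]_2 -> R) (rho : 'I_2 -> option nat -> 'rV[R]_2 -> R).
Hypotheses (su : forall i k, smooth_family (u i k)) (sr : forall i, smooth_family (rho i)).
Hypotheses (u0 : forall i k, u i k None = fun=> 0) (r0 : forall i, rho i None = fun=> 0).
Hypotheses (usym : u 1 0 = u 0 1) (dr : forall m i k, partial i (rho k (Some m)) = u i k (Some m)).
Hypothesis ub : forall m i k z, `|u i k (Some m) z| <= 20^-1 * `|z|.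

Lemma circle_derive_deltoid (q : 'rV[R]_2) :
  circle_derive deltoid_map q 0 = - 2 * q 0 1 - 4 * (q 0 0 * q 0 1) /\
  circle_derive deltoid_map q 1 = 2 * q 0 1 ^+ 2 + 2 * q 0 0 - 2 * q 0 0 ^+ 2.
Proof.
have dc i k : is_derive q (delta_mx 0 i) (fun z : 'rV[R]_2 => z 0 k) (k == i)%:R.
  by have := is_derive_coord q (delta_mx 0 i) k; rewrite mxE eqxx.
have j0 i : jac deltoid_map q i 0 = 2 * (0 == i)%:R + 2 * q 0 0 * (0 == i)%:R - 2 * q 0 1 * (1 == i)%:R.
  rewrite mxE; apply: is_derive_val; under eq_fun do rewrite vec2E0.
  have d := is_deriveB (is_deriveD (is_deriveZ 2 (dc i 0)) (is_deriveX 2 (dc i 0))) (is_deriveX 2 (dc i 1)).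
  by apply: (is_derive_eq d); rewrite /GRing.scale/= !expr1 !mulr_natl.
have j1 i : jac deltoid_map q i 1 = 2 * (1 == i)%:R - 2 * (q 0 0 * (1 == i)%:R + q 0 1 * (0 == i)%:R).
  rewrite mxE; apply: is_derive_val; under eq_fun do rewrite vec2E1.
  have d := is_deriveB (is_deriveZ 2 (dc i 1)) (is_deriveZ 2 (is_deriveM (dc i 0) (dc i 1))).
  have := is_derive_eq d erefl; congr is_derive.
  by apply/funext => w; rewrite -mulrA.
by rewrite /circle_derive !j0 !j1 /=; split; ring.
Qed.

Lemma smooth_circle_derive (F : option nat -> 'rV[R]_2 -> 'rV[R]_2) k : smooth_map_family F ->
  smooth_family (fun j q => circle_derive (F j) q k).
Proof.
move=> sF; have c0 := @smooth_coord_family R 0; have c1 := @smooth_coord_family R 1.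
have J i := smooth_map_family_jac i k sF.
exact: (smooth_familyD (smooth_familyM (smooth_familyN c1) (J 0)) (smooth_familyM c0 (J 1))).
Qed.

Definition turned (p : 'rV[R]_2) (d : R) : 'rV[R]_2 := rot (cos d) (sin d) p.

Lemma turned_coord_continuous p k : continuous (fun d => turned p d 0 k).
Proof.
move: k; apply: ord2_case => d.
  have -> : (fun d => turned p d 0 0) = (fun d => cos d * p 0 0 - sin d * p 0 1).
    by apply/funext => t; rewrite vec2E0.
  by apply: cvgB; apply: cvgM; [exact: continuous_cos|exact: cvg_cst|exact: continuous_sin|exact: cvg_cst].
have -> : (fun d => turned p d 0 1) = (fun d => sin d * p 0 0 + cos d * p 0 1).
  by apply/funext => t; rewrite vec2E1.
by apply: cvgD; apply: cvgM; [exact: continuous_sin|exact: cvg_cst|exact: continuous_cos|exact: cvg_cst].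
Qed.

Lemma turned_continuous p : continuous (turned p).
Proof. by move=> d; apply: continuous_rV => k; exact: turned_coord_continuous. Qed.

Lemma is_derive_turned (p : 'rV[R]_2) :
  is_derive (0 : R) 1 (fun d => circle_derive deltoid_map (turned p d) 0)
    (- 2 * p 0 0 - 4 * (p 0 0 ^+ 2 - p 0 1 ^+ 2)).
Proof.
have -> : (fun d => circle_derive deltoid_map (turned p d) 0) =
   (fun d => - 2 * (turned p d 0 1) - 4 * (turned p d 0 0 * turned p d 0 1)).
  by apply/funext => d; rewrite (circle_derive_deltoid _).1.
have c0 : is_derive (0 : R) 1 (fun d => turned p d 0 0) (- p 0 1).
  under eq_fun do rewrite vec2E0.
  have d := is_deriveB (is_deriveM (is_derive_cos (0 : R)) (is_derive_cst (p 0 0) (0 : R) (1 : R)))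
    (is_deriveM (is_derive_sin (0 : R)) (is_derive_cst (p 0 1) (0 : R) (1 : R))).
  by apply: (is_derive_eq d); rewrite sin0 cos0 /GRing.scale/=; ring.
have c1 : is_derive (0 : R) 1 (fun d => turned p d 0 1) (p 0 0).
  under eq_fun do rewrite vec2E1.
  have d := is_deriveD (is_deriveM (is_derive_sin (0 : R)) (is_derive_cst (p 0 0) (0 : R) (1 : R)))
    (is_deriveM (is_derive_cos (0 : R)) (is_derive_cst (p 0 1) (0 : R) (1 : R))).
  by apply: (is_derive_eq d); rewrite sin0 cos0 /GRing.scale/=; ring.
have d := is_deriveB (is_deriveZ (- 2) c1) (is_deriveZ 4 (is_deriveM c0 c1)).
apply: (is_derive_eq d); rewrite /turned /rot vec2E0 vec2E1 sin0 cos0 /GRing.scale/=; ring.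
Qed.

(** The first quantity is the derivative along the circle of the first velocity component: the cusps
    are simple zeros, hence persist. The second, stable under small shifts, allows a division in
    [circle_derive_pert], so that the second component vanishes with the first. *)
Lemma cusp_point_props (p : 'rV[R]_2) : cusp_point p ->
  [/\ - 2 * p 0 0 - 4 * (p 0 0 ^+ 2 - p 0 1 ^+ 2) != 0, 0 < 1 + p 0 0 &
      forall k, circle_derive deltoid_map p k = 0].
Proof.
have hh := @half_sqrt3_sqr R.
have [d0 d1] := circle_derive_deltoid p.
move=> cp; have : [/\ - 2 * p 0 0 - 4 * (p 0 0 ^+ 2 - p 0 1 ^+ 2) != 0, 0 < 1 + p 0 0,
     - 2 * p 0 1 - 4 * (p 0 0 * p 0 1) = 0 & 2 * p 0 1 ^+ 2 + 2 * p 0 0 - 2 * p 0 0 ^+ 2 = 0].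
  by case: cp => [->|[->|->]]; rewrite vec2E0 vec2E1 ?sqrrN ?hh; split; (try by lra); apply/eqP; lra.
by move=> [H1 H2 H3 H4]; split=> //; apply: ord2_case; rewrite ?d0 ?d1.
Qed.

Lemma cusp_shifts (F : option nat -> 'rV[R]_2 -> 'rV[R]_2) p : smooth_map_family F -> F None = deltoid_map ->
    cusp_point p ->
  exists2 d : nat -> R, d @ \oo --> 0 & \forall m \near \oo,
    circle_derive (F (Some m)) (turned p (d m)) 0 = 0 /\ 1 + turned p (d m) 0 0 != 0.
Proof.
move=> sF F0 cp; have [a0 p0 cd0] := cusp_point_props cp.
have sD := smooth_circle_derive 0 sF.
have t0 : turned p 0 = p by rewrite /turned cos0 sin0 /rot !mul1r !mul0r subr0 add0r vec2_eta.
have [|||d d0 dz] := @zero_sequence R (fun m d => circle_derive (F (Some m)) (turned p d) 0) _ _ _ _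
   (is_derive_turned p) a0.
- move=> m x; apply: (@continuous_comp _ _ _ (turned p) (fun q => circle_derive (F (Some m)) q 0)).
    exact: turned_continuous.
  have cD : continuous (fun q => circle_derive (F (Some m)) q 0) := smooth_continuous (sD.1 (Some m)).
  exact: cD.
- move=> x; rewrite -F0.
  have H : (fun m : nat => (m, turned p x)) @ \oo --> filter_prod \oo (nbhs (turned p x)).
    move=> A [[U V] /= [[M _ MU] Vy] UV]; exists M => //= m Mm.
    by apply: UV; split => /=; [exact: MU|exact: nbhs_singleton].
  exact: cvg_comp H (sD.2 [::] (turned p x)).
- by rewrite t0 cd0.
exists d => //; apply: filterS2 dz _ => [m -> H|]; first by split => //; exact: H.
have : (fun m => 1 + turned p (d m) 0 0) @ \oo --> 1 + p 0 0.
  rewrite -{2}t0; apply: cvgD; first exact: cvg_cst.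
  apply: (@cvg_comp _ _ _ d (fun d => turned p d 0 0)); first exact: d0.
  exact: (@turned_coord_continuous p 0 0).
move=> /cvgrPdist_lt/(_ _ p0); apply: filterS => m; apply: contraTneq => ->.
by rewrite subr0 gtr0_norm ?ltxx.
Qed.


Lemma half_sqrt3_neq0 : half_sqrt3 != 0 :> R.
Proof. by rewrite -sqrf_eq0 half_sqrt3_sqr; apply/eqP; lra. Qed.

Lemma cusp_point_on_circle (p : 'rV[R]_2) : cusp_point p -> on_circle p.
Proof.
have hh := @half_sqrt3_sqr R; rewrite /on_circle.
by case=> [->|[->|->]]; rewrite vec2E0 vec2E1 ?sqrrN ?hh; field.
Qed.

Hypothesis devL : forall j x z, `|pert_dev_cut u j x - pert_dev_cut u j z| <= 2^-1 * `|x - z|.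

Lemma perturbed_deltoid_diffeomorphism : \forall m \near \oo, exists2 F, diffeomorphism F &
  pert_map rho (Some m) @` pert_critical u (Some m) = F @` tricuspoid.
Proof.
have [|G [sG GK KG]] := @perturbed_identity_inverse R 2 (pert_dev_cut u) _ devL.
  exact: smooth_pert_dev_cut.
pose C := pert_deltoid rho G.
have sC : smooth_map_family C by exact: smooth_pert_deltoid.
have C0 : C None = deltoid_map by exact: pert_deltoid_None.
have cp0 : cusp_point (vec2 1 0 : 'rV[R]_2) by left.
have cp1 : cusp_point (vec2 (- 2^-1) half_sqrt3 : 'rV[R]_2) by right; left.
have cp2 : cusp_point (vec2 (- 2^-1) (- half_sqrt3) : 'rV[R]_2) by right; right.
have [d0 d0c d0z] := cusp_shifts sC C0 cp0; have [d1 d1c d1z] := cusp_shifts sC C0 cp1.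
have [d2 d2c d2z] := cusp_shifts sC C0 cp2.
pose ext (f : nat -> R) j := if j is Some m then f m else 0.
(* The function a + b cos + c sin takes the values [d0], [d1], [d2] at the three cube roots of
   unity. *)
pose a := ext (fun m => (d0 m + d1 m + d2 m) / 3).
pose b := ext (fun m => (2 * d0 m - d1 m - d2 m) / 3).
pose c := ext (fun m => (d1 m - d2 m) / (2 * half_sqrt3)).
have ca : (fun m => a (Some m)) @ \oo --> a None.
  rewrite (_ : a None = (0 + 0 + 0) / 3); last by rewrite !addr0 mul0r.
  by apply: cvgM; [apply: cvgD => //; apply: cvgD|exact: cvg_cst].
have cb : (fun m => b (Some m)) @ \oo --> b None.
  rewrite (_ : b None = (2 * 0 - 0 - 0) / 3); last by rewrite mulr0 !subr0 mul0r.
  apply: cvgM; [apply: cvgB => //; apply: cvgB => //|exact: cvg_cst].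
  by apply: cvgM => //; exact: cvg_cst.
have cc : (fun m => c (Some m)) @ \oo --> c None.
  rewrite (_ : c None = (0 - 0) / (2 * half_sqrt3)); last by rewrite subr0 mul0r.
  by apply: cvgM; [exact: cvgB|exact: cvg_cst].
pose T := turn a b c; have sT : smooth_map_family T := smooth_turn ca cb cc.
have sCT : smooth_map_family (fun j => C j \o T j) by move=> k; exact: smooth_family_comp (sC k) sT.
have sdel : smooth_map_family (fun _ : option nat => @deltoid_map R).
  by move=> k; apply: smooth_family_single; have := (sC k).1 None; rewrite C0.
pose om j q := C j (T j q) - deltoid_map q.
have som : smooth_map_family om.
  move=> k; have -> : (fun j q => om j q 0 k) = (fun j q => C j (T j q) 0 k - deltoid_map q 0 k).
    by apply/funext => j; apply/funext => q; rewrite [LHS]mxE [X in _ + X]mxE.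
  exact: (smooth_familyB (sCT k) (sdel k)).
have om0 : om None = (fun=> 0).
  apply/funext => q; rewrite /om C0 /T /turn /turn_angle /= !mul0r !addr0 cos0 sin0.
  by rewrite /rot !mul1r !mul0r subr0 add0r vec2_eta subrr.
have := deltoid_extension som om0.
move=> dx; apply: filterS3 d0z (filterI d1z d2z) dx => m z0 [z1 z2].
have h0 := half_sqrt3_neq0.
have Tz q : cusp_point q ->
    circle_derive (C (Some m)) (T (Some m) q) 0 = 0 /\ 1 + T (Some m) q 0 0 != 0.
  have tE d : turn_angle a b c (Some m) q = d -> T (Some m) q = turned q d by rewrite /T /turn => ->.
  case=> [qE|[qE|qE]].
  - by rewrite (tE (d0 m)) ?qE// /turn_angle vec2E0 vec2E1 /a /b /c /=; field.
  - by rewrite (tE (d1 m)) ?qE// /turn_angle vec2E0 vec2E1 /a /b /c /=; field.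
  - by rewrite (tE (d2 m)) ?qE// /turn_angle vec2E0 vec2E1 /a /b /c /=; field.
have Tc q : on_circle q -> on_circle (T (Some m) q).
  by move=> qc; rewrite /on_circle rot_circle// cos2Dsin2.
case=> [k q cq|F [dF FE]].
  have [D0 n1] := Tz q cq.
  have D k' : circle_derive (C (Some m)) (T (Some m) q) k' = 0.
    move: k'; apply: ord2_case => //.
    (* The shifts only make the first velocity component vanish; the rank one relation transfers
       this to the second. *)
    have : (1 + T (Some m) q 0 0) * circle_derive (C (Some m)) (T (Some m) q) 1 =
      - T (Some m) q 0 1 * circle_derive (C (Some m)) (T (Some m) q) 0.
      exact: (circle_derive_pert sr u0 r0 usym dr ub devL sG GK (Some m) (Tc q (cusp_point_on_circle cq))).
    by rewrite D0 mulr0 => /eqP; rewrite mulf_eq0 (negbTE n1) => /eqP.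
  have sCm : smooth_map (C (Some m)) := fun k => (sC k).1 (Some m).
  have sTm : smooth_map (T (Some m)) := fun k => (sT k).1 (Some m).
  have CT0 : circle_derive (C (Some m) \o T (Some m)) q k = 0.
    rewrite circle_derive_comp//; have [-> ->] := circle_derive_turn a b c (Some m) q.
    have := D k; rewrite /circle_derive => Dk; rewrite -/T.
    set tau := 1 + _; transitivity (tau * (- T (Some m) q 0 1 * jac (C (Some m)) (T (Some m) q) 0 k +
      T (Some m) q 0 0 * jac (C (Some m)) (T (Some m) q) 1 k)); first by ring.
    by rewrite Dk mulr0.
  have [_ _ /(_ k) de0] := cusp_point_props cq.
  have J i : jac (om (Some m)) q i k = jac (C (Some m) \o T (Some m)) q i k - jac deltoid_map q i k.
    rewrite !mxE; apply: is_derive_val.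
    have d1' := is_derive_partial i q ((sCT k).1 (Some m)).
    have d2' := is_derive_partial i q ((sdel k).1 None).
    have := is_deriveB d1' d2'; congr is_derive.
    by apply/funext => w; rewrite [RHS]mxE [X in _ = _ + X]mxE.
  move: CT0 de0; rewrite /circle_derive (J 0) (J 1) => CT0 de0.
  transitivity ((- q 0 1 * jac (C (Some m) \o T (Some m)) q 0 k + q 0 0 * jac (C (Some m) \o T (Some m)) q 1 k) -
   (- q 0 1 * jac deltoid_map q 0 k + q 0 0 * jac deltoid_map q 1 k)); first by ring.
  by rewrite CT0 de0 subrr.
exists F => //; rewrite (pert_deltoid_image rho u0 ub devL GK KG (Some m)) tricuspoidE.
apply/seteqP; split => x /= [].
  move=> q qc <-; have [p pc pE] := turn_onto a b c (Some m) qc.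
  exists (deltoid_map p); first by exists p.
  by rewrite FE// /om addrC subrK -/C -pE.
move=> _ [q qc <-] <-; exists (T (Some m) q); first exact: Tc.
by rewrite FE// /om addrC subrK.
Qed.

End PerturbedCaustic.

Lemma perturbed_deltoid_exists (R : realType)
    (u : 'I_2 -> 'I_2 -> option nat -> 'rV[R]_2 -> R) (rho : 'I_2 -> option nat -> 'rV[R]_2 -> R) :
    (forall i k, smooth_family (u i k)) -> (forall i, smooth_family (rho i)) ->
    (forall i k, u i k None = fun=> 0) -> (forall i, rho i None = fun=> 0) ->
    u 1 0 = u 0 1 -> (forall m i k, partial i (rho k (Some m)) = u i k (Some m)) ->
    (forall m i k z, `|u i k (Some m) z| <= 20^-1 * `|z|) ->
  exists m, exists2 F, diffeomorphism F &
    pert_map rho (Some m) @` pert_critical u (Some m) = F @` tricuspoid.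
Proof.
move=> su sr u0 r0 usym dr ub.
have [N _ NP] := pert_dev_cut_lipschitz su u0 ub.
(* Dropping the first N indices makes the Lipschitz bound hold for every member of the family. *)
pose u' i k j := u i k (omap (addn N) j); pose rho' i j := rho i (omap (addn N) j).
have devL j x z : `|pert_dev_cut u' j x - pert_dev_cut u' j z| <= 2^-1 * `|x - z|.
  case: j => [m|]; first by apply: (NP (N + m)%N); rewrite /= leq_addr.
  by rewrite !(pert_dev_cut_None (u := u')) ?subrr ?normr0 ?mulr_ge0 ?invr_ge0// => i k; exact: u0.
have su' i k : smooth_family (u' i k) := smooth_family_shift N (su i k).
have sr' i : smooth_family (rho' i) := smooth_family_shift N (sr i).
have usym' : u' 1 0 = u' 0 1 by rewrite /u' usym.
have [M _ MP] := @perturbed_deltoid_diffeomorphism R u' rho' su' sr' u0 r0 usym'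
  (fun m => dr (N + m)%N) (fun m => ub (N + m)%N) devL.
have [F dF FE] := MP M (leqnn M).
by exists (N + M)%N, F.
Qed.

(** * The center of a perturbed umbilic *)

Section UmbilicPerturbation.
Context {R : realType}.

Lemma mixed_difference n (f : 'rV[R]_n -> R) i j (x : 'rV[R]_n) (e : R) : smooth f -> 0 < e ->
  exists2 p, `|p - x| <= 2 * e &
    f (x + e *: delta_mx 0 i + e *: delta_mx 0 j) - f (x + e *: delta_mx 0 i) -
      f (x + e *: delta_mx 0 j) + f x = e ^+ 2 * partial j (partial i f) p.
Proof.
move=> sf e0; set vi : 'rV[R]_n := delta_mx 0 i; set vj : 'rV[R]_n := delta_mx 0 j.
have dl (g : 'rV[R]_n -> R) k (p : 'rV[R]_n) (s : R) : smooth g ->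
  is_derive s 1 (fun t : R => g (p + t *: (delta_mx 0 k : 'rV[R]_n)))
    (partial k g (p + s *: delta_mx 0 k)).
  by move=> sg; move: (is_derive_partial k (p + s *: delta_mx 0 k) sg) => /is_derive_lineP.
have [s s01 E1] := @MVT_between R (fun t => f (x + e *: vj + t *: vi) - f (x + t *: vi)) _ 0 e
  (fun t _ => is_deriveB (dl f i (x + e *: vj) t sf) (dl f i x t sf)).
have [t t01 E2] := @MVT_between R (fun t => partial i f (x + s *: vi + t *: vj)) _ 0 e
  (fun t _ => dl _ j (x + s *: vi) t (smooth_partial i sf)).
move: s01 t01; rewrite min_l ?(ltW e0)// max_r ?(ltW e0)// => /andP[s0 s1] /andP[t0 t1].
exists (x + s *: vi + t *: vj).
  rewrite -(addrA x) [x + _]addrC addrK.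
  have dn k : `|delta_mx 0 k : 'rV[R]_n| <= 1.
    apply: rV_norm_le => // l; rewrite mxE eqxx /=; case: (_ == _); rewrite ?normr1 ?normr0//.
  rewrite (le_trans (ler_normD _ _))// !normrZ !ger0_norm// mulr2n mulrDl mul1r.
  by apply: lerD; [rewrite -[X in _ <= X]mulr1|rewrite -[X in _ <= X]mulr1]; apply: ler_pM => //; exact: dn.
move: E1 E2; rewrite !subr0 !scale0r !addr0 => E1 E2.
transitivity (f (x + e *: vj + e *: vi) - f (x + e *: vi) - (f (x + e *: vj) - f x)).
  by rewrite [x + e *: vi + e *: vj]addrAC; ring.
by rewrite E1 [x + e *: vj + _]addrAC E2; ring.
Qed.

Lemma continuous_eq_at (V : normedModType R) (a b : V -> R) (x : V) : continuous a -> continuous b ->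
    (forall e, 0 < e -> exists p q, [/\ `|p - x| <= e, `|q - x| <= e & a p = b q]) ->
  a x = b x.
Proof.
move=> ca cb H; apply/eqP; rewrite -subr_eq0 -normr_le0; apply/ler_addgt0Pl => e e0; rewrite addr0.
have e2 : 0 < e / 2 by rewrite divr_gt0.
have /cvgrPdist_le/(_ _ e2)/nbhs_normP[r1 /= r10 H1] := ca x.
have /cvgrPdist_le/(_ _ e2)/nbhs_normP[r2 /= r20 H2] := cb x.
have m0 : 0 < Num.min r1 r2 by rewrite lt_min r10.
have m1 : Num.min r1 r2 <= r1 by rewrite ge_min lexx.
have m2 : Num.min r1 r2 <= r2 by rewrite ge_min lexx orbT.
have d0 : 0 < Num.min r1 r2 / 2 by rewrite divr_gt0.
have dd : Num.min r1 r2 / 2 < Num.min r1 r2 by lra.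
have [p [q [px qx E]]] := H _ d0.
have b1 : `|a x - a p| <= e / 2.
  by apply: H1; rewrite /= distrC (le_lt_trans px)// (lt_le_trans dd).
have b2 : `|b x - b q| <= e / 2.
  by apply: H2; rewrite /= distrC (le_lt_trans qx)// (lt_le_trans dd).
have := ler_normB (a x - a p) (b x - b q).
by rewrite E in b1 *; rewrite (_ : a x - b q - (b x - b q) = a x - b x); [lra|ring].
Qed.

(** The second difference is symmetric in i and j, and it equals the squared step times either mixed
    derivative at some nearby point; continuity concludes. *)
Lemma partialC n (f : 'rV[R]_n -> R) i j : smooth f ->
  partial i (partial j f) = partial j (partial i f).
Proof.
move=> sf; apply/funext => x; apply: continuous_eq_at.
- exact: smooth_continuous (smooth_partial i (smooth_partial j sf)).
- exact: smooth_continuous (smooth_partial j (smooth_partial i sf)).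
move=> e e0; have d0 : 0 < e / 2 by rewrite divr_gt0.
have [p px pE] := mixed_difference i j x sf d0; have [q qx qE] := mixed_difference j i x sf d0.
have xE : x + (e / 2) *: delta_mx 0 i + (e / 2) *: delta_mx 0 j =
    x + (e / 2) *: delta_mx 0 j + (e / 2) *: delta_mx 0 i by exact: addrAC.
have dE : 2 * (e / 2) = e by field.
exists q, p; split; [by rewrite -dE|by rewrite -dE|].
apply: (@mulfI _ ((e / 2) ^+ 2)); first by rewrite sqrf_eq0 gt_eqF.
by apply: (etrans (esym qE)); apply: etrans pE; rewrite xE; congr (_ + _); exact: addrAC.
Qed.

Lemma det2 (M : 'M[R]_2) : \det M = M 0 0 * M 1 1 - M 0 1 * M 1 0.
Proof.
rewrite (expand_det_row _ 0) sum_ord2 /cofactor !det_mx11 !mxE /=.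
have -> : lift (0 : 'I_2) (0 : 'I_1) = 1 by exact/val_inj.
have -> : lift (1 : 'I_2) (0 : 'I_1) = 0 by exact/val_inj.
by rewrite expr0 mul1r expr1 mulN1r mulrN.
Qed.

Lemma partialD n (f g : 'rV[R]_n -> R) i : smooth f -> smooth g ->
  partial i (f \+ g) = partial i f \+ partial i g.
Proof.
move=> sf sg; apply/funext => x; apply: is_derive_val.
exact: (is_deriveD (is_derive_partial i x sf) (is_derive_partial i x sg)).
Qed.

Lemma diffeomorphism_comp n (F G : 'rV[R]_n -> 'rV[R]_n) :
  diffeomorphism F -> diffeomorphism G -> diffeomorphism (F \o G).
Proof.
move=> [sF [F' [sF' FK KF]]] [sG [G' [sG' GK KG]]]; split; first exact: smooth_map_comp.
exists (G' \o F'); split; first exact: smooth_map_comp.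
  exact: can_comp.
exact: can_comp.
Qed.

Lemma diffeomorphic_image n (F : 'rV[R]_n -> 'rV[R]_n) (A : set 'rV[R]_n) :
  diffeomorphism F -> diffeomorphic_sets (F @` A) A.
Proof.
move=> [sF [G [sG FK KF]]]; exists G; first by split => //; exists F.
apply/seteqP; split=> x /=; first by move=> [_ [y Ay <-] <-]; rewrite FK.
by move=> Ax; exists (F x); [exists x|rewrite FK].
Qed.

Lemma affine_diffeomorphism n (a : 'rV[R]_n) (c : R) : c != 0 -> diffeomorphism (fun x => a + c *: x).
Proof.
have sA b d : smooth_map (fun x : 'rV[R]_n => b + d *: x).
  move=> k; under eq_fun do rewrite !mxE.
  apply: (@smoothD R n (fun=> _) (fun z => _)); first exact: smooth_cst.
  by apply: (@smoothM R n (fun=> _) (fun z => _)); [exact: smooth_cst|exact: smooth_coord].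
move=> c0; split; first exact: sA.
exists (fun x => - (c^-1 *: a) + c^-1 *: x); split; first exact: sA.
  by move=> x; rewrite scalerDr addKr scalerA mulVf// scale1r.
by move=> x; rewrite scalerDr scalerN !scalerA mulfV// !scale1r addNKr.
Qed.

Lemma partial_elliptic_umbilic (y : 'rV[R]_2) :
  partial 0 (@elliptic_umbilic R) y = y 0 0 ^+ 2 - y 0 1 ^+ 2 /\
  partial 1 (@elliptic_umbilic R) y = - (2 * y 0 0 * y 0 1).
Proof.
have dc i k : is_derive y (delta_mx 0 i) (fun z : 'rV[R]_2 => z 0 k) (k == i)%:R.
  by have := is_derive_coord y (delta_mx 0 i) k; rewrite mxE eqxx.
have d i := is_deriveB (is_deriveZ 3^-1 (is_deriveX 3 (dc i 0))) (is_deriveM (dc i 0) (is_deriveX 2 (dc i 1))).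
have E : 3^-1 \*: (fun z : 'rV[R]_2 => z 0 0) ^+ 3 - (fun z => z 0 0) * (fun z => z 0 1) ^+ 2 =
    elliptic_umbilic_fun.
  by apply/funext => z; rewrite !fctE.
split; apply: is_derive_val.
  have := d 0; rewrite E => H; apply: (is_derive_eq H).
  by rewrite /GRing.scale/= !fctE; field.
have := d 1; rewrite E => H; apply: (is_derive_eq H).
by rewrite /GRing.scale/= !fctE; field.
Qed.

Lemma gradient_elliptic_umbilic (y : 'rV[R]_2) :
  gradient (@elliptic_umbilic R) y = vec2 (y 0 0 ^+ 2 - y 0 1 ^+ 2) (- (2 * y 0 0 * y 0 1)).
Proof.
have [p0 p1] := partial_elliptic_umbilic y.
by rewrite -[LHS]vec2_eta ![gradient _ _ 0 _]mxE p0 p1.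
Qed.

Lemma hessian_elliptic_umbilic (y : 'rV[R]_2) :
  [/\ partial 0 (partial 0 (@elliptic_umbilic R)) y = 2 * y 0 0,
      partial 1 (partial 0 (@elliptic_umbilic R)) y = - (2 * y 0 1),
      partial 0 (partial 1 (@elliptic_umbilic R)) y = - (2 * y 0 1) &
      partial 1 (partial 1 (@elliptic_umbilic R)) y = - (2 * y 0 0)].
Proof.
have -> : partial 0 (@elliptic_umbilic R) = fun y => y 0 0 ^+ 2 - y 0 1 ^+ 2.
  by apply/funext => z; rewrite (partial_elliptic_umbilic z).1.
have -> : partial 1 (@elliptic_umbilic R) = fun y => - (2 * y 0 0 * y 0 1).
  by apply/funext => z; rewrite (partial_elliptic_umbilic z).2.
have dc i k : is_derive y (delta_mx 0 i) (fun z : 'rV[R]_2 => z 0 k) (k == i)%:R.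
  by have := is_derive_coord y (delta_mx 0 i) k; rewrite mxE eqxx.
have d0 i : partial i (fun y : 'rV[R]_2 => y 0 0 ^+ 2 - y 0 1 ^+ 2) y =
    2 * y 0 0 * (0 == i)%:R - 2 * y 0 1 * (1 == i)%:R.
  apply: is_derive_val; have d := is_deriveB (is_deriveX 2 (dc i 0)) (is_deriveX 2 (dc i 1)).
  by apply: (is_derive_eq d); rewrite /GRing.scale/= !expr1 !mulr_natl.
have d1 i : partial i (fun y : 'rV[R]_2 => - (2 * y 0 0 * y 0 1)) y =
    - (2 * (y 0 0 * (1 == i)%:R + y 0 1 * (0 == i)%:R)).
  apply: is_derive_val; have d := is_deriveN (is_deriveZ 2 (is_deriveM (dc i 0) (dc i 1))).
  have := is_derive_eq d erefl; congr is_derive.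
  by apply/funext => w; rewrite -mulrA.
by rewrite !d0 !d1 /=; split; ring.
Qed.


Lemma umbilic_gradient (h : Cinfty R 2) (y : 'rV[R]_2) (g := elliptic_umbilic + h : Cinfty R 2) :
  gradient g y = vec2 (y 0 0 ^+ 2 - y 0 1 ^+ 2 + partial 0 h y) (- (2 * y 0 0 * y 0 1) + partial 1 h y).
Proof.
have sh : smooth h by exact/asboolP/cinfty_smooth.
have se : smooth (@elliptic_umbilic R) by exact/asboolP/cinfty_smooth.
have gE : (g : 'rV[R]_2 -> R) = elliptic_umbilic \+ h by [].
have [p0 p1] := partial_elliptic_umbilic y.
have GE i : gradient g y 0 i = partial i g y by rewrite mxE.
by rewrite -[LHS]vec2_eta (GE 0) (GE 1) gE (partialD 0 se sh) (partialD 1 se sh) /= p0 p1.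
Qed.

(* The functions excluded by the generic property: a perturbed umbilic of this kind has a one-point
   critical set. *)
Definition degenerate_umbilic (g : 'rV[R]_2 -> R) : Prop :=
  exists2 y0, hessian g y0 = 0 & forall y, y != y0 -> \det (hessian g y) != 0.

(* [a], [b], [c] stand for the second derivatives (0,0), (0,1), (1,1) of the perturbation. *)
Section Center.
Variables (a b c : 'rV[R]_2 -> R).

Definition umbilic_trace (y : 'rV[R]_2) : R := 2^-1 * (a y + c y).

(** In terms of e = y + [umbilic_dev y] the trace-free part of the Hessian has the form that the
    Hessian of the unperturbed umbilic has in terms of y. *)
Definition umbilic_dev (y : 'rV[R]_2) : 'rV[R]_2 := vec2 (4^-1 * (a y - c y)) (- (2^-1 * b y)).

Definition umbilic_hessian (H : 'M[R]_2) (y : 'rV[R]_2) : Prop :=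
  [/\ H 0 0 = 2 * y 0 0 + a y, H 0 1 = - (2 * y 0 1) + b y,
      H 1 0 = - (2 * y 0 1) + b y & H 1 1 = - (2 * y 0 0) + c y].

Lemma umbilic_hessianE H y (e := y + umbilic_dev y) (t := umbilic_trace y) : umbilic_hessian H y ->
  [/\ H 0 0 = t + 2 * e 0 0, H 0 1 = - (2 * e 0 1), H 1 0 = - (2 * e 0 1) & H 1 1 = t - 2 * e 0 0].
Proof.
have YE i : (y + umbilic_dev y) 0 i = y 0 i + umbilic_dev y 0 i by rewrite mxE.
move=> [-> -> -> ->]; rewrite /e /t (YE 0) (YE 1) /umbilic_trace /umbilic_dev vec2E0 vec2E1.
by split; field.
Qed.

Hypothesis aL : forall x y, `|a x - a y| <= 50^-1 * `|x - y|.
Hypothesis bL : forall x y, `|b x - b y| <= 50^-1 * `|x - y|.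
Hypothesis cL : forall x y, `|c x - c y| <= 50^-1 * `|x - y|.

Lemma umbilic_trace_lipschitz x y : `|umbilic_trace x - umbilic_trace y| <= 50^-1 * `|x - y|.
Proof.
rewrite /umbilic_trace -mulrBr normrM ger0_norm ?invr_ge0//.
have := ler_normD (a x - a y) (c x - c y).
rewrite (_ : a x - a y + (c x - c y) = a x + c x - (a y + c y)); last by ring.
have := aL x y; have := cL x y; lra.
Qed.

Lemma umbilic_dev_lipschitz x y : `|umbilic_dev x - umbilic_dev y| <= 2^-1 * `|x - y|.
Proof.
apply: rV_norm_le => [|k]; first by rewrite mulr_ge0.
have -> : (umbilic_dev x - umbilic_dev y) 0 k = umbilic_dev x 0 k - umbilic_dev y 0 k.
  by rewrite [LHS]mxE [X in _ + X]mxE.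
have n0 := normr_ge0 (x - y).
move: k; apply: ord2_case; rewrite /umbilic_dev.
  rewrite !vec2E0 -mulrBr normrM ger0_norm ?invr_ge0//.
  have := ler_normB (a x - a y) (c x - c y).
  rewrite (_ : a x - a y - (c x - c y) = a x - c x - (a y - c y)); last by ring.
  have := aL x y; have := cL x y; lra.
rewrite !vec2E1 -opprD normrN -mulrBr normrM ger0_norm ?invr_ge0//.
have := bL x y; lra.
Qed.

Lemma umbilic_center : exists y0, y0 + umbilic_dev y0 = 0.
Proof.
by apply: (@perturbed_identity_onto R 2 umbilic_dev 2^-1); [lra|lra|exact: umbilic_dev_lipschitz].
Qed.

(** If the trace T vanished at y0, then |T(y)| <= |y - y0| / 50 by the Lipschitz bound, while 2
    |e(y)| >= |y - y0|; so T^2 - 4 |e|^2 would vanish at y0 only, and g would be degenerate. *)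
Lemma umbilic_trace_neq0 (g : 'rV[R]_2 -> R) y0 : (forall y, umbilic_hessian (hessian g y) y) ->
  ~ degenerate_umbilic g -> y0 + umbilic_dev y0 = 0 -> umbilic_trace y0 != 0.
Proof.
move=> hg nd y00; apply/eqP => t0; apply: nd; exists y0.
  have [H00 H01 H10 H11] := umbilic_hessianE (hg y0).
  rewrite y00 t0 in H00 H01 H10 H11.
  have Z i : (0 : 'rV[R]_2) 0 i = 0 by rewrite mxE.
  apply/matrixP; apply: ord2_case; apply: ord2_case; rewrite [RHS]mxE ?H00 ?H01 ?H10 ?H11 Z mulr0 ?oppr0 ?addr0//.
move=> y yy0; have [H00 H01 H10 H11] := umbilic_hessianE (hg y).
rewrite det2 H00 H01 H10 H11; set e := y + _.
have tL := umbilic_trace_lipschitz y y0; rewrite t0 subr0 in tL.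
have eL : `|y - y0| <= 2 * `|e|.
  have := umbilic_dev_lipschitz y y0.
  have := ler_normB e (umbilic_dev y - umbilic_dev y0).
  have -> : e - (umbilic_dev y - umbilic_dev y0) = y - y0.
    by rewrite /e opprB -(subr0 y) -{1}y00 opprD !addrA; apply/rowP => i; rewrite !mxE; ring.
  by move: `|y - y0| `|e| `|umbilic_dev y - _| => ? ? ?; lra.
have n0 : 0 < `|y - y0| by rewrite normr_gt0 subr_eq0.
have [i ei] : exists i, `|e| <= `|e 0 i|.
  have [H|H] := lerP `|e 0 0| `|e 0 1|; [exists 1|exists 0]; apply: rV_norm_le => //.
    by apply: ord2_case.
  by apply: ord2_case => //; exact: ltW.
apply/eqP => D.
have D' : umbilic_trace y ^+ 2 = 4 * (e 0 0 ^+ 2 + e 0 1 ^+ 2).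
  by apply/eqP; rewrite -subr_eq0 -D; apply/eqP; ring.
have e2 : `|y - y0| ^+ 2 <= 4 * (e 0 0 ^+ 2 + e 0 1 ^+ 2).
  have le : `|y - y0| <= 2 * `|e 0 i| by rewrite (le_trans eL)// ler_wpM2l.
  have : `|y - y0| ^+ 2 <= (2 * `|e 0 i|) ^+ 2 by rewrite ler_pXn2r ?nnegrE ?mulr_ge0.
  rewrite exprMn real_normK ?num_real//.
  have := sqr_ge0 (e 0 0); have := sqr_ge0 (e 0 1).
  by move: i {ei le}; apply: ord2_case; move: (`|y - y0| ^+ 2) (e 0 0 ^+ 2) (e 0 1 ^+ 2) => ? ? ?; lra.
have : `|umbilic_trace y| ^+ 2 <= (50^-1 * `|y - y0|) ^+ 2.
  by rewrite ler_pXn2r// nnegrE.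
rewrite real_normK ?num_real// D' => H; have {H} := le_trans e2 H.
rewrite exprMn; have : 0 < `|y - y0| ^+ 2 by rewrite exprn_gt0.
by move: (`|y - y0| ^+ 2) => n; rewrite expr2; lra.
Qed.

End Center.
End UmbilicPerturbation.

(** * Caustics of small perturbations *)

Section CausticOfPerturbation.
Context {R : realType}.

(** The hypotheses on p say that the full Hessian at the center is e times the identity; eliminating
    [p0], [p1] and [cp] extracts the factor e from every entry. *)
Lemma rescaled_hessian (p0 p1 e z0 z1 ap bp cp ay b_y cy : R) : e != 0 ->
    p0 + 4^-1 * (ap - cp) = 0 -> p1 - 2^-1 * bp = 0 -> 2^-1 * (ap + cp) = e ->
  let t := 1 + 2^-1 * ((ay - ap) / e + (cy - cp) / e) in
  let d0 := z0 + 4^-1 * ((ay - ap) / e - (cy - cp) / e) in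
  let d1 := z1 - 2^-1 * ((b_y - bp) / e) in
  [/\ 2 * (p0 + e * z0) + ay = e * (t + 2 * d0), - (2 * (p1 + e * z1)) + b_y = - (2 * (e * d1)) &
      - (2 * (p0 + e * z0)) + cy = e * (t - 2 * d0)].
Proof.
move=> e0 h0 h1 h2; have -> : p0 = - (4^-1 * (ap - cp)) by lra.
have -> : p1 = 2^-1 * bp by lra.
have -> : cp = 2 * e - ap by lra.
by split; field.
Qed.

Section OnePerturbation.
Variables (g a b c : 'rV[R]_2 -> R) (r : 'I_2 -> 'rV[R]_2 -> R) (p : 'rV[R]_2) (e : R).
Hypotheses (gh : forall y, umbilic_hessian a b c (hessian g y) y).
Hypothesis gg : forall y, gradient g y = vec2 (y 0 0 ^+ 2 - y 0 1 ^+ 2 + r 0 y) (- (2 * y 0 0 * y 0 1) + r 1 y).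
Hypotheses (e0 : e != 0) (pc : p + umbilic_dev a b c p = 0) (pt : umbilic_trace a c p = e).
Variables (u : 'I_2 -> 'I_2 -> option nat -> 'rV[R]_2 -> R) (rho : 'I_2 -> option nat -> 'rV[R]_2 -> R).
Variable m : nat.
Hypotheses (ua : forall z, u 0 0 (Some m) z = (a (p + e *: z) - a p) / e).
Hypotheses (ub : forall z, u 0 1 (Some m) z = (b (p + e *: z) - b p) / e).
Hypotheses (uc : forall z, u 1 1 (Some m) z = (c (p + e *: z) - c p) / e).
Hypotheses (r0 : forall z, rho 0 (Some m) z =
  (r 0 (p + e *: z) - r 0 p - e * (z 0 0 * a p + z 0 1 * b p)) / e ^+ 2).
Hypotheses (r1 : forall z, rho 1 (Some m) z =
  (r 1 (p + e *: z) - r 1 p - e * (z 0 0 * b p + z 0 1 * c p)) / e ^+ 2).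

Let YE z i : (p + e *: z) 0 i = p 0 i + e * z 0 i.
Proof. by rewrite !mxE. Qed.

Let p0 : p 0 0 + 4^-1 * (a p - c p) = 0.
Proof.
by have := congr1 (fun v : 'rV[R]_2 => v 0 0) pc; rewrite mxE [RHS]mxE /umbilic_dev vec2E0.
Qed.

Let p1 : p 0 1 - 2^-1 * b p = 0.
Proof.
by have := congr1 (fun v : 'rV[R]_2 => v 0 1) pc; rewrite mxE [RHS]mxE /umbilic_dev vec2E1.
Qed.

Lemma rescaled_critical z : \det (hessian g (p + e *: z)) = 0 <-> pert_critical u (Some m) z.
Proof.
have [H00 H01 H10 H11] := gh (p + e *: z); rewrite !YE in H00 H01 H10 H11.
have [E0 E1 E2] := rescaled_hessian (z 0 0) (z 0 1) (a (p + e *: z)) (b (p + e *: z)) (c (p + e *: z)) e0 p0 p1 pt.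
rewrite det2 H00 H01 H10 H11 E0 E1 E2 -ua -ub -uc -/(pert_trace u (Some m) z).
rewrite /pert_critical /= /pert_dev vec2E0 vec2E1.
set t := pert_trace _ _ _; set d0 := _ + 4^-1 * _; set d1 := _ - 2^-1 * _.
have -> : e * (t + 2 * d0) * (e * (t - 2 * d0)) - - (2 * (e * d1)) * - (2 * (e * d1)) =
  e ^+ 2 * (t ^+ 2 - 4 * (d0 ^+ 2 + d1 ^+ 2)) by ring.
split=> [/eqP|->]; last by rewrite subrr mulr0.
by rewrite mulf_eq0 sqrf_eq0 (negbTE e0) /= subr_eq0 => /eqP.
Qed.

(** At p the Hessian is e times the identity, so the linear term of the gradient at p + e z is e^2
    z, of the same order as the quadratic terms and the remainder: hence one common factor e^2. *)
Lemma rescaled_gradient z :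
  gradient g (p + e *: z) = gradient g p + (e ^+ 2 / 4) *: pert_map rho (Some m) z.
Proof.
rewrite !gg !YE /pert_map r0 r1 -[RHS]vec2_eta.
have VE (v w : 'rV[R]_2) k i : (v + k *: w) 0 i = v 0 i + k * w 0 i by rewrite !mxE.
rewrite !VE !vec2E0 !vec2E1.
have -> : a p = 2 * e - c p by move: pt; rewrite /umbilic_trace; lra.
have -> : p 0 0 = - (4^-1 * (2 * e - c p - c p)) by move: p0 pt; rewrite /umbilic_trace; lra.
have -> : p 0 1 = 2^-1 * b p by move: p1; lra.
by congr vec2; field.
Qed.

Lemma rescaled_caustic :
  caustic g = (fun x => gradient g p + (e ^+ 2 / 4) *: x) @` (pert_map rho (Some m) @` pert_critical u (Some m)).
Proof.
apply/seteqP; split=> x /=; rewrite /caustic /=.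
  move=> [y yc <-]; pose z := e^-1 *: (y - p).
  have yE : y = p + e *: z by rewrite scalerA mulfV// scale1r addrC subrK.
  exists (pert_map rho (Some m) z); last by rewrite -rescaled_gradient -yE.
  by exists z => //; apply/rescaled_critical; rewrite -yE.
move=> [_ [z zc <-] <-]; exists (p + e *: z); first exact/rescaled_critical.
exact: rescaled_gradient.
Qed.

End OnePerturbation.

Lemma Cinfty_is_smooth n (f : Cinfty R n) : smooth f.
Proof. exact/asboolP/cinfty_smooth. Qed.

Lemma umbilic_hessian_perturbation (h : Cinfty R 2) y :
  umbilic_hessian (partial 0 (partial 0 h)) (partial 0 (partial 1 h)) (partial 1 (partial 1 h))
    (hessian (elliptic_umbilic + h : Cinfty R 2) y) y.
Proof.
have sh := Cinfty_is_smooth h; have se := Cinfty_is_smooth (@elliptic_umbilic R).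
have gE : (elliptic_umbilic + h : Cinfty R 2) = elliptic_umbilic \+ h :> ('rV[R]_2 -> R) by [].
have pE i k : hessian (elliptic_umbilic + h : Cinfty R 2) y i k =
    partial i (partial k (@elliptic_umbilic R)) y + partial i (partial k h) y.
  rewrite mxE gE (partialD k se sh).
  by rewrite (partialD i (smooth_partial k se) (smooth_partial k sh)).
have [e00 e10 e01 e11] := hessian_elliptic_umbilic y.
have hC : partial 1 (partial 0 h) = partial 0 (partial 1 h) := partialC 1 0 sh.
by split; rewrite pE ?e00 ?e01 ?e10 ?e11 ?hC.
Qed.

(** The bound on third derivatives makes the second ones Lipschitz with constant 2/100: this is the
    1/50 required for the center and lies below the 1/20 of the rescaled problem. The bound on
    second derivatives gives |e m| <= 1. *)
Lemma small_perturbation_caustic (h : nat -> Cinfty R 2) (eta : nat -> R) :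
    (forall m i j k y, `|partial i (partial j (partial k (h m))) y| <= 100^-1) ->
    (forall m i j y, `|partial i (partial j (h m)) y| <= 1) ->
    eta @ \oo --> 0 -> (forall m, 0 <= eta m) -> uniformly_small eta (fun m => h m : 'rV[R]_2 -> R) ->
    (forall m, ~ degenerate_umbilic (elliptic_umbilic + h m : Cinfty R 2)) ->
  exists m, diffeomorphic_sets (caustic (elliptic_umbilic + h m : Cinfty R 2)) tricuspoid.
Proof.
move=> h3 h2 eta0 etap hu nd.
pose D i k m := partial i (partial k (h m)).
have D2 m i k y : `|D i k m y| <= 1 := h2 m i k y.
have D3 m l i k y : `|partial l (D i k m) y| <= 100^-1 := h3 m l i k y.
have sE m k : smooth (partial k (h m)) := smooth_partial k (Cinfty_is_smooth (h m)).
have sD m i k : smooth (D i k m) := smooth_partial i (sE m k).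
have uE k : uniformly_small eta (fun m => partial k (h m)) := uniformly_small_partial k hu.
have uD i k : uniformly_small eta (D i k) := uniformly_small_partial i (uE k).
have DC m : D 1 0 m = D 0 1 m := partialC 1 0 (Cinfty_is_smooth (h m)).
have hess m y : umbilic_hessian (D 0 0 m) (D 0 1 m) (D 1 1 m) (hessian (elliptic_umbilic + h m : Cinfty R 2) y) y.
  exact: umbilic_hessian_perturbation.
have DL m i k x y : `|D i k m x - D i k m y| <= 50^-1 * `|x - y|.
  have := @partials_lipschitz R 2 _ 100^-1 y x (sD m i k) (fun l t _ => D3 m l i k _).
  by rewrite (_ : 2%:R * 100^-1 = 50^-1)//; field.
pose E k m := partial k (h m).
have sE' m k : smooth (E k m) := sE m k.
have uE' k : uniformly_small eta (E k) := uE k.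
have pE i k : (fun m => partial i (E k m)) = D i k by [].
have pE' i k m : partial i (E k m) = D i k m by [].
have grad m y : gradient (elliptic_umbilic + h m : Cinfty R 2) y =
    vec2 (y 0 0 ^+ 2 - y 0 1 ^+ 2 + E 0 m y) (- (2 * y 0 0 * y 0 1) + E 1 m y) := umbilic_gradient (h m) y.
clearbody E; clearbody D.
clear h3 h2 sE uE.
have /choice[p pP] m := umbilic_center (DL m 0 0) (DL m 0 1) (DL m 1 1).
pose e m := umbilic_trace (D 0 0 m) (D 1 1 m) (p m).
have e0 m : e m != 0 := umbilic_trace_neq0 (DL m 0 0) (DL m 0 1) (DL m 1 1) (hess m) (nd m) (pP m).
have e1 m : `|e m| <= 1.
  rewrite /e /umbilic_trace normrM ger0_norm ?invr_ge0//.
  have := ler_normD (D 0 0 m (p m)) (D 1 1 m (p m)); have := D2 m 0 0 (p m); have := D2 m 1 1 (p m); lra.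
pose u i k := rescaled1 e p (D i k); pose rho k := rescaled2 e p (E k).
have [|||||||m [F dF FE]] := @perturbed_deltoid_exists R u rho.
- by move=> i k; exact: (rescaled1_smooth p eta0 e1 e0 (uD i k)).
- by move=> k; exact: (rescaled2_smooth p eta0 etap e1 e0 (uE' k)).
- by [].
- by [].
- by rewrite /u; congr rescaled1; apply/funext.
- by move=> m i k; rewrite /rho (rescaled2_partial p e0 i (sE' m k)) pE.
- move=> m i k z; have := rescaled1_bound p e0 z (sD m i k) (fun l y => D3 m l i k y).
  move=> H; rewrite (le_trans H)// ler_wpM2r//; lra.
exists m.
have lE k z : lin_form (fun i => partial i (E k m) (p m)) z = z 0 0 * D 0 k m (p m) + z 0 1 * D 1 k m (p m).
  by rewrite /lin_form sum_ord2 !pE'.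
rewrite (@rescaled_caustic _ (D 0 0 m) (D 0 1 m) (D 1 1 m) (fun k => E k m) (p m) (e m) (hess m) (grad m) (e0 m)
  (pP m) erefl u rho m)//.
- rewrite FE; set Aff := fun x => _ + _ *: x.
  have -> : Aff @` (F @` tricuspoid) = (Aff \o F) @` tricuspoid by rewrite image_comp.
  apply: diffeomorphic_image; apply: diffeomorphism_comp => //; apply: affine_diffeomorphism.
  by rewrite mulf_neq0 ?sqrf_eq0 ?e0 ?invr_eq0// expf_neq0.
- by move=> z; rewrite /rho /rescaled2 lE DC.
- by move=> z; rewrite /rho /rescaled2 lE.
Qed.

End CausticOfPerturbation.

(** * Genericity *)

Section Genericity.
Context {R : realType}.

Lemma jac_id n (x : 'rV[R]_n) : jac id x = 1%:M.
Proof.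
apply/matrixP => i j; rewrite !mxE.
have d := is_derive_coord x (delta_mx 0 i) j; rewrite mxE eqxx [j == i]eq_sym in d.
exact: is_derive_val d.
Qed.

Lemma jac_det_neq0 n (F G : 'rV[R]_n -> 'rV[R]_n) x : smooth_map F -> smooth_map G -> cancel F G ->
  \det (jac F x) != 0.
Proof.
move=> sF sG FK; have := jac_comp x sG sF.
have -> : G \o F = id by apply/funext.
rewrite jac_id => /(congr1 determinant); rewrite det1 det_mulmx => /esym E.
by apply/eqP => D; move: E; rewrite D mul0r => /eqP; rewrite eq_sym oner_eq0.
Qed.

Lemma jac_gradient n (g : 'rV[R]_n -> R) y : jac (gradient g) y = hessian g y.
Proof.
apply/matrixP => i j; rewrite !mxE; congr (partial i _ y).
by apply/funext => z; rewrite mxE.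
Qed.

Lemma smooth_gradient n (g : 'rV[R]_n -> R) : smooth g -> smooth_map (gradient g).
Proof. by move=> sg j; under eq_fun do rewrite mxE; exact: smooth_partial. Qed.

Lemma smooth_graph_map n (g : 'rV[R]_n -> R) (F : 'rV[R]_(n + n) -> 'rV[R]_(n + n)) :
  smooth g -> smooth_map F -> smooth_map (fun y => lsubmx (F (row_mx y (gradient g y)))).
Proof.
move=> sg sF k; under eq_fun do rewrite mxE.
apply: (@smooth_comp R n (n + n) (fun x => F x 0 (lshift n k)) (fun y => row_mx y (gradient g y))) => // j.
case: (split_ordP j) => l ->.
- by under eq_fun do rewrite row_mxEl; exact: smooth_coord.
- by under eq_fun do rewrite row_mxEr; exact: smooth_gradient.
Qed.

(* Along a Lagrangian equivalence [Phi], the fibre component of the image of the graph point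
   over [y] is a diffeomorphism [psi], and [phi \o gradient g = gradient h \o psi]. *)
Lemma lagrangian_equivalent_hessian n (g h : 'rV[R]_n -> R) : smooth g -> smooth h ->
    lagrangian_equivalent g h ->
  exists2 psi : 'rV[R]_n -> 'rV[R]_n, bijective psi & forall y, exists A B : 'M[R]_n,
    [/\ \det A != 0, \det B != 0 & hessian g y *m A = B *m hessian h (psi y)].
Proof.
move=> sg sh [Phi [[sP [Psi [sPi PK KP]]] _ [phi [sphi [phi' [sphi' phiK _]]] Pf] Pg]].
pose psi y := lsubmx (Phi (row_mx y (gradient g y))).
pose psi' y := lsubmx (Psi (row_mx y (gradient h y))).
have spsi : smooth_map psi := smooth_graph_map sg sP.
have spsi' : smooth_map psi' := smooth_graph_map sh sPi.
have E y : Phi (row_mx y (gradient g y)) = row_mx (psi y) (gradient h (psi y)).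
  have : lagrangian_graph h (Phi (row_mx y (gradient g y))) by rewrite -Pg; exists (row_mx y (gradient g y)) => //; exists y.
  by move=> [z _ zE]; rewrite /psi -zE row_mxKl.
have E' y : Psi (row_mx y (gradient h y)) = row_mx (psi' y) (gradient g (psi' y)).
  have : lagrangian_graph h (row_mx y (gradient h y)) by exists y.
  rewrite -Pg => -[_ [z _ <-] zE]; rewrite /psi' -zE PK row_mxKl //.
have psiK : cancel psi psi' by move=> y; rewrite /psi' -E PK row_mxKl.
have psiK' : cancel psi' psi by move=> y; rewrite /psi -E' KP row_mxKl.
have Eg : phi \o gradient g = gradient h \o psi.
  by apply/funext => y /=; have := Pf (row_mx y (gradient g y)); rewrite row_mxKr E row_mxKr.
exists psi; first by exists psi'.
move=> y; exists (jac phi (gradient g y)), (jac psi y); split.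
- exact: jac_det_neq0 sphi sphi' phiK.
- exact: jac_det_neq0 spsi spsi' psiK.
have := congr1 (fun F => jac F y) Eg.
rewrite (jac_comp y sphi (smooth_gradient sg)) (jac_comp y (smooth_gradient sh) spsi).
by rewrite !jac_gradient.
Qed.

Lemma det_neq0_unit n (A : 'M[R]_n) : \det A != 0 -> A \in unitmx.
Proof. by move=> A0; rewrite unitmxE unitfE. Qed.

Lemma degenerate_umbilic_equivalent (g h : 'rV[R]_2 -> R) : smooth g -> smooth h ->
  lagrangian_equivalent g h -> degenerate_umbilic h -> degenerate_umbilic g.
Proof.
move=> sg sh /(lagrangian_equivalent_hessian sg sh)[psi [psi' psiK psiK'] H] [z0 hz0 hz].
exists (psi' z0).
  have [A [B [A0 B0 AB]]] := H (psi' z0); move: AB; rewrite psiK' hz0 mulmx0.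
  move=> /(congr1 (fun M => M *m invmx A)); rewrite mulmxK ?mul0mx//; exact: det_neq0_unit.
move=> y yz; have [A [B [A0 B0 AB]]] := H y.
have : \det (hessian h (psi y)) != 0.
  by apply: hz; apply: contra_neq yz => <-; rewrite psiK.
move/(congr1 determinant): AB; rewrite !det_mulmx => AB D.
apply: contra_neq (mulf_neq0 B0 D) => E.
by rewrite -AB E mul0r.
Qed.

Lemma hessian_det_continuous (g : 'rV[R]_2 -> R) : smooth g -> continuous (fun y => \det (hessian g y)).
Proof.
move=> sg; have sp i j : continuous (partial i (partial j g)).
  exact: smooth_continuous (smooth_partial i (smooth_partial j sg)).
have -> : (fun y => \det (hessian g y)) = (fun y => partial 0 (partial 0 g) y * partial 1 (partial 1 g) y -
    partial 0 (partial 1 g) y * partial 1 (partial 0 g) y).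
  by apply/funext => y; rewrite det2 !mxE.
move: (sp 0 0) (sp 1 1) (sp 0 1) (sp 1 0).
move: (partial 0 _) (partial 1 _) (partial 0 (partial 1 g)) (partial 1 (partial 0 g)) => a b c d sa sb sc sd.
move=> y; apply: (@continuousB R _ _ (fun y => a y * b y) (fun y => c y * d y)).
  exact: (@continuousM R _ a b y (sa y) (sb y)).
exact: (@continuousM R _ c d y (sc y) (sd y)).
Qed.

Lemma segment_zero (d : 'rV[R]_2 -> R) (a b : 'rV[R]_2) : continuous d -> 0 < d a -> d b < 0 ->
  exists2 t, 0 <= t <= 1 & d (a + t *: (b - a)) = 0.
Proof.
move=> cd da db; have cl : continuous (fun t : R => d (a + t *: (b - a))).
  move=> t; apply: (@continuous_comp _ _ _ (fun t : R => a + t *: (b - a)) d); last exact: cd.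
  by apply: cvgD; [exact: cvg_cst|apply: cvgZr_tmp; exact: cvg_id].
have [|||t tI t0] := @IVT R (fun t => d (a + t *: (b - a))) 0 1 0.
- exact: ler01.
- by apply: continuous_subspaceT => x; exact: cl.
- rewrite scale0r addr0 scale1r [a + _]addrC subrK.
  by rewrite ge_min le_max (ltW da) (ltW db) orbT.
by exists t => //; rewrite in_itv/= in tI.
Qed.

(* The plane minus a point is connected. *)
Lemma sign_off_point (d : 'rV[R]_2 -> R) (y0 a b : 'rV[R]_2) : continuous d -> d y0 = 0 ->
  (forall x, d x = 0 -> x = y0) -> 0 < d a -> d b < 0 -> False.
Proof.
move=> cd d0 only da db.
have [t t01 /only tE] := segment_zero cd da db.
(* A detour point on the perpendicular to b - a through y0. The segments from a to w and from w to b
   avoid y0, and whatever the sign of [d w], a zero other than y0 appears on one of them. *)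
pose w : 'rV[R]_2 := y0 + vec2 (- (b - a) 0 1) ((b - a) 0 0).
have ab : a != b by apply/eqP => E; move: da db; rewrite E => /ltW; rewrite leNgt => /negbTE->.
have sq0 : (b - a) 0 0 ^+ 2 + (b - a) 0 1 ^+ 2 != 0.
  apply: contra_neq ab => /eqP; rewrite paddr_eq0 ?sqr_ge0// !sqrf_eq0 => /andP[/eqP E0 /eqP E1].
  by apply/eqP; rewrite eq_sym -subr_eq0 -(vec2_eta (b - a)) E0 E1; apply/eqP/rowP => i; rewrite !mxE if_same.
have nw (s k : R) (x : 'rV[R]_2) : x = y0 + k *: (b - a) -> k != 0 -> x + s *: (w - x) = y0 -> False.
  move=> -> k0 E.
  have C i := congr1 (fun v : 'rV[R]_2 => v 0 i) E.
  have := C 0; have := C 1; rewrite /w !mxE /= -!/(vec2 _ _ 0 _).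
  move: sq0; rewrite !mxE; move: (b 0 0 - a 0 0) (b 0 1 - a 0 1) (y0 0 0) (y0 0 1) => v0 v1 e0 e1 sq0 E1 E0.
  have F0 : (1 - s) * k * v0 - s * v1 = 0 by move: E0; lra.
  have F1 : (1 - s) * k * v1 + s * v0 = 0 by move: E1; lra.
  have /eqP : s * (v0 ^+ 2 + v1 ^+ 2) = 0.
    transitivity (v0 * ((1 - s) * k * v1 + s * v0) - v1 * ((1 - s) * k * v0 - s * v1)); first by ring.
    by rewrite F0 F1 !mulr0 subrr.
  rewrite mulf_eq0 (negbTE sq0) orbF => /eqP s0.
  have /eqP : k * (v0 ^+ 2 + v1 ^+ 2) = 0.
    transitivity (v0 * ((1 - s) * k * v0 - s * v1) + v1 * ((1 - s) * k * v1 + s * v0)).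
      by rewrite s0; ring.
    by rewrite F0 F1 !mulr0 addr0.
  by rewrite mulf_eq0 (negbTE sq0) orbF (negbTE k0).
have aE : a = y0 + (- t) *: (b - a) by rewrite -tE scaleNr addrK.
have bE : b = y0 + (1 - t) *: (b - a).
  by rewrite -tE scalerBl scale1r addrA addrAC addrK addrC subrK.
have t0 : - t != 0.
  by apply: contra_neq (lt0r_neq0 da) => tz; rewrite aE tz scale0r addr0.
have t1 : 1 - t != 0.
  by apply: contra_neq (ltr0_neq0 db) => tz; rewrite bE tz scale0r addr0.
have [dw|dw|/only wy] := ltrgtP (d w) 0.
- by have [s _ /only] := segment_zero cd da dw; exact: nw aE t0.
- have [s _ /only sE] := segment_zero cd dw db.
  apply: (nw (1 - s) _ _ bE t1); rewrite -sE.
  by apply/rowP => i; rewrite !mxE; ring.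
- move: sq0; have E : vec2 (- (b - a) 0 1) ((b - a) 0 0) = 0 :> 'rV[R]_2.
    by apply: (@addrI _ y0); rewrite addr0.
  have := congr1 (fun v : 'rV[R]_2 => v 0 0) E; have := congr1 (fun v : 'rV[R]_2 => v 0 1) E.
  rewrite vec2E0 vec2E1 [RHS]mxE => ->; rewrite [RHS]mxE => /eqP; rewrite oppr_eq0 => /eqP ->.
  by rewrite expr0n addr0 eqxx.
Qed.

Lemma degenerate_umbilic_no_sign_change (g : 'rV[R]_2 -> R) (a b : 'rV[R]_2) : smooth g ->
  degenerate_umbilic g -> 0 < \det (hessian g a) -> \det (hessian g b) < 0 -> False.
Proof.
move=> sg [y0 g0 gn]; apply: (sign_off_point (y0 := y0) (hessian_det_continuous sg)).
  by rewrite g0 det0.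
by move=> x dx; apply/eqP; apply: contraT => /gn; rewrite dx eqxx.
Qed.

(** * Removal of degenerate functions by a bump *)

Lemma iter_partial_local n (f g : 'rV[R]_n -> R) (D : set 'rV[R]_n) s : open D ->
  (forall x, D x -> f x = g x) -> forall x, D x -> iter_partial s f x = iter_partial s g x.
Proof.
move=> oD fg; elim: s => //= i s IH x Dx; rewrite /partial.
apply: near_eq_derive; have : nbhs x D by exact: open_nbhs_nbhs.
exact: filterS.
Qed.

Lemma smooth_iter_partial n (f : 'rV[R]_n -> R) s : smooth f -> smooth (iter_partial s f).
Proof. by move=> sf; elim: s => [|i s IH]; [exact: sf|exact: (smooth_partial i IH)]. Qed.

Lemma iter_partialD n (f g : 'rV[R]_n -> R) s : smooth f -> smooth g ->
  iter_partial s (f \+ g) = iter_partial s f \+ iter_partial s g.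
Proof.
by move=> sf sg; elim: s => //= i s ->; apply: partialD; exact: smooth_iter_partial.
Qed.

Definition bump_quadratic (a b : R) (p y : 'rV[R]_2) : R :=
  cutoff (y - p) * (2^-1 * (a * (y - p) 0 0 ^+ 2 + b * (y - p) 0 1 ^+ 2)).

Lemma smooth_shifted_coord (p : 'rV[R]_2) i : smooth (fun y : 'rV[R]_2 => (y - p) 0 i).
Proof.
under eq_fun do rewrite !mxE.
by apply: (@smoothD R 2 (fun y => _) (fun=> _)); [exact: smooth_coord|exact: smooth_cst].
Qed.

Lemma smooth_bump_quadratic a b p : smooth (bump_quadratic a b p).
Proof.
have sc i := smooth_shifted_coord p i.
have s2 i : smooth (fun y : 'rV[R]_2 => (y - p) 0 i ^+ 2) by exact: (smoothM (sc i) (sc i)).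
apply: (@smoothM R 2 (fun y => _) (fun y => _)).
  by apply: (@smooth_comp R 2 2 cutoff (fun y => y - p) (@smooth_cutoff R)) => k; exact: sc.
apply: (@smoothM R 2 (fun=> _) (fun y => _)); first exact: smooth_cst.
apply: (@smoothD R 2 (fun y => _) (fun y => _)).
  by apply: (@smoothM R 2 (fun=> _) (fun y => _)); [exact: smooth_cst|exact: s2].
by apply: (@smoothM R 2 (fun=> _) (fun y => _)); [exact: smooth_cst|exact: s2].
Qed.

Lemma open_coord_lt (p : 'rV[R]_2) (r : R) : open [set y : 'rV[R]_2 | forall i, `|(y - p) 0 i| < r].
Proof.
have -> : [set y : 'rV[R]_2 | forall i, `|(y - p) 0 i| < r] =
   [set y | `|(y - p) 0 0| < r] `&` [set y | `|(y - p) 0 1| < r].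
  by apply/seteqP; split=> y /=; [split|move=> [? ?]; exact: ord2_case].
have c i := smooth_continuous (smooth_shifted_coord p i).
have o i : open [set y : 'rV[R]_2 | `|(y - p) 0 i| < r].
  apply: (@open_comp _ _ (fun y : 'rV[R]_2 => (y - p) 0 i) [set v | `|v| < r]) => [v _|].
    exact: c.
  exact: (@open_norm_lt R r).
exact: openI.
Qed.

Lemma open_coord_gt (p : 'rV[R]_2) (r : R) i : open [set y : 'rV[R]_2 | r < `|(y - p) 0 i|].
Proof.
apply: (@open_comp _ _ (fun y : 'rV[R]_2 => (y - p) 0 i) [set v | r < `|v|]) => [v _|].
  exact: (smooth_continuous (smooth_shifted_coord p i)).
exact: (@open_norm_gt R r).
Qed.

Lemma bump_quadratic_far a b (p y : 'rV[R]_2) (t : seq 'I_2) i : 2 < `|(y - p) 0 i| -> iter_partial t (bump_quadratic a b p) y = 0.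
Proof.
move=> yp; rewrite (@iter_partial_local 2 _ (fun=> 0) _ t (@open_coord_gt p 2 i) _ y yp) ?iter_partial0//.
by move=> x /= /ltW/cutoff0 xp; rewrite /bump_quadratic xp mul0r.
Qed.

Lemma bump_quadratic_center a b p : hessian (bump_quadratic a b p) p =
  \matrix_(i, j) (if i == j then if i == 0 then a else b else 0).
Proof.
have dc i k y : is_derive y (delta_mx 0 i) (fun z : 'rV[R]_2 => (z - p) 0 k) (k == i)%:R.
  have -> : (fun z : 'rV[R]_2 => (z - p) 0 k) = (fun z => z 0 k) - cst (p 0 k).
    by apply/funext => z; rewrite !mxE.
  have := is_deriveB (is_derive_coord y (delta_mx 0 i) k) (is_derive_cst (p 0 k) y (delta_mx 0 i)).
  by rewrite subr0 mxE eqxx.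
pose Q (y : 'rV[R]_2) := 2^-1 * (a * (y - p) 0 0 ^+ 2 + b * (y - p) 0 1 ^+ 2).
have dQ i y : partial i Q y = a * ((y - p) 0 0 * (0 == i)%:R) + b * ((y - p) 0 1 * (1 == i)%:R).
  apply: is_derive_val.
  have d := is_deriveZ 2^-1 (is_deriveD (is_deriveZ a (is_deriveX 2 (dc i 0 y))) (is_deriveZ b (is_deriveX 2 (dc i 1 y)))).
  by apply: (is_derive_eq d); rewrite /GRing.scale/= !expr1; field.
have ddQ i j y : partial i (partial j Q) y = a * ((0 == i)%:R * (0 == j)%:R) + b * ((1 == i)%:R * (1 == j)%:R).
  have -> : partial j Q = fun y => a * (0 == j)%:R * (y - p) 0 0 + b * (1 == j)%:R * (y - p) 0 1.
    by apply/funext => z; rewrite dQ; ring.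
  apply: is_derive_val.
  have d := is_deriveD (is_deriveZ (a * (0 == j)%:R) (dc i 0 y)) (is_deriveZ (b * (1 == j)%:R) (dc i 1 y)).
  by apply: (is_derive_eq d); rewrite /GRing.scale/=; ring.
have pp : [set y : 'rV[R]_2 | forall i, `|(y - p) 0 i| < 1] p.
  by move=> i; rewrite subrr mxE normr0.
apply/matrixP => i j; rewrite [LHS]mxE [RHS]mxE.
have -> : partial i (partial j (bump_quadratic a b p)) p = partial i (partial j Q) p.
  have L := @iter_partial_local 2 (bump_quadratic a b p) Q _ [:: i; j] (@open_coord_lt p 1) _ p pp.
  apply: L => x xp.
  by rewrite /bump_quadratic cutoff1 ?mul1r// => k; exact/ltW/xp.
rewrite ddQ; move: i; apply: ord2_case; move: j; apply: ord2_case => /=; ring.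
Qed.

(** The Hessian of g vanishes at p, so with the bump its determinant at p is s e^2. At q, outside
    the support, the determinant is unchanged and nonzero; s is chosen to give the opposite sign at
    p. *)
Lemma bump_perturbation (g : Cinfty R 2) (O : set (Cinfty R 2)) : degenerate_umbilic g -> open O -> O g ->
  exists2 h : Cinfty R 2, O h & exists a b, 0 < \det (hessian h a) /\ \det (hessian h b) < 0.
Proof.
move=> [p gp gn] oO Og; have sg := Cinfty_is_smooth g.
have [k [delta [cd d0 dO]]] := oO g Og.
have [q [qp q3]] : exists q : 'rV[R]_2, q != p /\ 2 < `|(q - p) 0 0|.
  have E : (p + vec2 3 0 - p) 0 0 = 3 :> R by rewrite [p + _]addrC addrK vec2E0.
  exists (p + vec2 3 0); split; last by rewrite E ger0_norm//; lra.
  by apply/eqP => qp; move: E; rewrite qp subrr mxE => /eqP; rewrite eq_sym pnatr_eq0.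
have dq := gn q qp.
have [s sq] : exists s : R, s = 1 /\ \det (hessian g q) < 0 \/ s = -1 /\ 0 < \det (hessian g q).
  by move: dq; rewrite neq_lt => /orP[dq|dq]; [exists 1; left|exists (-1); right].
pose r := `|p| + 2.
have far a b (y : 'rV[R]_2) : ~ (forall i, `|y 0 i| <= r) -> forall t, iter_partial t (bump_quadratic a b p) y = 0.
  move=> /existsNP[i /negP]; rewrite -ltNge => yr t; apply: (@bump_quadratic_far a b p y t i).
  have -> : (y - p) 0 i = y 0 i - p 0 i by rewrite !mxE.
  have := ler_normD (y 0 i - p 0 i) (p 0 i); rewrite subrK.
  have := coord_le_norm p i; move: yr; rewrite /r; lra.
(* The error function has a positive minimum on a box containing the support; outside it the bump
   and its derivatives are 0, however fast the error function decays. *)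
have [c c0 cdelta] : exists2 c, 0 < c & forall y : 'rV[R]_2, (forall i, `|y 0 i| <= r) -> c <= delta y.
  have cK : compact [set y : 'rV[R]_2 | forall i, [set t | `|t| <= r] (y ord0 i)].
    apply: (@rV_compact _ 2 (fun=> [set t | `|t| <= r])) => _.
    rewrite (_ : [set t | _] = `[- r, r]%classic); first exact: segment_compact.
    by apply/seteqP; split=> t /=; rewrite in_itv/= ler_norml.
  have [|c _ cP] := @EVT_min_rV R 2 delta _ _ cK (continuous_subspaceT cd).
    by exists 0 => i /=; rewrite mxE normr0 addr_ge0.
  by exists (delta c) => // y yr; apply: cP; rewrite inE.
pose e (j : option nat) : R := if j is Some m then m.+1%:R^-1 else 0.
pose F j := bump_quadratic (e j) (e j * s) p.
have sF : smooth_family F.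
  have : smooth_family (fun j y => e j * bump_quadratic 1 s p y).
    apply: (@smooth_familyM R 2 (fun j _ => e j) (fun _ => bump_quadratic 1 s p)).
      by apply: smooth_family_scalar; exact: cvg_harmonic.
    exact: smooth_family_single (smooth_bump_quadratic _ _ _).
  congr smooth_family; apply/funext => j; apply/funext => y.
  by rewrite /F /bump_quadratic; ring.
have F0 : F None = fun=> 0 by apply/funext => y; rewrite /F /bump_quadratic /e !mul0r addr0 !mulr0.
have c2 : 0 < c / 2 by rewrite divr_gt0.
have [M _ /(_ M (leqnn M)) FM] := smooth_family_small_jet r k sF F0 c2.
have sFM := sF.1 (Some M).
pose f : Cinfty R 2 := MkCinfty (asboolT sFM : F (Some M) \in @smooth_pred R 2).
have gfE : (g + f : Cinfty R 2) = g \+ F (Some M) :> ('rV[R]_2 -> R) by [].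
have gfp i j y : partial i (partial j (g + f : Cinfty R 2)) y =
    partial i (partial j g) y + partial i (partial j (F (Some M))) y.
  by rewrite gfE (partialD j sg sFM) (partialD i (smooth_partial j sg) (smooth_partial j sFM)).
exists (g + f : Cinfty R 2).
  apply: dO => t tk y.
  have -> : iter_partial t (g + f : Cinfty R 2) y - iter_partial t g y = iter_partial t (F (Some M)) y.
    by rewrite gfE (iter_partialD t sg sFM) /= [_ + iter_partial t _ _]addrC addrK.
  have [yr|yr] := pselect (forall i, `|y 0 i| <= r).
    by rewrite (le_lt_trans (FM t tk y yr))// (lt_le_trans _ (cdelta y yr))//; lra.
  by rewrite far// normr0.
have eM : 0 < e (Some M) by rewrite invr_gt0.
have hp : \det (hessian (g + f : Cinfty R 2) p) = s * e (Some M) ^+ 2.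
  have -> : hessian (g + f : Cinfty R 2) p = hessian (F (Some M)) p.
    apply/matrixP => i j; rewrite [LHS]mxE gfp [RHS]mxE.
    by have := congr1 (fun A : 'M[R]_2 => A i j) gp; rewrite /= [LHS]mxE [RHS]mxE => ->; rewrite add0r.
  by rewrite bump_quadratic_center det2 ![(\matrix_(_, _) _) _ _]mxE /=; ring.
have hq : \det (hessian (g + f : Cinfty R 2) q) = \det (hessian g q).
  have -> // : hessian (g + f : Cinfty R 2) q = hessian g q.
  apply/matrixP => i j; rewrite [LHS]mxE gfp [RHS]mxE.
  have := @bump_quadratic_far (e (Some M)) (e (Some M) * s) p q [:: i; j] 0 q3.
  by rewrite /= -/(F (Some M)) => ->; rewrite addr0.
have e2 : 0 < e (Some M) ^+ 2 by rewrite exprn_gt0.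
case: sq => -[sE dgq]; rewrite sE in hp.
  by exists p, q; split; [rewrite hp mul1r|rewrite hq].
by exists q, p; split; [rewrite hq|rewrite hp mulN1r oppr_lt0].
Qed.

Lemma prod_close (m m' n n' d : R) : d <= 1 -> `|n - m| < d -> `|n' - m'| < d ->
  `|n * n' - m * m'| <= d * (`|m| + `|m'| + 1).
Proof.
move=> d1 nm nm'; have -> : n * n' - m * m' = (n - m) * n' + m * (n' - m') by ring.
rewrite (le_trans (ler_normD _ _))// !normrM.
have n'b : `|n'| <= `|m'| + 1 by have := ler_normD (n' - m') m'; rewrite subrK; lra.
have H1 : `|n - m| * `|n'| <= d * (`|m'| + 1) by apply: ler_pM => //; exact: ltW.
have H2 : `|m| * `|n' - m'| <= d * `|m| by rewrite mulrC ler_wpM2r// ltW.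
lra.
Qed.

Lemma det2_close (M : 'M[R]_2) (e : R) : 0 < e -> exists2 d, 0 < d & forall N : 'M[R]_2,
  (forall i j, `|N i j - M i j| < d) -> `|\det N - \det M| < e.
Proof.
move=> e0; pose S := `|M 0 0| + `|M 1 1| + `|M 0 1| + `|M 1 0|.
have S0 : 0 <= S by rewrite !addr_ge0.
have eS : 0 < e / (S + 3) by rewrite divr_gt0//; lra.
exists (Num.min 1 (e / (S + 3))) => [|N NM]; first by rewrite lt_min ltr01.
set d := Num.min _ _ in NM.
have d1 : d <= 1 by rewrite ge_min lexx.
have d0 : 0 < d by rewrite lt_min ltr01.
have de : d * (S + 3) <= e.
  by rewrite -ler_pdivlMr; [rewrite ge_min lexx orbT|lra].
have P0 := prod_close d1 (NM 0 0) (NM 1 1); have P1 := prod_close d1 (NM 0 1) (NM 1 0).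
rewrite !det2.
have -> : N 0 0 * N 1 1 - N 0 1 * N 1 0 - (M 0 0 * M 1 1 - M 0 1 * M 1 0) =
  (N 0 0 * N 1 1 - M 0 0 * M 1 1) - (N 0 1 * N 1 0 - M 0 1 * M 1 0) by ring.
rewrite (le_lt_trans (ler_normB _ _))// (le_lt_trans (lerD P0 P1))// -mulrDr.
rewrite (lt_le_trans _ de)// ltr_pM2l// /S; lra.
Qed.

Lemma hessian_entry n (g : 'rV[R]_n -> R) y i j : hessian g y i j = iter_partial [:: i; j] g y.
Proof. by rewrite mxE. Qed.

Lemma gt0_of_close (x y : R) : `|x - y| < y -> 0 < x.
Proof. by rewrite ltr_norml => /andP[H _]; lra. Qed.

Lemma lt0_of_close (x y : R) : `|x - y| < - y -> x < 0.
Proof. by rewrite ltr_norml => /andP[_ H]; lra. Qed.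

Definition hessian_sign_change : set (Cinfty R 2) :=
  [set g | exists a b, 0 < \det (hessian g a) /\ \det (hessian g b) < 0].

Lemma open_hessian_sign_change : open hessian_sign_change.
Proof.
move=> g [a [b [ga gb]]].
have [d1 d10 H1] := det2_close (hessian g a) ga.
have gb' : 0 < - \det (hessian g b) by rewrite oppr_gt0.
have [d2 d20 H2] := det2_close (hessian g b) gb'.
exists 2%N, (fun=> Num.min d1 d2); split => [y|y|h hg]; first exact: cst_continuous.
  by rewrite lt_min d10.
have he i j y : `|hessian h y i j - hessian g y i j| < Num.min d1 d2.
  suff -> : hessian h y i j - hessian g y i j = iter_partial [:: i; j] h y - iter_partial [:: i; j] g y.
    exact: (hg [:: i; j] isT).
  by congr (_ - _); exact: hessian_entry.
exists a, b; split.
  apply: (@gt0_of_close _ (\det (hessian g a))); apply: H1 => i j.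
  by rewrite (lt_le_trans (he i j a))// ge_min lexx.
apply: (@lt0_of_close _ (\det (hessian g b))); apply: H2 => i j.
by rewrite (lt_le_trans (he i j b))// ge_min lexx orbT.
Qed.

(** A constant sequence of open dense sets suffices. An open set not contained in P holds a
    degenerate function, and a bump moves it into [hessian_sign_change]; hence the union of that set
    with the interior of P is dense. *)
Lemma generic_nondegenerate : generic (fun g : Cinfty R 2 => ~ degenerate_umbilic g).
Proof.
set P := fun g : Cinfty R 2 => _.
split; last first.
  move=> g h gh Pg Ph; apply: Pg.
  exact: degenerate_umbilic_equivalent (Cinfty_is_smooth g) (Cinfty_is_smooth h) gh Ph.
exists (fun _ => hessian_sign_change `|` interior P) => [_|].
  split; first by apply: openU; [exact: open_hessian_sign_change|exact: open_interior].
  move=> O [g Og] oO.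
  have [OP|] := pselect (O `<=` P).
    by exists g; split => //; right; exists O.
  move=> /existsNP[h /not_implyP[Oh /contrapT dh]].
  have [f Of sf] := bump_perturbation dh oO Oh.
  by exists f; split => //; left.
move=> g /(_ 0%N I)[[a [b [ga gb]]] dg|/interior_subset//].
exact: degenerate_umbilic_no_sign_change (Cinfty_is_smooth g) dg ga gb.
Qed.

End Genericity.

(** The margin between c and e, uniform in y, makes the set open by means of constant error
    functions. *)
Definition uniform_neighbourhood (R : realType) (N : nat) (e : R) : set (Cinfty R 2) :=
  [set h | exists2 c, c < e & forall s : seq 'I_2, (size s <= N)%N -> forall y, `|iter_partial s h y| <= c].

Lemma nbhs_uniform_neighbourhood (R : realType) N (e : R) : 0 < e ->
  nbhs (0 : Cinfty R 2) (uniform_neighbourhood N e).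
Proof.
move=> e0; apply: open_nbhs_nbhs; split.
  move=> h [c ce hc]; exists N, (fun=> (e - c) / 2); split => [y|y|k kh].
  - exact: cst_continuous.
  - by rewrite divr_gt0// subr_gt0.
  exists ((c + e) / 2); first by lra.
  move=> s sN y; have := kh s sN y; have := hc s sN y.
  have := ler_normD (iter_partial s k y - iter_partial s h y) (iter_partial s h y); rewrite subrK; lra.
exists 0 => // s _ y; have -> : (0 : Cinfty R 2) = (fun=> 0) :> ('rV[R]_2 -> R) by [].
by rewrite iter_partial0 normr0.
Qed.

Theorem proposition3p1 (R : realType) :
  (forall y : 'rV[R]_2,
     gradient (@elliptic_umbilic R) y
     = vec2 (y 0 0 ^+ 2 - y 0 1 ^+ 2) (- (2 * y 0 0 * y 0 1))) /\
  exists2 U : set (Cinfty R 2), nbhs (0 : Cinfty R 2) U &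
  exists2 P : set (Cinfty R 2), generic P &
    forall f' : Cinfty R 2, U f' -> P (elliptic_umbilic + f') ->
      diffeomorphic_sets (caustic (elliptic_umbilic + f')) tricuspoid.
Proof.
split; first exact: gradient_elliptic_umbilic.
(* The factor 100 provides the bound on third derivatives and N + 1 the convergence to 0. Bounding
   the orders up to N + 3 covers the third derivatives for every N, and each order eventually. *)
pose e N : R := (100 * N.+1%:R)^-1.
have e0 N : 0 < e N by rewrite invr_gt0 mulr_gt0.
have [[N HN]|H] := pselect (exists N, forall h, uniform_neighbourhood (N + 3) (e N) h ->
    ~ degenerate_umbilic (elliptic_umbilic + h : Cinfty R 2) ->
    diffeomorphic_sets (caustic (elliptic_umbilic + h : Cinfty R 2)) tricuspoid).
  exists (uniform_neighbourhood (N + 3) (e N)); first exact: nbhs_uniform_neighbourhood.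
  by exists (fun g => ~ degenerate_umbilic g); first exact: generic_nondegenerate.
(* A sequence of counterexamples in smaller and smaller neighbourhoods is a family tending to 0. *)
exfalso; have /choice[h hP] N : exists h : Cinfty R 2, [/\ uniform_neighbourhood (N + 3) (e N) h,
    ~ degenerate_umbilic (elliptic_umbilic + h : Cinfty R 2) &
    ~ diffeomorphic_sets (caustic (elliptic_umbilic + h : Cinfty R 2)) tricuspoid].
  apply: contrapT => HN; apply: H; exists N => h hU hd; apply: contrapT => hn.
  by apply: HN; exists h.
have hb m s y : (size s <= m + 3)%N -> `|iter_partial s (h m) y| <= e m.
  by move=> sm; have [[c ce hc] _ _] := hP m; rewrite (le_trans (hc s sm y))// ltW.
have e100 m : e m <= 100^-1.
  rewrite /e lef_pV2 ?posrE ?mulr_gt0//.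
  by rewrite ler_peMr// ler1n.
have eharm m : e m <= @harmonic R m.
  rewrite /e /harmonic/= lef_pV2 ?posrE ?mulr_gt0//.
  by rewrite ler_peMl// ler1n.
have [m mP] : exists m, diffeomorphic_sets (caustic (elliptic_umbilic + h m : Cinfty R 2)) tricuspoid.
  apply: (@small_perturbation_caustic R h harmonic).
  - move=> m i j k y; apply: le_trans (e100 m); apply: (hb m [:: i; j; k]).
    by rewrite leq_addl.
  - move=> m i j y; apply: (@le_trans _ _ 100^-1); last by lra.
    apply: le_trans (e100 m); apply: (hb m [:: i; j]).
    by rewrite (leq_trans _ (leq_addl _ _)).
  - exact: cvg_harmonic.
  - by move=> m; rewrite harmonic_ge0.
  - split=> [m|s]; first exact: Cinfty_is_smooth.
    exists (size s) => // m /= sm y; apply: le_trans (eharm m); apply: hb.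
    by rewrite (leq_trans sm)// leq_addr.
  - by move=> m; have [] := hP m.
by have [_ _] := hP m.
Qed.
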